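(* Let $(G,\mu)$ be an aperiodic pmp groupoid, i.e. a pmp groupoid with $|s^{-1}(x)|=\infty$ for all $x\in G^{(0)}$. Then $G$ is sofic if and only if its full group $[G]$ (with the metric $d_\mu$) is metrically sofic. More precisely, every isometric embedding $\theta:[G]\to\prod_{\mathcal U}\mathfrak S_n$ extends uniquely to an isometric embedding $[[G]]\to\prod_{\mathcal U}[[Y_n^2]]$.
   Context: A groupoid is a small category with all arrows invertible, identified with its set of arrows $G$; $s(g)=g^{-1}g$, $r(g)=gg^{-1}$, the unit space is $G^{(0)}=s(G)=r(G)$, and $gh$ is defined iff $s(g)=r(h)$. A discrete measurable groupoid is a groupoid with a standard Borel structure for which product and inverse are Borel and $s^{-1}(x)$ is countable for all $x\in G^{(0)}$. Its Borel full semigroup $[[G]]_B$ is the set of Borel $\alpha\subseteq G$ such that $s|_\alpha$ and $r|_\alpha$ are injective; it is an inverse monoid with $\alpha\beta=\{ab:a\in\alpha,b\in\beta,s(a)=r(b)\}$, $\alpha^{-1}=\{a^{-1}:a\in\alpha\}$ and unit $G^{(0)}$. A pmp groupoid $(G,\mu)$ is a discrete measurable groupoid $G$ with a Borel probability measure $\mu$ on $G^{(0)}$ such that $\mu(s(\alpha))=\mu(r(\alpha))$ for all $\alpha\in[[G]]_B$. The full semigroup $[[G]]$ is the metric quotient of $[[G]]_B$ under the pseudometric $d_\mu(\alpha,\beta)=\mu(s(\alpha\triangle\beta))$; it inherits the inverse monoid structure. The full group $[G]$ is the image in $[[G]]$ of $\{\alpha\in[[G]]_B:s(\alpha)=r(\alpha)=G^{(0)}\}$,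 with the metric $d_\mu$. Fix a free ultrafilter $\mathcal U$ on $\mathbb N$. For metric spaces $(M_k,d_k)$ of diameter $\le 1$, $\prod_{\mathcal U}M_k$ is the metric quotient of $\prod_kM_k$ under $d_{\mathcal U}((x_k),(y_k))=\lim_{k\to\mathcal U}d_k(x_k,y_k)$. Ultraproducts of full semigroups (full groups) are inverse monoids (groups) with coordinatewise operations. Embeddings are homomorphisms for these structures. A pmp groupoid $G$ is sofic if there are a sequence $(G_k)$ of finite pmp groupoids and an isometric embedding $[[G]]\to\prod_{\mathcal U}[[G_k]]$. For $n\ge1$, $Y_n$ is a set with $n$ elements and $Y_n^2$ is the groupoid of the full equivalence relation on $Y_n$ (product $(x,y)(y,z)=(x,z)$) with normalized counting measure on $Y_n$. Thus $[[Y_n^2]]$ is the inverse monoid of partial bijections of $Y_n$ and $[Y_n^2]=\mathfrak S_n$ is the permutation group, with metric $d(\sigma,\tau)=\frac1n|\{y:\sigma(y)\ne\tau(y)\}|$ on $\mathfrak S_n$. A metric group is metrically sofic if it embeds isometrically (by a group homomorphism) into $\prod_{\mathcal U}\mathfrak S_n$. *)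

(* Defs.v *)
From HB Require Import structures.
From mathcomp Require Import all_boot all_order all_algebra all_fingroup.
From mathcomp Require Import all_classical all_reals all_analysis.

Set Implicit Arguments.
Unset Strict Implicit.
Unset Printing Implicit Defensive.

Import Order.TTheory GRing.Theory Num.Theory.
Import numFieldNormedType.Exports.

Local Open Scope classical_set_scope.
Local Open Scope ring_scope.

(* T is isomorphic to the Borel space of a (nonempty) Polish space; a Hausdorff
   pseudometric is a metric. *)
Definition standard_borel (R : realType) d (T : measurableType d) : Prop :=
  exists (P : completePseudoMetricType R) (phi : T -> P),
    [/\ hausdorff_space P, @second_countable P, bijective phi &
        forall A : set T,
          measurable A <-> exists2 B, <<s @open P >> B & A = phi @^-1` B].

Section Groupoid.
Context {G : Type} (mul : G -> G -> G) (inv : G -> G).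

Definition src (g : G) : G := mul (inv g) g.
Definition rng (g : G) : G := mul g (inv g).
Definition units : set G := range src.
Definition composable : set (G * G) := [set p | src p.1 = rng p.2].

(* [mul] is total; its values outside [composable] are irrelevant. *)
Record is_groupoid : Prop := IsGroupoid {
  ginvK : forall g, inv (inv g) = g;
  gsrcM : forall g h, src g = rng h -> src (mul g h) = src h;
  grngM : forall g h, src g = rng h -> rng (mul g h) = rng g;
  gmulA : forall g h k, src g = rng h -> src h = rng k ->
    mul (mul g h) k = mul g (mul h k);
  gmul_src : forall g, mul g (src g) = g;
  gmul_rng : forall g, mul (rng g) g = g
}.

Definition setmul (A B : set G) : set G :=
  [set g | exists a b, [/\ A a, B b, src a = rng b & g = mul a b]].

End Groupoid.

(* The product is Borel for the trace sigma-algebra on [composable].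
   [measurable_fun composable _] would be too weak here: it holds vacuously
   unless [composable] is already known to be Borel. *)
Record is_discrete_measurable_groupoid (R : realType) d (G : measurableType d)
    (mul : G -> G -> G) (inv : G -> G) : Prop := IsDiscreteMeasurableGroupoid {
  dmg_groupoid : is_groupoid mul inv;
  dmg_standard : standard_borel R G;
  dmg_mul : forall A : set G, measurable A ->
    exists2 B : set (G * G), measurable B &
      forall p, composable mul inv p -> (B p <-> A (mul p.1 p.2));
  dmg_inv : measurable_fun [set: G] inv;
  dmg_fibre : forall x, units mul inv x ->
    countable [set g | src mul inv g = x]
}.

(* The Borel full semigroup [[G]]_B. *)
Definition bisections d (G : measurableType d) (mul : G -> G -> G)
    (inv : G -> G) : set (set G) :=
  [set a | [/\ measurable a, set_inj a (src mul inv) &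
               set_inj a (rng mul inv)]].

(* A Borel probability measure on the unit space is represented by its
   extension by zero to G, a probability measure carried by the units. *)
Record pmpGroupoid (R : realType) := PmpGroupoid {
  pmp_display : measure_display;
  pmp_arrow :> measurableType pmp_display;
  pmp_mul : pmp_arrow -> pmp_arrow -> pmp_arrow;
  pmp_inv : pmp_arrow -> pmp_arrow;
  pmp_dmg : is_discrete_measurable_groupoid R pmp_mul pmp_inv;
  pmp_mu : probability pmp_arrow R;
  pmp_mu_units : pmp_mu (units pmp_mul pmp_inv) = 1%E;
  pmp_mu_invariant : forall a, bisections pmp_mul pmp_inv a ->
    pmp_mu (src pmp_mul pmp_inv @` a) = pmp_mu (rng pmp_mul pmp_inv @` a)
}.

Definition aperiodic (R : realType) (G : pmpGroupoid R) : Prop :=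
  forall x, units (@pmp_mul R G) (@pmp_inv R G) x ->
    infinite_set [set g | src (@pmp_mul R G) (@pmp_inv R G) g = x].

(* The operations of an inverse monoid (or group) with a (pseudo)metric.
   This is a signature only: the axioms are not part of the record. *)
Record metricMonoid (R : realType) := MetricMonoid {
  mm_sort :> Type;
  mdist : mm_sort -> mm_sort -> R;
  mone : mm_sort;
  mmul : mm_sort -> mm_sort -> mm_sort;
  minv : mm_sort -> mm_sort
}.
Arguments mone {R m}.

Record isometric_embedding (R : realType) (X Y : metricMonoid R)
    (f : X -> Y) : Prop := IsometricEmbedding {
  emb_one : f mone = mone;
  emb_mul : forall x y, f (mmul x y) = mmul (f x) (f y);
  emb_inv : forall x, f (minv x) = minv (f x);
  emb_dist : forall x y, mdist (f x) (f y) = mdist x y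
}.

(* The metric quotient: points are the classes {y | d(x, y) = 0}, and the
   operations and the metric are computed on representatives. *)
Section MetricQuotient.
Context {R : realType} (X : metricMonoid R).

Definition zero_class (x : X) : set X := [set y | mdist x y = 0].
Definition mquot_sort : Type := set_type (range zero_class).

Definition mpi (x : X) : mquot_sort :=
  exist _ (zero_class x) (mem_set (imageT zero_class x)).
Definition mrepr (c : mquot_sort) : X := s2val (cid2 (set_mem (valP c))).

Lemma mreprK (c : mquot_sort) : mpi (mrepr c) = c.
Proof. by apply/val_inj => /=; rewrite /mrepr; case: cid2. Qed.

Definition mquot : metricMonoid R := @MetricMonoid R mquot_sort
  (fun c d => mdist (mrepr c) (mrepr d))
  (mpi mone)
  (fun c d => mpi (mmul (mrepr c) (mrepr d)))
  (fun c => mpi (minv (mrepr c))).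

End MetricQuotient.

(* A subset containing the unit, with the induced structure. It is meant for
   subsets closed under the operations, for which [insubd] never resorts to
   its default value. *)
Definition submonoid (R : realType) (X : metricMonoid R) (A : set X)
    (A1 : A mone) : metricMonoid R :=
  let one : set_type A := exist _ mone (mem_set A1) in
  @MetricMonoid R (set_type A)
    (fun x y => mdist (val x) (val y))
    one
    (fun x y => insubd one (mmul (val x) (val y)))
    (fun x => insubd one (minv (val x))).

Section Ultraproduct.
Context {R : realType} (U : set_system nat).

Definition prod_monoid (M : nat -> metricMonoid R) : metricMonoid R :=
  @MetricMonoid R (forall k, M k)
    (fun x y => lim ((fun k => mdist (x k) (y k)) @ U))
    (fun k => mone)
    (fun x y k => mmul (x k) (y k))
    (fun x k => minv (x k)).

Definition ultraprod (M : nat -> metricMonoid R) : metricMonoid R :=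
  mquot (prod_monoid M).

Definition ultraprod_map (M N : nat -> metricMonoid R)
    (f : forall k, M k -> N k) (x : ultraprod M) : ultraprod N :=
  mpi ((fun k => f k (mrepr x k)) : prod_monoid N).

End Ultraproduct.

Section FullSemigroup.
Context {R : realType} (G : pmpGroupoid R).
Local Notation mul := (@pmp_mul R G).
Local Notation inv := (@pmp_inv R G).
Local Notation mu := (@pmp_mu R G).
Local Notation s := (src mul inv).
Local Notation r := (rng mul inv).
Local Notation G0 := (units mul inv).

Let Ggrp : is_groupoid mul inv := dmg_groupoid (pmp_dmg G).

Lemma rng_inv g : r (inv g) = s g.
Proof. by rewrite /rng /src (ginvK Ggrp). Qed.

Lemma src_inv g : s (inv g) = r g.
Proof. by rewrite /rng /src (ginvK Ggrp). Qed.

Lemma src_src g : s (s g) = s g.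
Proof. by rewrite [in X in s X]/src (gsrcM Ggrp) // src_inv. Qed.

Lemma rng_src g : r (s g) = s g.
Proof. by rewrite [in X in r X]/src (grngM Ggrp) ?src_inv // rng_inv. Qed.

Lemma src_rng g : s (r g) = r g.
Proof. by rewrite -src_inv src_src. Qed.

Lemma unitsE : G0 = [set g | s g = g].
Proof.
by apply/seteqP; split=> [_ [g _ <-]|g /= <-]; [exact: src_src|exists g].
Qed.

Lemma image_src_units : s @` G0 = G0.
Proof.
apply/seteqP; split=> [_ [g _ <-]|_ [g _ <-]]; first by exists g.
by exists (s g); [exists g|exact: src_src].
Qed.

Lemma image_rng_units : r @` G0 = G0.
Proof.
apply/seteqP; split=> [_ [_ [g _ <-] <-]|_ [g _ <-]].
  by rewrite rng_src; exists g.
by exists (s g); [exists g|exact: rng_src].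
Qed.

Lemma measurable_src : measurable_fun [set: G] s.
Proof.
move=> _ A mA; rewrite setTI.
have [B mB BA] := dmg_mul (pmp_dmg G) mA.
have -> : s @^-1` A = (fun g => (inv g, g)) @^-1` B.
  apply/seteqP; split => g /=; first by move=> Asg; apply/BA => //=; exact: src_inv.
  by move/BA; apply; exact: src_inv.
rewrite -[X in measurable X]setTI.
apply: (measurable_fun_pair (dmg_inv (pmp_dmg G)) (@measurable_id _ _ setT)) => //.
Qed.

Lemma measurable_units : measurable G0.
Proof.
have [P [phi [hausP [B cB [Bop Bbase]] [psi phiK psiK] mP]]] :=
  dmg_standard (pmp_dmg G).
rewrite unitsE.
have -> : [set g | s g = g] =
    ~` \bigcup_(V in B) ((phi @^-1` V) `\` (s @^-1` (phi @^-1` V))).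
  apply/seteqP; split => g /=.
    by move=> sgg [V BV [/= Vg]]; rewrite sgg.
  apply: contra_notP => /eqP sgg.
  have /hausdorff_accessible hP := hausP.
  have /hP [W [oW /set_mem Wg Ws]] : phi g != phi (s g).
    by apply: contra_neq sgg => e; rewrite -[g in RHS]phiK e phiK.
  have /Bbase[V [BV Vg] VW] : nbhs (phi g) W by apply: open_nbhs_nbhs.
  exists V => //; split => //= /VW Wsg.
  by move: Ws; rewrite in_setC => /negP; apply; exact: mem_set.
apply: measurableC; rewrite bigcup_set_type.
apply: countable_bigcupT_measurable; first by rewrite (eq_countable (card_setT _)).
move=> [V /set_mem BV] /=.
have mV : measurable (phi @^-1` V).
  by apply/mP; exists V => //; apply: sub_sigma_algebra; exact: Bop.
by apply: measurableD => //; rewrite -[X in measurable X]setTI; exact: measurable_src.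
Qed.

Lemma units_bisection : bisections mul inv G0.
Proof.
split; first exact: measurable_units.
- by rewrite unitsE => x y /set_mem /= + /set_mem /= => {2}<- {2}<-.
- by move=> _ _ /set_mem [g _ <-] /set_mem [h _ <-]; rewrite !rng_src.
Qed.

Lemma inv_bisection a : bisections mul inv a -> bisections mul inv (inv @` a).
Proof.
case=> ma sa ra; split.
- have -> : inv @` a = inv @^-1` a.
    apply/seteqP; split=> [_ [g ag <-]|g /= ag]; first by rewrite /= (ginvK Ggrp).
    by exists (inv g) => //; exact: (ginvK Ggrp).
  by rewrite -[X in measurable X]setTI; exact: (dmg_inv (pmp_dmg G)).
- move=> _ _ /set_mem [g ag <-] /set_mem [h ah <-]; rewrite !src_inv => e.
  by congr inv; apply: ra => //; exact: mem_set.
- move=> _ _ /set_mem [g ag <-] /set_mem [h ah <-]; rewrite !rng_inv => e.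
  by congr inv; apply: sa => //; exact: mem_set.
Qed.

Definition bone : bisections mul inv := exist _ G0 (mem_set units_bisection).

Definition binv (a : bisections mul inv) : bisections mul inv :=
  exist _ (inv @` val a) (mem_set (inv_bisection (set_mem (valP a)))).

(* The product of two bisections is a bisection: it is Borel by the
   Lusin-Souslin theorem, so [insubd] never resorts to its default value. *)
Definition bmul (a b : bisections mul inv) : bisections mul inv :=
  insubd bone (setmul mul inv (val a) (val b)).

(* [fine] is harmless: mu is a probability measure. The set to which mu is
   applied is Borel by the Lusin-Souslin theorem. *)
Definition bdist (a b : bisections mul inv) : R :=
  fine (mu (s @` (val a `+` val b))).

Definition borel_full_semigroup : metricMonoid R :=
  MetricMonoid bdist bone bmul binv.

Definition full_semigroup : metricMonoid R := mquot borel_full_semigroup.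

Definition full_group_set : set full_semigroup :=
  [set x | exists a : borel_full_semigroup,
     [/\ s @` (val a) = G0, r @` (val a) = G0 & x = mpi a]].

Lemma full_group_set1 : full_group_set mone.
Proof.
by exists bone; split => //; [exact: image_src_units|exact: image_rng_units].
Qed.

Definition full_group : metricMonoid R := submonoid full_group_set1.

Definition full_group_incl (x : full_group) : full_semigroup :=
  val (x : set_type full_group_set).

End FullSemigroup.

(* The permutation group of 'I_n with the normalized Hamming distance. The
   product is the composition of functions, the opposite of the product of
   MathComp's {perm _}, for which (s * t) y = t (s y). *)
Definition sym_group (R : realType) (n : nat) : metricMonoid R :=
  @MetricMonoid R {perm 'I_n}
    (fun s t => #|[set y : 'I_n | s y != t y]%SET|%:R / n%:R)
    1%g (fun s t => (t * s)%g) (fun s => s^-1%g).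

(* The groupoid Y_n^2 for Y_n := 'I_n and n = m.+1. *)
Definition square (m : nat) : Type := ('I_m.+1 * 'I_m.+1)%type.

HB.instance Definition _ m := Choice.on (square m).
HB.instance Definition _ m := isPointed.Build (square m) (ord0, ord0).
HB.instance Definition _ m := @isMeasurable.Build default_measure_display
  (square m) discrete_measurable discrete_measurable0
  discrete_measurableC discrete_measurableU.

HB.instance Definition _ m := hasNbhs.Build (square m) principal_filter.
HB.instance Definition _ m := Discrete_ofNbhs.Build (square m) erefl.
HB.instance Definition _ m := DiscreteUniform_ofNbhs.Build (square m).
HB.instance Definition _ (R : numDomainType) m :=
  @DiscretePseudoMetric_ofUniform.Build R (square m).

Section Square.
Context (R : realType) (m : nat).
Implicit Types p q : square m.

Definition sq_mul p q : square m := (p.1, q.2).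
Definition sq_inv p : square m := (p.2, p.1).

Lemma sq_src p : src sq_mul sq_inv p = (p.2, p.2).
Proof. by []. Qed.

Lemma sq_rng p : rng sq_mul sq_inv p = (p.1, p.1).
Proof. by []. Qed.

Lemma sq_groupoid : is_groupoid sq_mul sq_inv.
Proof.
split=> [[]//|[x y] [z t] [->]//|[x y] [z t] [->]//|||].
- by move=> [x y] [z t] [u v].
- by case.
- by case.
Qed.

Lemma sq_finite (A : set (square m)) : finite_set A.
Proof. exact: (@finite_finset ('I_m.+1 * 'I_m.+1)%type A). Qed.

Lemma sq_complete (F : set_system (square m)) :
  ProperFilter F -> cauchy F -> cvg F.
Proof.
move=> FF /(_ diagonal).
case; first by move=> /= _ [x _ <-].
move=> [A B] /= [FA FB] AB.
have [x Ax] := filter_ex FA.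
apply: (@cvgP (square m) F x) => C /nbhs_singleton Cx.
apply: (@filterS _ F _ B) FB => y By.
by have <- : x = y := AB (x, y) (conj Ax By).
Qed.

HB.instance Definition _ :=
  Uniform_isComplete.Build (square m) sq_complete.

Lemma sq_standard : standard_borel R (square m).
Proof.
exists (square m), id; split.
- exact: discrete_hausdorff.
- exists (range (fun x : square m => [set x])).
    by apply: finite_set_countable; apply: finite_image; exact: sq_finite.
  split; first by move=> _ [x _ <-]; exact: discrete_open.
  by move=> x A /nbhs_singleton Ax; exists [set x] => [|y ->//]; split=> //; exists x.
- by exists id.
- move=> A; split => // _; exists A => //.
  by apply: sub_sigma_algebra; exact: discrete_open.
Qed.

Lemma sq_dmg : is_discrete_measurable_groupoid R sq_mul sq_inv.
Proof.
split.
- exact: sq_groupoid.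
- exact: sq_standard.
- move=> A _; exists [set p | A (sq_mul p.1 p.2)] => //.
  rewrite -[X in measurable X]image_id -bigcup_imset1.
  apply: fin_bigcup_measurable => [|[p q] _].
    exact: (@finite_finset (square m * square m)%type).
  rewrite (_ : [set (p, q)] = [set p] `*` [set q]); first exact: measurableX.
  by apply/seteqP; split=> [_ ->|[? ?] [/= -> ->]].
- by [].
- by move=> x _; apply: finite_set_countable; exact: sq_finite.
Qed.

(* The normalized counting measure on the units (i, i). *)
Definition sq_mu : set (square m) -> \bar R :=
  mscale (m.+1%:R^-1)%:nng
    (msum (fun i => \d_((inord i, inord i) : square m)) m.+1).

HB.instance Definition _ := Measure.on sq_mu.

Lemma sq_muE (A : set (square m)) :
  sq_mu A = (#|[pred i : 'I_m.+1 | (i, i) \in A]|%:R / m.+1%:R)%:E.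
Proof.
rewrite /sq_mu /mscale /= /msum.
under eq_bigr => i _ do rewrite /= inord_val diracE.
rewrite sumEFin -EFinM mulrC; congr (_ / _)%:E.
rewrite -sum1_card natr_sum [RHS]big_mkcond; apply: eq_bigr => i _.
by rewrite inE; case: (_ \in _).
Qed.

Lemma sq_mu_units : sq_mu (units sq_mul sq_inv) = 1%E.
Proof.
rewrite sq_muE (eq_card (B := predT)) ?card_ord ?divff ?pnatr_eq0 // => i.
by rewrite !inE; apply/mem_set; exists (i, i).
Qed.

Lemma sq_mu_setT : sq_mu [set: square m] = 1%E.
Proof.
rewrite sq_muE (eq_card (B := predT)) ?card_ord ?divff ?pnatr_eq0 // => i.
by rewrite !inE; apply/mem_set.
Qed.

HB.instance Definition _ := Measure_isProbability.Build _ _ _ sq_mu sq_mu_setT.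

Lemma sq_mu_image (f : square m -> 'I_m.+1) (a : set (square m)) :
  set_inj a (fun p => (f p, f p)) ->
  sq_mu ((fun p => (f p, f p)) @` a) =
  (#|[pred p : 'I_m.+1 * 'I_m.+1 | p \in a]|%:R / m.+1%:R)%:E.
Proof.
move=> finj; rewrite sq_muE; congr (_%:R / _)%:E.
rewrite -(card_in_image (f := f)); last first.
  by move=> p q pa qa fpq; apply: (finj p q pa qa) => /=; rewrite fpq.
apply: eq_card => i; rewrite !inE; apply/idP/fintype.imageP.
  by move/set_mem => [p ap [<- _]]; exists p => //; exact: (mem_set ap).
by move=> [p ap ->]; apply/mem_set; exists p => //; exact: (set_mem ap).
Qed.

Lemma sq_mu_invariant a : bisections sq_mul sq_inv a ->
  sq_mu (src sq_mul sq_inv @` a) = sq_mu (rng sq_mul sq_inv @` a).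
Proof. by case=> _ sa ra; rewrite (sq_mu_image sa) (sq_mu_image ra). Qed.

Definition sq_pmp : pmpGroupoid R :=
  PmpGroupoid sq_dmg sq_mu_units sq_mu_invariant.

(* A permutation s is identified with the set of the arrows (s y, y), which
   have source y and range s y. *)
Definition perm_graph (s : {perm 'I_m.+1}) : set (square m) :=
  [set p | p.1 = s p.2].

Lemma perm_graph_bisection s : bisections sq_mul sq_inv (perm_graph s).
Proof.
split=> // -[x y] [z t] /set_mem + /set_mem; rewrite /perm_graph /= => -> ->.
  by move=> [->].
by move=> [/perm_inj ->].
Qed.

Definition perm_incl (s : sym_group R m.+1) : full_semigroup sq_pmp :=
  mpi (exist _ (perm_graph s) (mem_set (perm_graph_bisection s))
       : borel_full_semigroup sq_pmp).

End Square.

Section Soficity.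
Context {R : realType} (U : set_system nat).

Definition sofic (G : pmpGroupoid R) : Prop :=
  exists H : nat -> pmpGroupoid R,
    (forall k, finite_set [set: H k]) /\
    exists f : full_semigroup G -> ultraprod U (fun k => full_semigroup (H k)),
      isometric_embedding f.

(* The indices n >= 1 are enumerated as n = k.+1 with k : nat. *)
Definition sym_ultraprod : metricMonoid R :=
  ultraprod U (fun k => sym_group R k.+1).

Definition square_ultraprod : metricMonoid R :=
  ultraprod U (fun k => full_semigroup (sq_pmp R k)).

Definition metrically_sofic (H : metricMonoid R) : Prop :=
  exists f : H -> sym_ultraprod, isometric_embedding f.

Definition sym_ultraprod_incl : sym_ultraprod -> square_ultraprod :=
  ultraprod_map (fun k => @perm_incl R k).

End Soficity.

(* Main.v *)
From HB Require Import structures.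
From mathcomp Require Import all_boot all_order all_algebra all_fingroup lra.
From mathcomp Require Import all_classical all_reals all_analysis.
Require Import Defs.

(** Injective Borel images are Borel (Lusin-Souslin) and a countable-to-one
    Borel map is injective on each of countably many Borel pieces
    (Lusin-Novikov); so products of bisections are bisections and the groupoid
    is covered by countably many bisections. By measure preservation every
    bisection is almost contained in a full one, and by aperiodicity every
    Borel set A of units is, up to a null set, the support of a full
    bisection h_A.

    Let theta be an isometric embedding of the full group. In permutations, as
    in [G], elements with disjoint supports have a product whose support is
    their union; since theta preserves the measure of supports, it preserves
    disjointness, and the support P_A of theta(h_A) is the complement of that
    of theta(h_B), for B the complement of A. Hence P_A depends only on A, and
    A |-> P_A is an equivariant, measure-preserving homomorphism of Boolean
    algebras. A bisection with source A, almost contained in the full bisection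
    g, is sent to the restriction of theta(g) to P_A; this choice is forced.

    Conversely, a finite pmp groupoid acts by left multiplication on its set of
    arrows. Repeating each arrow a suitable number of times gives an almost
    isometric action on a set with m elements, for all large m. As [G] is
    separable, a diagonal argument turns a sofic approximation of G into
    approximations of [G] by symmetric groups of the prescribed degrees. *)

Set Implicit Arguments.
Unset Strict Implicit.
Unset Printing Implicit Defensive.

Import Order.TTheory GRing.Theory Num.Theory.
Import numFieldNormedType.Exports.

Local Open Scope classical_set_scope.

(** * Souslin schemes *)

(** Lusin-Souslin and Lusin-Novikov are proved with Souslin schemes indexed by finite words. A
    standard Borel space has schemes that decide any countable family of Borel sets at finite depth,
    so a failure of separation can be followed along branches down to their limit points. The
    measurability of products, sources, ranges and saturations rests on this.

    On the permutation side nothing is exact: representatives of the classes of an ultraproduct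
    satisfy identities only up to sets of density 0 along the ultrafilter. Inclusions between such
    sets come from disjointness of supports, and the reverse inclusions from an equality of
    measures.

    In the converse the degrees are imposed, the factor of index k being the symmetric group of
    degree k+1. This is why a finite model must act on sets of every large size, and why the stage
    of the approximation is a function of the degree that tends to infinity. *)

Lemma bigcup_count_measurable d (T : measurableType d) (I : countType)
    (P : set I) (F : I -> set T) :
  (forall i, P i -> measurable (F i)) -> measurable (\bigcup_(i in P) F i).
Proof.
move=> mF; rewrite -[X in measurable X]setTI bigcup_mkcond setTI.
apply: countable_bigcupT_measurable => [|i]; first exact: countableP.
by case: ifPn => // /set_mem; exact: mF.
Qed.

Lemma bigcap_count_measurable d (T : measurableType d) (I : countType)
    (P : set I) (F : I -> set T) :
  (forall i, P i -> measurable (F i)) -> measurable (\bigcap_(i in P) F i).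
Proof.
move=> mF; rewrite -[X in measurable X]setCK setC_bigcap.
by apply: measurableC; apply: bigcup_count_measurable => i /mF; exact: measurableC.
Qed.

Section Scheme.
Context d (T : measurableType d).
Implicit Types (W V : seq nat -> set T) (C D : set T) (B : nat -> set T).

(* The branch condition stands for completeness: every sequence whose prefixes
   are all nonempty nodes has a limit. *)
Record scheme W : Prop := Scheme {
  scheme_meas : forall s, measurable (W s);
  scheme_nil : W [::] = setT;
  scheme_rcons : forall s, W s = \bigcup_n W (rcons s n);
  scheme_branch : forall y : nat -> nat,
    (forall n, W (mkseq y n) !=set0) -> exists x, forall n, W (mkseq y n) x
}.

Definition decides W C : Prop :=
  exists n, forall s, size s = n -> W s `<=` C \/ W s `<=` ~` C.

Definition separates_points B : Prop :=
  forall x y, (forall k, B k x <-> B k y) -> x = y.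

Lemma scheme_cat W s t : scheme W -> W (s ++ t) `<=` W s.
Proof.
move=> sW; elim/last_ind: t => [|t n IH]; first by rewrite cats0.
apply: subset_trans IH => x Wx; rewrite (scheme_rcons sW).
by exists n => //; rewrite rcons_cat.
Qed.

Lemma scheme_mkseq W y m n : scheme W -> (m <= n)%N ->
  W (mkseq y n) `<=` W (mkseq y m).
Proof.
move=> sW mn; rewrite -(subnKC mn) /mkseq iotaD map_cat.
exact: scheme_cat.
Qed.

Lemma scheme_extend W s n x : scheme W -> W s x ->
  exists2 t, size t = n & W (s ++ t) x.
Proof.
move=> sW; elim: n => [|n IH] Wx; first by exists [::]; rewrite ?cats0.
have [t tn] := IH Wx; rewrite (scheme_rcons sW) => -[m _ Wm].
by exists (rcons t m); rewrite ?size_rcons ?tn // -rcons_cat.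
Qed.

Lemma decides_sub W C s n : scheme W ->
  (forall s, size s = n -> W s `<=` C \/ W s `<=` ~` C) ->
  (n <= size s)%N -> W s `<=` C \/ W s `<=` ~` C.
Proof.
move=> sW dC ns.
have /dC : size (take n s) = n by rewrite size_take_min; apply/minn_idPl.
by rewrite -{3 4}(cat_take_drop n s) => -[] H; [left|right];
  apply: subset_trans H; exact: scheme_cat.
Qed.

Lemma decidesC W C : decides W C -> decides W (~` C).
Proof.
by case=> n dC; exists n => s /dC [] H; [right|left]; rewrite ?setCK.
Qed.

Definition prod_dec (i n : nat) : nat := nth 0%N (odflt [::] (unpickle n)) i.

(* A letter codes a finite list of letters; the i-th factor starts reading at
   position i, so that every word of length n involves n factors only. *)
Definition prod_scheme (W : nat -> seq nat -> set T) (s : seq nat) : set T :=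
  \bigcap_i W i (map (prod_dec i) (drop i s)).

Lemma drop_mkseq (A : Type) (f : nat -> A) i n :
  drop i (mkseq f n) = mkseq (fun m => f (m + i)%N) (n - i).
Proof.
rewrite /mkseq -map_drop drop_iota add0n.
have -> : iota i (n - i) = map (addn i) (iota 0 (n - i)) by rewrite -iotaDl addn0.
rewrite -map_comp; by apply: eq_map => m /=; rewrite addnC.
Qed.

(** A branch of the product gives one limit in each factor. These limits are equal: for every [k]
    any two factors decide [B k] at some depth, a point of a common deep node shows that they decide
    alike, and [B] separates points. *)
Lemma prod_schemeP B (W : nat -> seq nat -> set T) :
  separates_points B -> (forall i, scheme (W i)) ->
  (forall i k, decides (W i) (B k)) -> scheme (prod_scheme W).
Proof.
move=> sepB sW dW; split.
- by move=> s; apply: bigcapT_measurable => i; exact: scheme_meas.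
- by rewrite /prod_scheme; under eq_bigcapr do rewrite (scheme_nil (sW _));
    rewrite bigcapT.
- move=> s; apply/seteqP; split => x.
    move=> Wx.
    have /choice[g gP] i : exists n, W i (rcons (map (prod_dec i) (drop i s)) n) x.
      by have := Wx i I; rewrite (scheme_rcons (sW i)) => -[n _]; exists n.
    (* The factors of index at most [size s] read the new letter; the others still have the empty
       word. *)
    exists (pickle (mkseq g (size s).+1)) => // i _.
    have [ii|ii] := leqP i (size s).
      rewrite drop_rcons // map_rcons /prod_dec pickleK /= nth_mkseq //; exact: gP.
    by rewrite drop_oversize ?size_rcons //= (scheme_nil (sW i)).
  case=> n _ Wx i _; have := Wx i I.
  have [ii|ii] := leqP i (size s).
    by rewrite drop_rcons // map_rcons => H; rewrite (scheme_rcons (sW i)); exists (prod_dec i n).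
  by move=> _; rewrite drop_oversize ?(ltnW ii) //= (scheme_nil (sW i)).
- move=> y ne.
  pose yy i m := prod_dec i (y (m + i)%N).
  have E i n : map (prod_dec i) (drop i (mkseq y n)) = mkseq (yy i) (n - i).
    by rewrite drop_mkseq /mkseq -map_comp.
  have /choice[x xP] i : exists x, forall n, W i (mkseq (yy i) n) x.
    apply: scheme_branch => // n; have [x Wx] := ne (n + i)%N.
    by exists x; have := Wx i I; rewrite E addnK.
  exists (x 0%N) => n i _; rewrite E.
  suff -> : x 0%N = x i by exact: xP.
  apply: sepB => k.
  have [n0 d0] := dW 0%N k; have [ni di] := dW i k.
  pose N := (n0 + (ni + i))%N.
  have [z Wz] := ne N.
  have z0 := Wz 0%N I; have zi := Wz i I.
  rewrite E in z0; rewrite E in zi.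
  have x0 := xP 0%N (N - 0)%N; have xi := xP i (N - i)%N.
  have := decides_sub (s := mkseq (yy 0%N) (N - 0)) (sW 0%N) d0.
  have := decides_sub (s := mkseq (yy i) (N - i)) (sW i) di.
  rewrite !size_mkseq.
  have -> : (ni <= N - i)%N by rewrite /N addnA addnK leq_addl.
  have -> : (n0 <= N - 0)%N by rewrite subn0 leq_addr.
  move=> /(_ isT) Hi /(_ isT) H0.
  case: Hi => Hi; case: H0 => H0.
  + by split => _; [exact: Hi|exact: H0].
  + by have := H0 _ z0; have := Hi _ zi.
  + by have := H0 _ z0; have := Hi _ zi.
  + by split => H; exfalso; [exact: H0 H|exact: Hi H].
Qed.

Lemma prod_scheme_decides (W : nat -> seq nat -> set T) i C :
  decides (W i) C -> decides (prod_scheme W) C.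
Proof.
case=> n dC; exists (n + i)%N => s sn.
have /dC : size (map (prod_dec i) (drop i s)) = n.
  by rewrite size_map size_drop sn addnK.
by case=> H; [left|right] => x Wx; apply: H; exact: Wx.
Qed.

Definition decidable_by B C : Prop :=
  exists W, [/\ scheme W, forall k, decides W (B k) & decides W C].

(** The product of one scheme for each index; [W0] fills the numbers that code no index. *)
Lemma decidable_all (I : countType) B (D : I -> set T) :
  separates_points B -> (exists W, scheme W /\ forall k, decides W (B k)) ->
  (forall i, decidable_by B (D i)) ->
  exists W, [/\ scheme W, forall k, decides W (B k) & forall i, decides W (D i)].
Proof.
move=> sepB [W0 [sW0 dW0]] decD.
have /choice[W WP] n : exists W, [/\ scheme W, forall k, decides W (B k) &
    forall i, pickle i = n -> decides W (D i)].
  case: (pselect (exists i : I, pickle i = n)) => [[i <-]|H].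
    have [W [? ? ?]] := decD i; exists W; split=> // j.
    by move/(pcan_inj (@pickleK I)) => ->.
  by exists W0; split=> // i Hi; case: H; exists i.
exists (prod_scheme W); split.
- by apply: (@prod_schemeP B) => // i; case: (WP i).
- by move=> k; apply: (@prod_scheme_decides _ 0%N); case: (WP 0%N).
- by move=> i; apply: (@prod_scheme_decides _ (pickle i)); case: (WP (pickle i)) => _ _; apply.
Qed.

(** The first letter announces the answer: 0 for the complement of the union, [n.+1] for membership
    in [C n]. The rest of the word runs in a scheme that decides every [C n]. A limit cannot
    contradict the announcement, since the contradiction would already show in a nonempty node at a
    finite depth. *)
Lemma decidable_bigcup B (C : nat -> set T) :
  (forall n, measurable (C n)) ->
  separates_points B -> (exists W, scheme W /\ forall k, decides W (B k)) ->
  (forall i, decidable_by B (C i)) -> decidable_by B (\bigcup_n C n).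
Proof.
move=> mC sepB baseB decC.
have [W [sW dB dC]] := decidable_all sepB baseB decC.
pose E n := if n is m.+1 then C m else ~` \bigcup_n C n.
have mE n : measurable (E n).
  by case: n => [|n] //=; apply: measurableC; exact: bigcup_measurable.
pose V s := if s is n :: s' then W s' `&` E n else setT.
exists V; split.
- split.
  + by move=> [|n s] //=; apply: measurableI => //; exact: scheme_meas.
  + by [].
  + case=> [|n s] /=.
      apply/seteqP; split=> x // _; case: (pselect ((\bigcup_n C n) x)) => [[n _ Cx]|nC].
        by exists n.+1 => //=; rewrite (scheme_nil sW).
      by exists 0%N => //=; rewrite (scheme_nil sW).
    by rewrite (scheme_rcons sW s) setI_bigcupl.
  + move=> y ne; pose y' n := y n.+1.
    have E' n : mkseq y n.+1 = y 0%N :: mkseq y' n.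
      by rewrite /mkseq /= -[1%N]addn0 iotaDl -map_comp.
    have ne' n : (W (mkseq y' n) `&` E (y 0%N)) !=set0.
      by have := ne n.+1; rewrite E'.
    have [x Wx] : exists x, forall n, W (mkseq y' n) x.
      by apply: scheme_branch => // n; have [x []] := ne' n; exists x.
    exists x; case=> [|n] //; rewrite E' /=; split => //.
    have key i : exists n, W (mkseq y' n) `<=` C i \/ W (mkseq y' n) `<=` ~` C i.
      by have [p dp] := dC i; exists p; apply: dp; rewrite size_mkseq.
    case: (y 0%N) ne' => [|k] ne' /=.
      move=> -[i _ Ci]; have [m [] H] := key i.
        by have [z [Wz []]] := ne' m; exists i => //; exact: H.
      by have := H _ (Wx m).
    have [m [] H] := key k; first exact: H.
    by have [z [/H Wz]] := ne' m.
- move=> k; have [n dn] := dB k; exists n.+1 => -[|m s] //= [sn].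
  by have [] := dn _ sn; [left|right] => x [Wx _]; auto.
- exists 1%N => -[|n [|? ?]] //= _; case: n => [|n]; [right|left] => x [_ Ex] //.
  by exists n.
Qed.

(** The form in which standardness is used from here on. It forgets the Polish topology and keeps a
    countable family that separates points and generates the Borel sets, together with schemes
    deciding this family and any other countable family of Borel sets. *)
Definition standard_base B : Prop :=
  [/\ forall k, measurable (B k), separates_points B,
      forall A, measurable A -> <<s range B >> A &
      forall (I : countType) (D : I -> set T), (forall i, measurable (D i)) ->
      exists W, [/\ scheme W, forall k, decides W (B k) & forall i, decides W (D i)]].

(** The Borel sets decided by some scheme that also decides [B] form a sigma-algebra containing [B],
    hence are all the Borel sets; [decidable_all] then treats countably many of them at once. *)
Lemma scheme_standard_base B :
  (forall k, measurable (B k)) -> separates_points B ->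
  (forall A, measurable A -> <<s range B >> A) ->
  (exists W, scheme W /\ forall k, decides W (B k)) ->
  standard_base B.
Proof.
move=> mB sepB genB baseB; split => // I D mD.
apply: decidable_all => // i.
have [W0 [sW0 dW0]] := baseB.
suff : [set A | measurable A /\ decidable_by B A] (D i) by case.
move: (genB _ (mD i)); apply: smallest_sub; last first.
  by move=> _ [k _ <-]; split => //; exists W0.
split.
- split => //; exists W0; split => //; exists 0%N => s _; right=> x _ [].
- move=> A [mA [W [? ? dA]]]; rewrite setTD; split; first exact: measurableC.
  by exists W; split=> //; exact: decidesC.
- move=> F FP; split; first by apply: bigcup_measurable => n _; case: (FP n).
  by apply: decidable_bigcup => // n; case: (FP n).
Qed.

End Scheme.

(** * A scheme on a complete separable metric space *)

Section PolishScheme.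
Context {R : realType} (P : completePseudoMetricType R) (O : nat -> set P).
Hypothesis Oopen : forall k, open (O k).
Hypothesis Obasis : forall x V, nbhs x V -> exists k, O k x /\ O k `<=` V.
Local Open Scope ring_scope.

(** Countably many closed sets covering the space, each contained in [O k] or in its complement. The
    factor [[set _ | _]] empties the letters whose closure is not inside [O k]. *)
Definition decision_cover k a : set P :=
  if a is b.+1 then closure (O b) `&` [set _ | closure (O b) `<=` O k]
  else ~` O k.

Definition small_cover k b : set P := closure (O b) `&`
  [set _ | forall x y, closure (O b) x -> closure (O b) y -> ball x k.+1%:R^-1 y].

(** The letter at position [k] codes one index for each of the two covers of number [k]: the first
    decides [O k], the second consists of sets of diameter at most [1/(k+1)]. *)
Definition polish_scheme (s : seq nat) : set P :=
  \bigcap_(k in [set k | (k < size s)%N])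
    (decision_cover k (odflt (0, 0) (unpickle (nth 0 s k))).1%N `&`
     small_cover k (odflt (0, 0) (unpickle (nth 0 s k))).2%N).

Lemma closedI_cst (A : set P) (Q : Prop) : closed A -> closed (A `&` [set _ | Q]).
Proof.
move=> cA; case: (pselect Q) => q; first by rewrite (_ : [set _ | _] = setT) ?setIT // -subTset.
by rewrite (_ : [set _ | _] = set0) ?setI0 //; [exact: closed0|rewrite -subset0].
Qed.

Lemma decision_cover_closed k a : closed (decision_cover k a).
Proof.
case: a => [|b]; first exact/open_closedC.
by apply: closedI_cst; exact: closed_closure.
Qed.

Lemma small_cover_closed k a : closed (small_cover k a).
Proof. by apply: closedI_cst; exact: closed_closure. Qed.

Lemma basis_closure x V : nbhs x V -> exists k, O k x /\ closure (O k) `<=` V.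
Proof.
move=> /uniform_regular [U xU UV]; have [k [kx kU]] := Obasis xU.
by exists k; split => //; apply: subset_trans UV; exact: closureS.
Qed.

Lemma decision_cover_bigcup k x : exists a, decision_cover k a x.
Proof.
case: (pselect (O k x)) => [Ox|nOx]; last by exists 0%N.
have [|b [bx bO]] := @basis_closure x (O k); first exact: open_nbhs_nbhs.
by exists b.+1; split => //; exact: subset_closure.
Qed.

Lemma small_cover_bigcup k x : exists a, small_cover k a x.
Proof.
have e0 : 0 < k.+1%:R^-1 :> R by rewrite invr_gt0.
have [|b [bx bO]] := @basis_closure x (ball x (k.+1%:R^-1 / 2)).
  by apply: nbhsx_ballx; rewrite divr_gt0.
exists b; split; first exact: subset_closure.
by move=> y z /bO xy /bO xz; exact: ball_splitr xy xz.
Qed.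

(** Points chosen in the successive nodes form a Cauchy sequence because of the small covers; the
    limit stays in the nodes because all the covers are closed. *)
Lemma polish_scheme_branch y : (forall n, polish_scheme (mkseq y n) !=set0) ->
  exists x, forall n, polish_scheme (mkseq y n) x.
Proof.
move=> /choice[x xP].
pose F k := (decision_cover k (odflt (0, 0) (unpickle (y k))).1%N `&`
             small_cover k (odflt (0, 0) (unpickle (y k))).2%N).
have xF k n : (k < n)%N -> F k (x n).
  by move=> kn; have := xP n k; rewrite /= size_mkseq nth_mkseq // /F; apply.
have cx : cvg (x @ \oo).
  apply/cauchy_cvgP/cauchy_exP => e e0.
  have [k ke] : exists k, k.+1%:R^-1 < e :> R.
    exists (Num.truncn e^-1); rewrite invf_plt ?posrE //.
    by have := truncnS_gt e^-1.
  exists (x k.+1); exists k.+1 => // n /= kn; apply: (@le_ball _ _ _ k.+1%:R^-1); first exact: ltW.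
  have [_ [x1 small]] := xF k k.+1 (leqnn _); have [_ [x2 _]] := xF k n kn.
  exact: small.
exists (lim (x @ \oo)) => n k /=; rewrite size_mkseq => kn; rewrite nth_mkseq //.
apply: (@closed_cvg _ _ \oo _ x (F k)) => //.
- by apply: closedI; [exact: decision_cover_closed|exact: small_cover_closed].
- by exists k.+1 => // m /=; exact: xF.
Qed.

Lemma polish_scheme_rcons s :
  polish_scheme s = \bigcup_n polish_scheme (rcons s n).
Proof.
apply/seteqP; split=> [x Wx|x [n _ Wx] k /= ks]; last first.
  by have := Wx k; rewrite /= size_rcons nth_rcons ks ltnS (ltnW ks); apply.
have [a ax] := decision_cover_bigcup (size s) x.
have [b bx] := small_cover_bigcup (size s) x.
exists (pickle (a, b)) => // k /=; rewrite size_rcons ltnS nth_rcons leq_eqVlt.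
case/orP=> [/eqP ->|ks]; first by rewrite ltnn eqxx pickleK.
by rewrite ks; exact: Wx.
Qed.

Lemma polish_scheme_decides k s : size s = k.+1 ->
  polish_scheme s `<=` O k \/ polish_scheme s `<=` ~` O k.
Proof.
move=> sk; have H x : polish_scheme s x ->
    decision_cover k (odflt (0, 0) (unpickle (nth 0 s k))).1%N x.
  by move=> Wx; have /= := Wx k; rewrite sk ltnS leqnn => /(_ isT) [].
case: (odflt _ _).1 H => [|b] /= H; first by right.
by left => x /H [cx]; apply.
Qed.

End PolishScheme.

Lemma standard_borel_base (R : realType) d (T : measurableType d) :
  standard_borel R T -> exists B : nat -> set T, standard_base B.
Proof.
case=> P [phi [hausP [B cB [Bop Bbase]] [psi phiK psiK] mP]].
have [f finj] := (elimT (countable_injP _) cB).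
(* [O] lists the basis through the injection [f]; an index that is not a value of [f] gives the
   empty set. *)
pose O k := \bigcup_(V in [set V | B V /\ f V = k]) V.
have OE V : B V -> O (f V) = V.
  move=> BV; apply/seteqP; split=> [x [V' [BV' e] V'x]|x Vx]; last by exists V.
  by rewrite -(finj _ _ (mem_set BV') (mem_set BV) e).
have Oopen k : open (O k) by apply: bigcup_open => V [BV _]; exact: Bop.
have Obasis x V : nbhs x V -> exists k, O k x /\ O k `<=` V.
  by move=> /Bbase[U [BU Ux] UV]; exists (f U); rewrite OE.
have mO U : open U -> measurable (phi @^-1` U).
  by move=> oU; apply/mP; exists U => //; exact: sub_sigma_algebra.
exists (fun k => phi @^-1` O k); apply: scheme_standard_base.
- by move=> k; exact: mO.
- move=> x y xy; apply: (can_inj phiK); apply: hausP => U V /Obasis[k [kx kU]] Vy.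
  exists (phi y); split; last exact: nbhs_singleton.
  by apply: kU; exact/xy.
- move=> _ /mP[A sA ->].
  suff : [set A | <<s range (fun k => phi @^-1` O k) >> (phi @^-1` A)] A by [].
  move: A sA; apply: smallest_sub.
    have [s0 sD sU] := smallest_sigma_algebra setT (range (fun k => phi @^-1` O k)).
    split=> [|A /sD|F /sU]; first by rewrite /= preimage_set0.
      by rewrite /= !setTD preimage_setC.
    by rewrite /= preimage_bigcup.
  move=> U oU /=.
  have -> : U = \bigcup_(k in [set k | O k `<=` U]) O k.
    apply/seteqP; split=> [x Ux|x [k kU]]; last exact: kU.
    by have [|k [kx kU]] := Obasis x U; [exact: open_nbhs_nbhs|exists k].
  rewrite bigcup_mkcond preimage_bigcup.
  have [s0 sD sU] := smallest_sigma_algebra setT (range (fun k => phi @^-1` O k)).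
  apply: sU => k; case: ifPn => _; last by rewrite preimage_set0.
  by apply: sub_sigma_algebra; exists k.
- exists (fun s => phi @^-1` polish_scheme O s); split; last first.
    by move=> k; exists k.+1 => s /(@polish_scheme_decides _ _ O) [] H; [left|right] => x; exact: H.
  split.
  + move=> s; rewrite preimage_bigcap; apply: bigcap_measurableType => k _.
    rewrite preimage_setI; have mC (C : set P) : closed C -> measurable (phi @^-1` C).
      move=> /closed_openC oC; rewrite -[C]setCK preimage_setC.
      by apply: measurableC; exact: (mO _ oC).
    by apply: measurableI; apply: mC;
      [apply: (decision_cover_closed Oopen)|exact: small_cover_closed].
  + by apply/seteqP; split=> // x _ k.
  + by move=> s; rewrite (polish_scheme_rcons Oopen Obasis) preimage_bigcup.
  + move=> y ne; have [|x Wx] := @polish_scheme_branch _ _ O Oopen y.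
      by move=> n; have [x Wx] := ne n; exists (phi x).
    by exists (psi x) => n /=; rewrite psiK.
Qed.

(** * Separation and injective images *)

Lemma dep_choice (A : Type) (P : A -> Prop) (S : A -> A -> Prop) a0 :
  P a0 -> (forall a, P a -> exists2 b, P b & S a b) ->
  exists u : nat -> A, [/\ u 0%N = a0, forall n, P (u n) & forall n, S (u n) (u n.+1)].
Proof.
move=> Pa0 PS.
have /choice[g gP] (a : {a | P a}) : exists b : {a | P a}, S (sval a) (sval b).
  by case: a => a Pa /=; have [b Pb Sab] := PS a Pa; exists (exist _ b Pb).
pose u n := iter n g (exist _ a0 Pa0).
by exists (fun n => sval (u n)); split=> [//|n|n]; [exact: svalP|exact: gP].
Qed.

Section Images.
Context d (T : measurableType d) d' (X : measurableType d').
Variables (B : nat -> set T) (D : nat -> set X) (f : T -> X).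
Hypothesis baseB : standard_base B.
Hypothesis mD : forall k, measurable (D k).
Hypothesis sepD : separates_points D.
Hypothesis mf : measurable_fun setT f.

Let mfD k : measurable (f @^-1` D k).
Proof. by rewrite -[X in measurable X]setTI; exact: mf. Qed.

(* Were the images not separable, a node of the product tree that is not
   separable would always have a child that is not, and the resulting branches
   would have limits whose images are pairwise inseparable by the D k. *)
Lemma separation (J : finType) (A : J -> set T) :
  (forall j, measurable (A j)) ->
  (forall x, exists j, forall y, A j y -> f y <> x) ->
  exists Y : J -> set X, [/\ forall j, measurable (Y j),
    forall j y, A j y -> Y j (f y) & forall x, exists j, ~ Y j x].
Proof.
move=> mA disjA; have [_ _ _ decB] := baseB.
have [W [sW _ decW]] := decB _
  (fun i : J + nat => match i with inl j => A j | inr k => f @^-1` D k end)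
  (fun i => match i with inl j => mA j | inr k => mfD k end).
pose separable (u : J -> seq nat) := exists Y : J -> set X,
  [/\ forall j, measurable (Y j), forall j y, W (u j) y -> A j y -> Y j (f y)
     & forall x, exists j, ~ Y j x].
apply: contrapT => nsepA.
have nsep0 : ~ separable (fun=> [::]).
  move=> [Y [mY AY Y0]]; apply: nsepA; exists Y; split=> // j y Ay.
  by apply: AY => //; rewrite (scheme_nil sW).
have step u : ~ separable u ->
    exists2 v, ~ separable v & exists n : J -> nat, v = fun j => rcons (u j) (n j).
  move=> nsep; apply: contrapT => H; apply: nsep.
  have /choice[Y YP] (n : {ffun J -> nat}) : exists Y : J -> set X,
      [/\ forall j, measurable (Y j),
      forall j y, W (rcons (u j) (n j)) y -> A j y -> Y j (f y)
     & forall x, exists j, ~ Y j x].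
    apply: contrapT => H'; apply: H; exists (fun j => rcons (u j) (n j)) => //.
    by exists n.
  (* Each choice [n] of one letter for every [j] gives separators of the children. For the parent, a
     point must lie, for some letter, in the separators of all the choices having that letter at
     [j]. A point common to all [j] would select a choice [n] whose own separators have a common
     point. *)
  exists (fun j => \bigcup_(m in [set: nat])
    \bigcap_(n in [set n : {ffun J -> nat} | n j = m]) Y n j).
  split.
  - move=> j; apply: bigcup_measurable => m _.
    by apply: bigcap_count_measurable => n _; case: (YP n).
  - move=> j y; rewrite (scheme_rcons sW) => -[m _ Wy] Ay; exists m => // n /= nj.
    by have [_ + _] := YP n; apply => //; rewrite nj.
  - move=> x; apply: contrapT => /forallNP H2.
    have /choice[n nP] j : exists m, (\bigcap_(n in [set n : {ffun J -> nat} | n j = m]) Y n j) x.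
      by have /contrapT[m _ ?] := H2 j; exists m.
    have [_ _ /(_ x)[j]] := YP (finfun n); apply.
    by apply: nP => /=; rewrite ffunE.
have [U [U0 nsepU stepU]]  :=
  @dep_choice _ (fun u => ~ separable u)
    (fun u v => exists n : J -> nat, v = fun j => rcons (u j) (n j)) _ nsep0 step.
have [n nP] := choice stepU.
pose y j m := n m j.
have UE m j : U m j = mkseq (y j) m.
  by elim: m => [|m IH]; rewrite ?U0 // nP IH mkseqS.
have decA m j : (forall s, size s = m -> W s `<=` A j \/ W s `<=` ~` A j) ->
    W (mkseq (y j) m) `<=` A j.
  move=> dA; have [|//|WA] := dA (mkseq (y j) m); first by rewrite size_mkseq.
  (* A node that misses [A j] makes the tuple separable: the empty set serves for [j] and the whole
     space for the other indices. *)
  exfalso; apply: (nsepU m); exists (fun i => if i == j then set0 else setT); split.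
  - by move=> i; case: ifP.
  - by move=> i z; case: eqP => [->|//]; rewrite UE => /WA.
  - by move=> x; exists j; rewrite eqxx.
have /choice[x xP] j : exists x, A j x /\ forall m, W (mkseq (y j) m) x.
  have [x Wx] : exists x, forall m, W (mkseq (y j) m) x.
    apply: scheme_branch => // m; apply/set0P/negP => /eqP W0.
    apply: (nsepU m); exists (fun i => if i == j then set0 else setT); split.
    - by move=> i; case: ifP.
    - by move=> i z; case: eqP => [->|//]; rewrite UE W0.
    - by move=> z; exists j; rewrite eqxx.
  by have [m dm] := decW (inl j); exists x; split=> //; apply: (decA m).
have [j0 _] := disjA point.
have [j jP] := disjA (f (x j0)).
have /eqP : f (x j) <> f (x j0) by apply: jP; case: (xP j).
apply/negP; rewrite negbK; apply/eqP; apply: sepD => k.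
have [m dm] := decW (inr k).
have side i : W (mkseq (y i) m) `<=` f @^-1` D k \/ W (mkseq (y i) m) `<=` ~` (f @^-1` D k).
  by apply: dm; rewrite size_mkseq.
(* If [D k] contained the image of one node and missed that of another, then [D k] and its
   complement would separate the tuple. *)
have key i i' : W (mkseq (y i) m) `<=` f @^-1` D k ->
    W (mkseq (y i') m) `<=` ~` (f @^-1` D k) -> False.
  move=> Hi Hi'; apply: (nsepU m).
  exists (fun l => if l == i then D k else if l == i' then ~` D k else setT); split.
  - by move=> l; case: ifP => // _; case: ifP => // _; exact: measurableC.
  - move=> l z; rewrite UE; case: eqP => [->|_]; first by move=> /Hi.
    by case: eqP => [->|//]; move=> /Hi'.
  - move=> z; case: (pselect (D k z)) => Dz; last by exists i; rewrite eqxx.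
    exists i'; case: eqP => [e|_]; last by rewrite eqxx; apply.
    move=> _; have [_ /(_ m) Wx] := xP i'; apply: (Hi' _ Wx).
    by rewrite e in Wx *; exact: Hi.
have [_ /(_ m) Wj] := xP j; have [_ /(_ m) W0] := xP j0.
case: (side j) => Hj; case: (side j0) => H0.
- by split=> _; [exact: H0|exact: Hj].
- by have := key _ _ Hj H0.
- by have := key _ _ H0 Hj.
- by split=> H; exfalso; [exact: Hj H|exact: H0 H].
Qed.

(** Lusin separation of two analytic sets: disjoint images have no common point, which is the
    hypothesis of [separation] for a family indexed by [bool]. *)
Lemma separation2 (A1 A2 : set T) : measurable A1 -> measurable A2 ->
  (forall y z, A1 y -> A2 z -> f y <> f z) ->
  exists Y : set X, [/\ measurable Y, forall y, A1 y -> Y (f y) &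
                        forall z, A2 z -> ~ Y (f z)].
Proof.
move=> m1 m2 A12.
have [||Y [mY AY Y0]] := @separation bool (fun b => if b then A1 else A2).
- by case.
- move=> x; case: (pselect (exists2 y, A1 y & f y = x)) => [[y Ay <-]|H].
    by exists false => z Az /esym; exact: A12.
  by exists true => y Ay fy; apply: H; exists y.
exists (Y true); split=> [//|y|z]; first exact: (AY true).
by move=> Az Yz; have [[] H] := Y0 (f z); apply: H => //; exact: (AY false).
Qed.

(** The points whose leftmost word is [s]: at such a point no proper prefix of [s] can be continued
    by a smaller letter. It turns a scheme, whose siblings may overlap, into a partition at each
    length. *)
Definition first_word (W : seq nat -> set T) (s : seq nat) : set T :=
  W s `\` \bigcup_(p in [set p : nat * nat | (p.1 < size s)%N /\ (p.2 < nth 0 s p.1)%N])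
    W (rcons (take p.1 s) p.2).

Lemma first_word_meas W s : scheme W -> measurable (first_word W s).
Proof.
move=> sW; apply: measurableD; first exact: scheme_meas.
by apply: bigcup_count_measurable => p _; exact: scheme_meas.
Qed.

Lemma first_word_take W s m x : scheme W -> (m <= size s)%N ->
  first_word W s x -> first_word W (take m s) x.
Proof.
move=> sW ms [Wx nx]; split.
  by move: Wx; rewrite -{1}(cat_take_drop m s); exact: scheme_cat.
move=> [[i k] /= []]; rewrite size_takel // => im; rewrite nth_take // => kn.
rewrite take_takel; last exact: ltnW.
by move=> H; apply: nx; exists (i, k) => //=; rewrite (leq_trans im ms).
Qed.

Lemma first_word_inj W s t x : scheme W -> size s = size t ->
  first_word W s x -> first_word W t x -> s = t.
Proof.
move=> sW st Vs Vt.
suff H m : (m <= size s)%N -> take m s = take m t.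
  by have := H _ (leqnn _); rewrite {2}st !take_size.
elim: m => [|m IH] ms; first by rewrite !take0.
have mt : (m < size t)%N by rewrite -st.
rewrite !(take_nth 0%N) // (IH (ltnW ms)); congr rcons.
have aux u v : size u = size v -> (m < size u)%N -> take m u = take m v ->
    first_word W u x -> first_word W v x -> ~~ (nth 0 u m < nth 0 v m)%N.
  move=> uv mu e [Wu _] [_ nv]; apply/negP => lt; apply: nv.
  exists (m, nth 0%N u m) => /=; first by rewrite -uv.
  rewrite -e -take_nth //; move: Wu; rewrite -{1}(cat_take_drop m.+1 u).
  exact: scheme_cat.
have e := IH (ltnW ms).
have h1 := aux s t st ms e Vs Vt; have h2 := aux t s (esym st) mt (esym e) Vt Vs.
by apply: anti_leq; rewrite leqNgt h2 leqNgt h1.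
Qed.

Lemma first_word_cover W n x : scheme W ->
  exists2 s, size s = n & first_word W s x.
Proof.
move=> sW; elim: n => [|n [s sn [Wx nx]]].
  by exists [::] => //; split; rewrite ?(scheme_nil sW) // => -[[]] ? ? [].
have ex : exists m, `[<W (rcons s m) x>].
  by move: Wx; rewrite (scheme_rcons sW) => -[m _ ?]; exists m; apply/asboolP.
case: (ex_minnP ex) => m /asboolP Wm min; exists (rcons s m); first by rewrite size_rcons sn.
split=> // -[[i k] /=]; rewrite size_rcons ltnS leq_eqVlt => -[/predU1P[->|im]].
  rewrite nth_rcons ltnn eqxx -[in take _ _]cats1 take_size_cat // => km Wk.
  by have := min k; rewrite leqNgt km => H; suff: false by []; apply: H; apply/asboolP.
rewrite nth_rcons im => km Wk; apply: nx; exists (i, k) => //=.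
by move: Wk; rewrite -[in take _ _]cats1 takel_cat // ltnW.
Qed.

(** By injectivity the images of the pieces [V s] of one length are disjoint, so separation encloses
    them in disjoint Borel sets [E s]. A point that lies at each length in some [E s], together with
    the sets of all prefixes of [s], determines a branch; the limit of this branch lies in [A] and
    is sent to the point. Hence the image is obtained from the [E s] by countable operations. *)
Lemma injective_image_measurable (A : set T) : measurable A -> set_inj A f ->
  measurable (f @` A).
Proof.
move=> mA injA; have [_ _ _ decB] := baseB.
have [W [sW _ decW]] := decB _
  (fun i : option nat => if i is Some k then f @^-1` D k else A)
  (fun i => match i with None => mA | Some k => mfD k end).
pose V s := first_word W s `&` A.
have mV s : measurable (V s) by apply: measurableI => //; exact: first_word_meas.
have /choice[K KP] (p : seq nat * seq nat) : exists Y : set X, measurable Y /\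
    (size p.1 = size p.2 -> p.1 <> p.2 ->
     (forall y, V p.1 y -> Y (f y)) /\ (forall z, V p.2 z -> ~ Y (f z))).
  case: (pselect (size p.1 = size p.2 /\ p.1 <> p.2)) => [[e ne]|H]; last first.
    by exists set0; split => // e ne; case: H.
  have [||y z [Vy Ay] [Vz Az] fyz|Y [? ? ?]] := @separation2 (V p.1) (V p.2) => //.
    have yz : y = z by apply: injA => //; exact: mem_set.
    by apply: ne; apply: (@first_word_inj W _ _ y) => //; rewrite yz.
  by exists Y.
(* Besides separating [s] from the other words of its length, [E s] records that the node meets [A],
   and on which side of each [D k] decided by the node the point lies. The latter identifies the
   point with the image of the limit. *)
pose E s := [set x | W s `&` A !=set0] `&`
  (\bigcap_(t in [set t | size t = size s /\ t <> s]) (K (s, t) `\` K (t, s)) `&`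
  ((\bigcap_(k in [set k | W s `<=` f @^-1` D k]) D k) `&`
  (\bigcap_(k in [set k | W s `<=` ~` (f @^-1` D k)]) ~` D k))).
have mE s : measurable (E s).
  apply: measurableI.
    case: (pselect (W s `&` A !=set0)) => H.
      by rewrite (_ : [set _ | _] = setT) // -subTset.
    by rewrite (_ : [set _ | _] = set0) // -subset0.
  apply: measurableI.
    apply: bigcap_count_measurable => t _.
    by apply: measurableD; [case: (KP (s, t))|case: (KP (t, s))].
  apply: measurableI; apply: bigcap_count_measurable => k _ //.
  exact: measurableC.
have VE s y : V s y -> E s (f y).
  move=> Vy; have [[Wy _] Ay] := Vy; split; first by exists y.
  split; last by split=> k /=; apply.
  move=> t [st ts]; split.
    have [_ H] := KP (s, t); have [||H1 _] := H; [exact: esym|by move=> /esym|].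
    exact: H1.
  by have [_ H] := KP (t, s); have [//|//|_ H2] := H; exact: H2.
have Edisj s t x : size s = size t -> E s x -> E t x -> s = t.
  move=> st [_ [Es _]] [_ [Et _]]; apply: contrapT => ne.
  have [|_] := Es t; first by split => // e; apply: ne.
  by have [|] := Et s.
have -> : f @` A = \bigcap_n \bigcup_(s in [set s | size s = n])
    \bigcap_(m in [set m | (m <= size s)%N]) E (take m s).
  apply/seteqP; split=> [_ [y Ay <-] n _|x Hx].
    have [s sn Vy] := first_word_cover n y sW; exists s => // m /= ms.
    by apply: VE; split=> //; exact: first_word_take.
  have /choice[s sP] n : exists s, size s = n /\ forall m, (m <= n)%N -> E (take m s) x.
    by have [s /= sn Es] := Hx n I; exists s; split=> // m; rewrite -sn; exact: Es.
  have sn n : size (s n) = n by case: (sP n).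
  have coh m n : (m <= n)%N -> take m (s n) = s m.
    move=> mn; apply: (@Edisj _ _ x); first by rewrite size_takel ?sn.
      by have [_] := sP n; apply.
    by have [_ /(_ m (leqnn m))] := sP m; rewrite take_oversize ?sn.
  pose y n := nth 0%N (s n.+1) n.
  have sy n : s n = mkseq y n.
    elim: n => [|n IH]; first exact: size0nil.
    rewrite mkseqS -IH -(coh n n.+1) // -take_nth ?sn // take_oversize ?sn //.
  have Ey n : E (mkseq y n) x.
    by rewrite -sy; have [_ /(_ n (leqnn n))] := sP n; rewrite take_oversize ?sn.
  have [z Wz] : exists z, forall n, W (mkseq y n) z.
    by apply: scheme_branch => // n; have [[z [Wz _]] _] := Ey n; exists z.
  exists z.
    have [n dn] := decW None; have [[t [Wt At]] _] := Ey n.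
    have [|/(_ _ (Wz n))//|/(_ _ Wt)//] := dn (mkseq y n).
    by rewrite size_mkseq.
  apply: sepD => k; have [n dn] := decW (Some k).
  have [_ [_ [E1 E2]]] := Ey n.
  have [|H|H] := dn (mkseq y n); first by rewrite size_mkseq.
    by split => _; [exact: E1|exact: H].
  by split=> Dk; exfalso; [exact: (H z (Wz n))|exact: (E2 k H)].
apply: bigcapT_measurable => n; apply: bigcup_count_measurable => s _.
by apply: bigcap_count_measurable => m _; exact: mE.
Qed.

End Images.

(** * Countable-to-one maps *)

Lemma cantor_nat (h : (nat -> bool) -> nat) : ~ injective h.
Proof.
move=> hinj.
pose z n := `[<exists2 z', h z' = n & z' n = false>].
have : z (h z) = ~~ z (h z).
  apply/asboolP/idP => [[z' /hinj -> ->] //|].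
  by move=> /negbTE zf; exists z.
by case: (z _).
Qed.

Section Uniformization.
Context d (T : measurableType d) d' (X : measurableType d').
Variables (B : nat -> set T) (D : nat -> set X) (f : T -> X).
Hypothesis baseB : standard_base B.
Hypothesis mD : forall k, measurable (D k).
Hypothesis sepD : separates_points D.
Hypothesis mf : measurable_fun setT f.

Let mfD A : measurable A -> measurable (f @^-1` A).
Proof. by move=> mA; rewrite -[X in measurable X]setTI; exact: mf. Qed.

Definition thin (M : set T) : Prop := exists F : nat -> set T,
  [/\ forall n, measurable (F n), forall n, set_inj (F n) f & M = \bigcup_n F n].

Lemma thin_meas M : thin M -> measurable M.
Proof. by case=> F [mF _ ->]; exact: bigcup_measurable. Qed.

Lemma thin_inj M : measurable M -> set_inj M f -> thin M.
Proof. by move=> mM iM; exists (fun=> M); split=> //; rewrite bigcup_const. Qed.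

Lemma thin0 : thin set0.
Proof. by apply: thin_inj => // x y; rewrite inE. Qed.

Lemma thin_bigcup (I : countType) (M : I -> set T) :
  (forall i, thin (M i)) -> thin (\bigcup_i M i).
Proof.
move=> /choice[F FP].
exists (fun n => if unpickle n is Some p then F p.1 p.2 else set0 : set T); split.
- by move=> n; case: unpickle => // -[i m]; case: (FP i).
- move=> n; case: unpickle => [[i m]|]; first by case: (FP i).
  by move=> x y; rewrite inE.
- apply/seteqP; split=> x.
    move=> [i _]; have [_ _ ->] := FP i; case=> m _ Fx.
    by exists (pickle (i, m)) => //; rewrite pickleK.
  move=> [n _]; case: unpickle => // -[i m] Fx; exists i => //.
  by have [_ _ ->] := FP i; exists m.
Qed.

Lemma thinU M N : thin M -> thin N -> thin (M `|` N).
Proof.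
move=> tM tN; rewrite (_ : _ `|` _ = \bigcup_b if b then M else N).
  by apply: thin_bigcup => -[].
by apply/seteqP; split=> x; [case; [exists true|exists false]|move=> [[] _]; [left|right]].
Qed.

Section Perfect.
Variable W : seq nat -> set T.
Hypothesis sW : scheme W.
Hypothesis dB : forall k, decides W (B k).
Hypothesis dD : forall k, decides W (f @^-1` D k).

(* If T is not thin, tuples that are not small can be split forever, which
   yields a Cantor set inside a single fibre. *)
Definition small n (u : seq bool -> seq nat) : Prop := exists2 M, thin M &
  forall x, exists t : n.-tuple bool, forall y, W (u t) y -> f y = x -> M y.

Definition splits n (u v : seq bool -> seq nat) : Prop :=
  forall t, size t = n ->
    (forall b, exists m w, v (rcons t b) = u t ++ (m :: w)) /\
    W (v (rcons t false)) `&` W (v (rcons t true)) = set0.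

(** If every splitting of [u] is small, so is [u]. Let [Mall] be the union of the exceptional sets
    of all the splittings. Off [Mall] the images of the nodes of a splitting have no common point,
    hence have separators. The [Z t] are built from these as in [separation] and have no common
    point either. On the part of [u t] off [Mall] and off the preimage of [Z t] the map is
    injective, so [Mall] and these parts form an exceptional set for [u]. *)
Lemma small_split n u : ~ small n u -> exists2 v, ~ small n.+1 v & splits n u v.
Proof.
move=> nsm; apply: contrapT => H; apply: nsm.
pose ok (t : seq bool) (ab : seq nat * seq nat) : Prop :=
  [/\ ab.1 <> [::], ab.2 <> [::] & W (u t ++ ab.1) `&` W (u t ++ ab.2) = set0].
pose tt (s : seq bool) : n.-tuple bool := insubd (nseq_tuple n false) (take n s).
pose v (p : {ffun n.-tuple bool -> seq nat * seq nat}) s : seq nat :=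
  u (take n s) ++ (if nth false s n then (p (tt s)).2 else (p (tt s)).1).
have ttE (t : seq bool) b : size t = n ->
    take n (rcons t b) = t /\ nth false (rcons t b) n = b.
  by move=> tn; rewrite nth_rcons tn ltnn eqxx -cats1 take_size_cat.
have vE p (t : n.-tuple bool) b : v p (rcons t b) = u t ++ (if b then (p t).2 else (p t).1).
  rewrite /v /tt; have [-> ->] := ttE t b (size_tuple t).
  have -> // : insubd (nseq_tuple n false) (tval t) = t.
  by apply: val_inj; rewrite val_insubd size_tuple eqxx.
(* A splitting is given by a pair of continuations for each tuple [t]. These data form a countable
   type, which keeps [Mall] thin. *)
have /choice[M MP] (p : {ffun n.-tuple bool -> seq nat * seq nat}) :
    exists M, thin M /\ ((forall t : n.-tuple bool, ok t (p t)) ->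
    forall x, exists t : n.+1.-tuple bool, forall y, W (v p t) y -> f y = x -> M y).
  case: (pselect (forall t : n.-tuple bool, ok t (p t))) => [okp|]; last first.
    by exists set0; split=> //; exact: thin0.
  have [[M tM MP]|nsm] := pselect (small n.+1 (v p)); first by exists M.
  exfalso; apply: H; exists (v p) => // t tn.
  have [n1 n2 W12] := okp (Tuple (introT eqP tn)).
  rewrite !(vE p (Tuple (introT eqP tn))); split=> // b.
  rewrite (vE p (Tuple (introT eqP tn))) /=.
  by case: b; [move: n2; case: (p _).2|move: n1; case: (p _).1] => // m w _; exists m, w.
pose Mall := \bigcup_p M p.
have tMall : thin Mall by apply: thin_bigcup => p; case: (MP p).
have mMall := thin_meas tMall.
have /choice[Y YP] (p : {ffun n.-tuple bool -> seq nat * seq nat}) :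
    exists Y : n.+1.-tuple bool -> set X,
    [/\ forall t, measurable (Y t),
        forall (t : n.+1.-tuple bool) y, (W (v p t) `\` Mall) y -> Y t (f y)
      & (forall t : n.-tuple bool, ok t (p t)) -> forall x, exists t, ~ Y t x].
  case: (pselect (forall t : n.-tuple bool, ok t (p t))) => okp; last first.
    by exists (fun=> setT); split.
  have [|x|Y [mY AY Y0]] := separation baseB mD sepD mf
      (A := fun t : n.+1.-tuple bool => W (v p t) `\` Mall).
  - by move=> t; apply: measurableD => //; exact: scheme_meas.
  - have [_ /(_ okp x)[t tP]] := MP p; exists t => y [Wy nM] fy; apply: nM.
    by exists p => //; exact: (tP y).
  - by exists Y.
pose Z (t : n.-tuple bool) := \bigcup_(ab in [set ab | ok t ab])
  \bigcap_(p in [set p : {ffun n.-tuple bool -> seq nat * seq nat} | p t = ab])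
    (Y p (rcons_tuple t false) `&` Y p (rcons_tuple t true)).
have mZ (t : n.-tuple bool) : measurable (Z t).
  apply: bigcup_count_measurable => ab _; apply: bigcap_count_measurable => p _.
  by apply: measurableI; case: (YP p).
have Z0 x : exists t : n.-tuple bool, ~ Z t x.
  apply: contrapT => /forallNP H2.
  have /choice[ab abP] (t : n.-tuple bool) : exists ab, ok t ab /\
      (\bigcap_(p in [set p : {ffun n.-tuple bool -> seq nat * seq nat} | p t = ab])
    (Y p (rcons_tuple t false) `&` Y p (rcons_tuple t true))) x.
    by have /contrapT[ab okab ?] := H2 t; exists ab.
  have [_ _ H3] := YP (finfun ab).
  have [t|s nYs] := H3 _ x; first by rewrite ffunE; case: (abP t).
  have [t [b e]] : exists (t : n.-tuple bool) b, s = rcons_tuple t b.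
    case: s {nYs} => s; case/lastP: s => [//|s b] sn.
    have sn' : size s == n by move: sn; rewrite size_rcons eqSS.
    by exists (Tuple sn'), b; exact: val_inj.
  have [_ /(_ (finfun ab))] := abP t; rewrite /= ffunE => /(_ erefl) [? ?].
  by apply: nYs; rewrite e; case: b {e}.
pose N (t : n.-tuple bool) := (W (u t) `\` Mall) `&` ~` (f @^-1` Z t).
have tN (t : n.-tuple bool) : thin (N t).
  apply: thin_inj.
    apply: measurableI; first by apply: measurableD => //; exact: scheme_meas.
    by apply: measurableC; exact: mfD.
  move=> y z /set_mem[[Wy My] nZ] /set_mem[[Wz Mz] _] fyz.
  have [_ sepB _ _] := baseB; apply: sepB => k.
  have [m dm] := dB k.
  (* Length [m.+1] is enough to decide [B k] and makes the continuations nonempty, as [ok]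
     requires. *)
  have [a am Wa] := scheme_extend m.+1 sW Wy.
  have [b bm Wb] := scheme_extend m.+1 sW Wz.
  have dec w : size w = m.+1 ->
      W (u t ++ w) `<=` B k \/ W (u t ++ w) `<=` ~` B k.
    by move=> wm; apply: (decides_sub sW dm); rewrite size_cat wm addnS ltnW ?ltnS ?leq_addl.
  (* Were the continuations [a] and [b] disjoint, the common image of the two points would lie in
     both separators of every choice [p] with [p t = (a, b)], that is, in [Z t]. *)
  suff Wne : W (u t ++ a) `&` W (u t ++ b) !=set0.
    have [w [wa wb]] := Wne.
    case: (dec _ am) => Ha; case: (dec _ bm) => Hb.
    - by split=> _; [exact: Hb|exact: Ha].
    - by have := Hb _ wb; have := Ha _ wa.
    - by have := Ha _ wa; have := Hb _ wb.
    - by split=> h; exfalso; [exact: (Ha y)|exact: (Hb z)].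
  apply/set0P/negP => /eqP W0; apply: nZ; exists (a, b).
    by split=> //= e; [move: am|move: bm]; rewrite e.
  move=> p /= pt; have [_ YA _] := YP p.
  split; first by apply: YA; split=> //; rewrite vE pt.
  by rewrite /= fyz; apply: YA; split=> //; rewrite vE pt.
exists (Mall `|` \bigcup_t N t).
  by apply: thinU => //; exact: thin_bigcup.
move=> x; have [t nZ] := Z0 x; exists t => y Wy fy.
case: (pselect (Mall y)) => My; [by left|right; exists t => //; split => //].
by rewrite /= fy.
Qed.

(** Splitting forever sends each binary sequence [z] to a branch with limit [e z], and the
    disjointness of split nodes makes [e] injective. At each stage, not being small with the empty
    exceptional set gives a fibre that meets all the nodes, so no [D k] distinguishes the images of
    two limits. *)
Lemma not_thin_perfect : ~ thin setT ->
  exists (x : X) (e : (nat -> bool) -> T), injective e /\ forall z, f (e z) = x.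
Proof.
move=> nthin.
have ns0 : ~ small 0 (fun=> [::]).
  move=> [M tM MP]; apply: nthin; rewrite (_ : setT = M) //.
  apply/seteqP; split=> // y _; have [t tP] := MP (f y); apply: tP => //.
  by rewrite (scheme_nil sW).
have [U [U0 nsU spU]] := @dep_choice (nat * (seq bool -> seq nat))
  (fun p => ~ small p.1 p.2) (fun p q => q.1 = p.1.+1 /\ splits p.1 p.2 q.2)
  (0%N, fun=> [::]) ns0
  (fun p nsp => let: ex_intro2 v a b := small_split nsp in
                ex_intro2 _ _ (p.1.+1, v) a (conj erefl b)).
have U1 n : (U n).1 = n by elim: n => [|n IH]; [rewrite U0|have [-> _] := spU n; rewrite IH].
pose u n := (U n).2.
have nsu n : ~ small n (u n) by have := nsU n; rewrite U1.
have spu n : splits n (u n) (u n.+1) by have [_] := spU n; rewrite U1.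
pose w (z : nat -> bool) n := u n (mkseq z n).
have wS z n : exists m s, w z n.+1 = w z n ++ (m :: s).
  by have [/(_ (z n))] := spu n (mkseq z n) (size_mkseq _ _); rewrite /w mkseqS.
have wD z n k : exists s, w z (n + k)%N = w z n ++ s.
  elim: k => [|k [s IH]]; first by exists [::]; rewrite addn0 cats0.
  by have [m [s' E]] := wS z (n + k)%N; exists (s ++ m :: s'); rewrite addnS E IH catA.
have sizew z n : (n <= size (w z n))%N.
  elim: n => // n IH; have [m [s ->]] := wS z n.
  by rewrite size_cat /= addnS ltnS (leq_trans IH) ?leq_addr.
pose y z n := nth 0%N (w z n.+1) n.
have wy z n : w z n = mkseq (y z) (size (w z n)).
  apply: (@eq_from_nth _ 0%N); first by rewrite size_mkseq.
  move=> i iw; rewrite nth_mkseq // /y; have [ni|ni] := leqP n i.+1.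
    have [s] := wD z n (i.+1 - n)%N; rewrite subnKC // => ->.
    by rewrite nth_cat iw.
  have [s] := wD z i.+1 (n - i.+1)%N; rewrite subnKC ?(ltnW ni) // => ->.
  by rewrite nth_cat sizew.
have common n : exists x, forall t : n.-tuple bool, exists2 q, W (u n t) q & f q = x.
  apply: contrapT => /forallNP H; apply: (nsu n); exists set0; first exact: thin0.
  move=> x; have /existsNP[t tP] := H x; exists t => q Wq fq.
  by apply: tP; exists q.
have common_mk n : exists x, forall z, exists2 q, W (w z n) q & f q = x.
  have [x xP] := common n; exists x => z.
  exact: (xP (Tuple (introT eqP (size_mkseq z n)))).
have Wsub z n : W (w z n) `<=` W (mkseq (y z) n).
  by rewrite wy; apply: scheme_mkseq.
have /choice[e eP] z : exists q, forall n, W (mkseq (y z) n) q.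
  apply: scheme_branch => // n; have [x /(_ z)[q Wq _]] := common_mk n.
  by exists q; exact: Wsub.
have eW z n : W (w z n) (e z) by rewrite wy; exact: eP.
exists (f (e (fun=> false))), e; split.
  move=> z z' ee; apply/funext.
  suff H n : mkseq z n = mkseq z' n.
    move=> n; have := H n.+1; rewrite !mkseqS.
    by move/(congr1 (last false)); rewrite !last_rcons.
  elim: n => [//|n IH]; rewrite !mkseqS IH; congr rcons.
  have [_] := spu n (mkseq z' n) (size_mkseq _ _).
  have := eW z n.+1; have := eW z' n.+1.
  rewrite /w !mkseqS IH ee; case: (z n); case: (z' n) => // h1 h2 => /seteqP[/(_ (e z'))];
  by move=> H _; exfalso; apply: H; split.
move=> z; apply: sepD => k; have [n dn] := dD k.
have dec z' : W (w z' n) `<=` f @^-1` D k \/ W (w z' n) `<=` ~` (f @^-1` D k).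
  by apply: (decides_sub sW dn); exact: sizew.
have [x xP] := common_mk n.
have dP z' : D k (f (e z')) <-> D k x.
  have [q Wq <-] := xP z'; case: (dec z') => H.
    by split=> _; [exact: H|exact: (H _ (eW z' n))].
  by split=> Dk; exfalso; [exact: (H _ (eW z' n))|exact: (H _ Wq)].
by rewrite !dP.
Qed.

End Perfect.

(** Otherwise one fibre would contain an injective image of the Cantor space. *)
Lemma countable_fibres_thin : (forall x, countable [set y | f y = x]) -> thin setT.
Proof.
move=> cf; apply: contrapT => nthin; have [_ _ _ decB] := baseB.
have [W [sW dB dD]] := decB _ (fun k => f @^-1` D k) (fun k => mfD (mD k)).
have [x [e [einj fe]]] := not_thin_perfect sW dB dD nthin.
have [g ginj] := elimT (countable_injP _) (cf x).
apply: (@cantor_nat (g \o e)) => z z' /ginj H; apply: einj; apply: H; exact: mem_set.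
Qed.

End Uniformization.

(** * Bisections of a discrete measurable groupoid *)

Section Bisections.
Context {R : realType} (G : pmpGroupoid R).
Local Notation mul := (@pmp_mul R G).
Local Notation inv := (@pmp_inv R G).
Local Notation s := (src mul inv).
Local Notation r := (rng mul inv).
Local Notation G0 := (units mul inv).
Local Notation bis := (bisections mul inv).
Implicit Types (a b c : set G) (g h x : G) (A B : set G).

Let Ggrp : is_groupoid mul inv := dmg_groupoid (pmp_dmg G).

Lemma mulVK g h : s g = r h -> mul (inv g) (mul g h) = h.
Proof.
move=> e; rewrite -(gmulA Ggrp) ?src_inv // -/(src mul inv g) e.
exact: (gmul_rng Ggrp).
Qed.

Lemma mulKV g h : r g = r h -> mul g (mul (inv g) h) = h.
Proof.
move=> e; have := @mulVK (inv g) h; rewrite (ginvK Ggrp) src_inv; exact.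
Qed.

Lemma mul_src_unit g x : s g = x -> mul g x = g.
Proof. by move=> <-; exact: (gmul_src Ggrp). Qed.

Lemma mul_rng_unit g x : r g = x -> mul x g = g.
Proof. by move=> <-; exact: (gmul_rng Ggrp). Qed.

Lemma unit_src x : G0 x -> s x = x.
Proof. by rewrite unitsE. Qed.

Lemma unit_rng x : G0 x -> r x = x.
Proof. by move=> [g _ <-]; exact: rng_src. Qed.

Lemma units_src g : G0 (s g). Proof. by exists g. Qed.

Lemma units_rng g : G0 (r g). Proof. by rewrite -src_inv; exact: units_src. Qed.

Lemma src_mul g h : s g = r h -> s (mul g h) = s h.
Proof. exact: (gsrcM Ggrp). Qed.

Lemma rng_mul g h : s g = r h -> r (mul g h) = r g.
Proof. exact: (grngM Ggrp). Qed.

Lemma unit_divl g h : r g = r h -> G0 (mul (inv g) h) -> g = h.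
Proof.
move=> rr u; have e : s (inv g) = r h by rewrite src_inv.
have e2 : mul (inv g) h = s g by rewrite -(unit_rng u) rng_mul // rng_inv.
by rewrite -[RHS](mulKV rr) e2 mul_src_unit.
Qed.

Lemma measurable_inv : measurable_fun [set: G] inv.
Proof. exact: (dmg_inv (pmp_dmg G)). Qed.

Lemma measurable_rng : measurable_fun [set: G] r.
Proof.
rewrite (_ : r = s \o inv); last by apply/funext => g /=; rewrite src_inv.
by apply: measurableT_comp; [exact: measurable_src|exact: measurable_inv].
Qed.

Lemma preimage_measurable (f : G -> G) A : measurable_fun [set: G] f ->
  measurable A -> measurable (f @^-1` A).
Proof. by move=> mf mA; rewrite -[X in measurable X]setTI; exact: mf. Qed.

Lemma bisS a b : bis a -> b `<=` a -> measurable b -> bis b.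
Proof.
by move=> [ma sa ra] ba mb; split=> // x y /set_mem xb /set_mem yb;
  [apply: sa|apply: ra]; apply: mem_set; exact: ba.
Qed.

Lemma bis_inj_src a g h : bis a -> a g -> a h -> s g = s h -> g = h.
Proof. by move=> [_ sa _] ag ah; apply: sa; exact: mem_set. Qed.

Lemma bis_inj_rng a g h : bis a -> a g -> a h -> r g = r h -> g = h.
Proof. by move=> [_ _ ra] ag ah; apply: ra; exact: mem_set. Qed.

Lemma bis_meas a : bis a -> measurable a. Proof. by case. Qed.

Lemma image_src_meas a : bis a -> measurable (s @` a).
Proof.
move=> [ma sa _]; have [B baseB] := standard_borel_base (dmg_standard (pmp_dmg G)).
have [mB sepB _ _] := baseB.
exact: (injective_image_measurable baseB mB sepB (measurable_src (G := G)) ma sa).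
Qed.

Lemma image_rng_meas a : bis a -> measurable (r @` a).
Proof.
move=> [ma _ ra]; have [B baseB] := standard_borel_base (dmg_standard (pmp_dmg G)).
have [mB sepB _ _] := baseB.
exact: (injective_image_measurable baseB mB sepB measurable_rng ma ra).
Qed.

(** Let [h g] be the arrow of [a] with the range of [g]. The product consists of the [g] with range
    in [r(a)] for which the product of the inverse of [h g] with [g] lies in [b]. Lusin-Souslin
    makes [h] Borel: its preimages are built from the ranges of sub-bisections of [a]. *)
Lemma bis_mul a b : bis a -> bis b -> bis (setmul mul inv a b).
Proof.
move=> ba bb.
(* At arrows whose range is not in [r(a)], [h] is the identity; this makes it a total Borel map. *)
have /choice[h hP0] g : exists h, ((r @` a) (r g) -> a h /\ r h = r g) /\
    (~ (r @` a) (r g) -> h = g).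
  case: (pselect ((r @` a) (r g))) => [[h ah e]|H]; first by exists h; split=> // -[]; exists h.
  by exists g; split=> // /H.
have hP g : (r @` a) (r g) -> a (h g) /\ r (h g) = r g by case: (hP0 g).
pose E := r @^-1` (r @` a).
have mE : measurable E by apply: preimage_measurable; [exact: measurable_rng|exact: image_rng_meas].
have mh : measurable_fun setT h.
  move=> _ C mC; rewrite setTI.
  rewrite (_ : _ @^-1` _ = r @^-1` (r @` (a `&` C)) `|` (C `\` E)).
    apply: measurableU; last exact: measurableD.
    apply: preimage_measurable; first exact: measurable_rng.
    apply: image_rng_meas; apply: (bisS ba); first exact: subIsetl.
    by apply: measurableI => //; exact: bis_meas.
  apply/seteqP; split=> g /=.
    case: (pselect (E g)) => [Eg|nE] Ch; first by left; have [ah e] := hP _ Eg; exists (h g).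
    by right; have [_ /(_ nE) e] := hP0 g; rewrite e in Ch.
  move=> [[k [ak Ck] e]|[Cg nE]]; last by have [_ /(_ nE) ->] := hP0 g.
  have Eg : (r @` a) (r g) by exists k.
  have [ah e'] := hP _ Eg.
  by rewrite (bis_inj_rng ba ah ak) // e'.
have [Q mQ QP] := dmg_mul (pmp_dmg G) (bis_meas bb).
have -> : setmul mul inv a b = E `&` (fun g => (inv (h g), g)) @^-1` Q.
  apply/seteqP; split=> g.
    move=> [x [y [ax y' e ->]]].
    have Eg : (r @` a) (r (mul x y)) by exists x => //; rewrite rng_mul.
    have [ah e'] := hP _ Eg.
    have hx : h (mul x y) = x by apply: (bis_inj_rng ba) => //; rewrite e' rng_mul.
    split=> //=; apply/QP; rewrite /= hx; last by rewrite mulVK.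
    by rewrite /composable /= src_inv rng_mul.
  move=> [Eg /= Qg]; have [ah e] := hP _ Eg.
  exists (h g), (mul (inv (h g)) g); split => //.
  - by move/QP : Qg; apply; rewrite /composable /= src_inv.
  - by rewrite rng_mul ?rng_inv ?src_inv.
  - by rewrite mulKV.
split.
- apply: measurableI => //.
  have mp := measurable_fun_pair (measurableT_comp measurable_inv mh) (@measurable_id _ G setT).
  by rewrite -[X in measurable X]setTI; exact: mp.
- move=> x y /set_mem[Ex /= Qx] /set_mem[Ey /= Qy] xy.
  have [ax ex] := hP _ Ex; have [ay ey] := hP _ Ey.
  have bx : b (mul (inv (h x)) x) by move/QP : Qx; apply; rewrite /composable /= src_inv.
  have by' : b (mul (inv (h y)) y) by move/QP : Qy; apply; rewrite /composable /= src_inv.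
  have e1 : mul (inv (h x)) x = mul (inv (h y)) y.
    by apply: (bis_inj_src bb) => //; rewrite !src_mul ?src_inv.
  have e2 : h x = h y.
    apply: (bis_inj_src ba) => //.
    by have /(congr1 r) := e1; rewrite !rng_mul ?src_inv // !rng_inv.
  by rewrite -(mulKV ex) -(mulKV ey) e1 e2.
- move=> x y /set_mem[Ex /= Qx] /set_mem[Ey /= Qy] xy.
  have [ax ex] := hP _ Ex; have [ay ey] := hP _ Ey.
  have bx : b (mul (inv (h x)) x) by move/QP : Qx; apply; rewrite /composable /= src_inv.
  have by' : b (mul (inv (h y)) y) by move/QP : Qy; apply; rewrite /composable /= src_inv.
  have e2 : h x = h y by apply: (bis_inj_rng ba) => //; rewrite ex ey.
  have e1 : mul (inv (h x)) x = mul (inv (h y)) y.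
    by apply: (bis_inj_rng bb) => //; rewrite !rng_mul ?src_inv // e2.
  by rewrite -(mulKV ex) -(mulKV ey) e1 e2.
Qed.

Lemma val_bmul (a b : borel_full_semigroup G) :
  val (bmul a b) = setmul mul inv (val a) (val b).
Proof.
rewrite /bmul val_insubd ifT //; apply: mem_set.
by apply: bis_mul; apply: set_mem; exact: valP.
Qed.

Lemma bis_val (a : borel_full_semigroup G) : bis (val a).
Proof. by apply: set_mem; exact: valP. Qed.

(** The source map is injective on each of countably many Borel sets covering the arrows.
    Intersecting these with the inverses of one another makes the range injective too, and [seqDU]
    makes the pieces disjoint. *)
Lemma bis_cover : exists c : nat -> set G,
  [/\ forall n, bis (c n), forall m n g, c m g -> c n g -> m = n
     & forall g, exists n, c n g].
Proof.
have [B baseB] := standard_borel_base (dmg_standard (pmp_dmg G)).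
have [mB sepB _ _] := baseB.
have [|F [mF iF FT]] := countable_fibres_thin baseB mB sepB (measurable_src (G := G)).
  move=> x; case: (pselect (G0 x)) => ux; first exact: (dmg_fibre (pmp_dmg G)).
  rewrite (_ : [set _ | _] = set0) // -subset0 => g /= e; apply: ux.
  by rewrite -e; exact: units_src.
pose E n := if unpickle n is Some p then F p.1 `&` inv @^-1` F p.2 else set0 : set G.
have mE n : measurable (E n).
  rewrite /E; case: unpickle => // p; apply: measurableI => //.
  by apply: preimage_measurable => //; exact: measurable_inv.
exists (seqDU E); split.
- move=> n; apply: (@bisS (E n)); last by apply: seqDU_measurable.
    split=> //; rewrite /E; case: unpickle => [[i j]|] /=; try by move=> ? ?; rewrite inE.
      by move=> x y /set_mem[x1 _] /set_mem[y1 _]; apply: (iF i); exact: mem_set.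
    move=> x y /set_mem[_ /= x2] /set_mem[_ /= y2] e.
    apply: (inv_inj (ginvK Ggrp)); apply: (iF j); rewrite ?src_inv //; exact: mem_set.
  exact: subset_seqDU.
- move=> m n g Em En; apply: contrapT => /eqP ne.
  have /trivIsetP/(_ m n I I ne)/seteqP[H _] := trivIset_seqDU E.
  exact: (H g).
- move=> g; suff [n _ ?] : (\bigcup_n seqDU E n) g by exists n.
  rewrite -seqDU_bigcup_eq.
  have [i _ Fi] : (\bigcup_n F n) g by rewrite -FT.
  have [j _ Fj] : (\bigcup_n F n) (inv g) by rewrite -FT.
  by exists (pickle (i, j)) => //; rewrite /E pickleK.
Qed.

End Bisections.

Local Open Scope ring_scope.

(** * Extension and supports of full bisections *)

Section Pmp.
Context {R : realType} (G : pmpGroupoid R).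
Local Notation mul := (@pmp_mul R G).
Local Notation inv := (@pmp_inv R G).
Local Notation mu := (@pmp_mu R G).
Local Notation s := (src mul inv).
Local Notation r := (rng mul inv).
Local Notation G0 := (units mul inv).
Local Notation bis := (bisections mul inv).
Implicit Types (a b c : set G) (g h x : G) (A B : set G).

Definition pm A : R := fine (mu A).

Lemma pmE A : measurable A -> mu A = (pm A)%:E.
Proof. by move=> mA; rewrite /pm fineK //; exact: fin_num_measure. Qed.

Lemma pm_ge0 A : 0 <= pm A.
Proof. by rewrite /pm fine_ge0. Qed.

Lemma pm_le A B : measurable A -> measurable B -> A `<=` B -> pm A <= pm B.
Proof.
by move=> mA mB AB; rewrite -lee_fin -!pmE //; apply: le_measure; rewrite ?inE.
Qed.

Lemma pm0 : pm set0 = 0.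
Proof. by rewrite /pm measure0. Qed.

Lemma pmU A B : measurable A -> measurable B -> (forall x, A x -> ~ B x) ->
  pm (A `|` B) = pm A + pm B.
Proof.
move=> mA mB AB; apply: EFin_inj; rewrite EFinD -!pmE //; last exact: measurableU.
rewrite measureU // -subset0 => x [Ax Bx]; exact: (AB x).
Qed.

Lemma pmDI A B : measurable A -> measurable B -> pm A = pm (A `\` B) + pm (A `&` B).
Proof.
move=> mA mB; rewrite -pmU; [by rewrite setUC setUIDK| exact: measurableD|exact: measurableI|].
by move=> x [_ nB] [].
Qed.

Lemma pmU_le A B : measurable A -> measurable B -> pm (A `|` B) <= pm A + pm B.
Proof.
move=> mA mB; rewrite -lee_fin EFinD -!pmE //; last exact: measurableU.
exact: measureU2.
Qed.

Lemma pm_units : pm G0 = 1.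
Proof. by rewrite /pm pmp_mu_units. Qed.

Lemma pm_le1 A : measurable A -> pm A <= 1.
Proof. by move=> mA; rewrite -lee_fin -pmE //; exact: probability_le1. Qed.

Lemma pm_bis a : bis a -> pm (s @` a) = pm (r @` a).
Proof. by move=> ba; rewrite /pm pmp_mu_invariant. Qed.


Definition full a : Prop := [/\ bis a, s @` a = G0 & r @` a = G0].

Lemma bisU a b : bis a -> bis b ->
  (forall g h, a g -> b h -> s g <> s h) -> (forall g h, a g -> b h -> r g <> r h) ->
  bis (a `|` b).
Proof.
move=> ba bb ds dr; split; first by apply: measurableU; exact: bis_meas.
- move=> x y /set_mem[ax|bx] /set_mem[ay|by'] e.
  + exact: (bis_inj_src ba).
  + by case: (ds x y).
  + by case: (ds y x).
  + exact: (bis_inj_src bb).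
- move=> x y /set_mem[ax|bx] /set_mem[ay|by'] e.
  + exact: (bis_inj_rng ba).
  + by case: (dr x y).
  + by case: (dr y x).
  + exact: (bis_inj_rng bb).
Qed.

Lemma nondecreasing_sub (F : nat -> set G) :
  (forall n, F n `<=` F n.+1) -> forall m n, (m <= n)%N -> F m `<=` F n.
Proof.
move=> FS m n; elim: n => [|n IH]; first by rewrite leqn0 => /eqP ->.
rewrite leq_eqVlt => /predU1P[->//|/IH H]; exact: subset_trans (FS n).
Qed.

Lemma bis_bigcup (F : nat -> set G) : (forall n, bis (F n)) ->
  (forall n, F n `<=` F n.+1) -> bis (\bigcup_n F n).
Proof.
move=> bF FS; split.
- by apply: bigcup_measurable => n _; exact: bis_meas.
- move=> x y /set_mem[i _ Fx] /set_mem[j _ Fy]; apply: (bis_inj_src (bF (maxn i j))).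
    exact: (nondecreasing_sub FS (leq_maxl i j)).
  exact: (nondecreasing_sub FS (leq_maxr i j)).
- move=> x y /set_mem[i _ Fx] /set_mem[j _ Fy]; apply: (bis_inj_rng (bF (maxn i j))).
    exact: (nondecreasing_sub FS (leq_maxl i j)).
  exact: (nondecreasing_sub FS (leq_maxr i j)).
Qed.

Lemma src_preimage_meas A : measurable A -> measurable (s @^-1` A).
Proof. by apply: preimage_measurable; exact: measurable_src. Qed.

Lemma rng_preimage_meas A : measurable A -> measurable (r @^-1` A).
Proof. by apply: preimage_measurable; exact: measurable_rng. Qed.

Lemma bis_restr_src a A : bis a -> measurable A -> bis (a `&` s @^-1` A).
Proof.
move=> ba mA; apply: (bisS ba); first exact: subIsetl.
by apply: measurableI; [exact: bis_meas|exact: src_preimage_meas].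
Qed.

Lemma bis_restr_rng a A : bis a -> measurable A -> bis (a `&` r @^-1` A).
Proof.
move=> ba mA; apply: (bisS ba); first exact: subIsetl.
by apply: measurableI; [exact: bis_meas|exact: rng_preimage_meas].
Qed.

Lemma bis0 : bis set0.
Proof. by split => // x y; rewrite inE. Qed.

Lemma bis_units A : measurable A -> A `<=` G0 -> bis A.
Proof. by move=> mA AG; exact: (bisS (units_bisection G)). Qed.

(** For a set of units, the union of the orbits that it meets. *)
Definition saturation A : set G := r @` (s @^-1` A).

Lemma saturation_meas A : measurable A -> measurable (saturation A).
Proof.
move=> mA; have [c [bc _ cT]] := bis_cover G.
rewrite (_ : saturation A = \bigcup_n r @` (c n `&` s @^-1` A)).
  by apply: bigcup_measurable => n _; apply: image_rng_meas; exact: bis_restr_src.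
apply/seteqP; split=> [_ [g Ag <-]|_ [n _ [g [cg Ag] <-]]]; last by exists g.
by have [n cg] := cT g; exists n => //; exists g.
Qed.

(** Countably many bisections cover the arrows, and each of them carries null sets of sources to
    null sets of ranges. *)
Lemma saturation_null A : measurable A -> pm A = 0 -> pm (saturation A) = 0.
Proof.
move=> mA A0; have [c [bc _ cT]] := bis_cover G.
apply: EFin_inj; rewrite -pmE; last exact: saturation_meas.
apply/eqP; rewrite eq_le measure_ge0 andbT.
rewrite (_ : saturation A = \bigcup_n r @` (c n `&` s @^-1` A)); last first.
  apply/seteqP; split=> [_ [g Ag <-]|_ [n _ [g [cg Ag] <-]]]; last by exists g.
  by have [n cg] := cT g; exists n => //; exists g.
have b n : bis (c n `&` s @^-1` A) by exact: bis_restr_src.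
have null n : mu (r @` (c n `&` s @^-1` A)) = 0%E.
  rewrite -(pmp_mu_invariant (b n)).
  apply/eqP; rewrite eq_le measure_ge0 andbT.
  apply: (@le_trans _ _ (mu A)); last by rewrite pmE // A0.
  apply: le_measure; rewrite ?inE //; first exact: image_src_meas.
  by move=> _ [g [_ Ag] <-].
apply: (le_trans (measure_sigma_subadditive _ _ _ _)); last first.
- by rewrite eseries0 // => n _ _; exact: null.
- by [].
- by apply: bigcup_measurable => n _; exact: image_rng_meas.
- by move=> n; exact: image_rng_meas.
Qed.

Lemma saturation_unit A x : A x -> G0 x -> saturation A x.
Proof. by move=> Ax ux; exists x; [rewrite /= unit_src|exact: unit_rng]. Qed.

Lemma saturation_inv A g : saturation A (s g) <-> saturation A (r g).
Proof.
split=> -[h Ah e].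
  by exists (mul g h); rewrite /= ?src_mul // rng_mul.
exists (mul (inv g) h); first by rewrite /= src_mul // src_inv.
by rewrite rng_mul ?rng_inv ?src_inv.
Qed.

(* If no arrow joins the complement of the source of [a] to the complement of
   its range, [a] maps the saturation Z of the first one, minus that
   complement, onto Z. *)
Lemma maximal_bis_null a : bis a ->
  (forall g, ~ (s @` a) (s g) -> ~ (r @` a) (r g) -> False) ->
  pm (G0 `\` s @` a) = 0.
Proof.
move=> ba maxa; set A := G0 `\` s @` a; pose Z := saturation A.
have mA : measurable A by apply: measurableD; [exact: measurable_units|exact: image_src_meas].
have mZ : measurable Z by exact: saturation_meas.
have e1 : s @` (a `&` s @^-1` Z) = Z `\` A.
  apply/seteqP; split=> [_ [g [ag Zg] <-]|x [Zx nA]].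
    by split=> // -[_]; apply; exists g.
  have ux : G0 x by case: Zx => g _ <-; exact: units_rng.
  have [g ag e] : (s @` a) x by apply: contrapT => n; apply: nA.
  by exists g => //; split=> //=; rewrite e.
have e2 : r @` (a `&` s @^-1` Z) = Z.
  apply/seteqP; split=> [_ [g [ag Zg] <-]|x Zx]; first exact/saturation_inv.
  have [g ag e] : (r @` a) x.
    apply: contrapT => nx; case: Zx => g [_ ng] e.
    by apply: (maxa g ng); rewrite e.
  by exists g => //; split=> //=; apply/saturation_inv; rewrite e.
have := pm_bis (bis_restr_src ba mZ); rewrite e1 e2.
have AZ : A `<=` Z by move=> x Ax; apply: saturation_unit => //; case: Ax.
by rewrite (pmDI mZ mA) (setIidr AZ); lra.
Qed.

(** The bisections of a countable cover are run through once, each time adjoining the arrows whose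
    source and range are still free. An arrow with both ends free in the limit lies in some [c n]
    and would have been adjoined at that stage. *)
Lemma maximal_extension a : bis a -> exists b, [/\ bis b, a `<=` b &
  forall g, ~ (s @` b) (s g) -> ~ (r @` b) (r g) -> False].
Proof.
move=> ba; have [c [bc _ cT]] := bis_cover G.
pose next (b d : set G) := b `|` ((d `&` s @^-1` (~` (s @` b))) `&` r @^-1` (~` (r @` b))).
pose F := fix F n := if n is m.+1 then next (F m) (c m) else a.
have bF n : bis (F n).
  elim: n => [//|n IH] /=; apply: bisU => //.
  - apply: bis_restr_rng; last by apply: measurableC; exact: image_rng_meas.
    by apply: bis_restr_src => //; apply: measurableC; exact: image_src_meas.
  - by move=> g h Fg [[_ /= nh] _] e; apply: nh; exists g.
  - by move=> g h Fg [_ /= nh] e; apply: nh; exists g.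
have FS n : F n `<=` F n.+1 by move=> x Fx; left.
exists (\bigcup_n F n); split; first exact: bis_bigcup.
  by move=> x ax; exists 0%N.
move=> g ns nr; have [n cg] := cT g; apply: (ns); exists g => //; exists n.+1 => //.
right; split; first split=> //=; move=> [h Fh e].
  by apply: ns; exists h => //; exists n.
by apply: nr; exists h => //; exists n.
Qed.

(** A maximal extension [t] misses a null set of sources and, by invariance of the measure, a null
    set of ranges. Off the saturation [N] of both, [t] is a bijection of units; on the null
    invariant set [N] it is replaced by the units. *)
Lemma full_extension a : bis a -> exists2 b, full b & pm (s @` (a `\` b)) = 0.
Proof.
move=> ba; have [t [bt at' maxt]] := maximal_extension ba.
pose A := G0 `\` s @` t; pose B := G0 `\` r @` t.
have mA : measurable A by apply: measurableD; [exact: measurable_units|exact: image_src_meas].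
have mB : measurable B by apply: measurableD; [exact: measurable_units|exact: image_rng_meas].
have A0 : pm A = 0 by exact: maximal_bis_null.
have B0 : pm B = 0.
  have := pmDI (measurable_units G) (image_rng_meas bt).
  have := pmDI (measurable_units G) (image_src_meas bt).
  rewrite -/A -/B A0 !setIidr.
  - by rewrite (pm_bis bt); lra.
  - by move=> _ [g _ <-]; exact: units_rng.
  - by move=> _ [g _ <-]; exact: units_src.
pose N := saturation (A `|` B).
have mN : measurable N by apply: saturation_meas; exact: measurableU.
have N0 : pm N = 0.
  apply: saturation_null; first exact: measurableU.
  by apply/eqP; rewrite eq_le pm_ge0 andbT (le_trans (pmU_le mA mB)) // A0 B0 addr0.
have NG : N `<=` G0 by move=> _ [g _ <-]; exact: units_rng.
have mNC : measurable (~` N) by exact: measurableC.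
exists ((t `&` s @^-1` (~` N)) `|` N); first split.
- apply: bisU => //; [exact: bis_restr_src|exact: bis_units|..].
    by move=> g h [_ /= ng] Nh e; apply: ng; rewrite e unit_src //; exact: NG.
  move=> g h [_ /= ng] Nh e; apply: ng; apply/saturation_inv.
  by rewrite e unit_rng //; exact: NG.
- apply/seteqP; split=> [_ [g _ <-]|x ux]; first exact: units_src.
  case: (pselect (N x)) => Nx; first by exists x; [right|exact: unit_src].
  have [g tg e] : (s @` t) x.
    by apply: contrapT => nx; apply: Nx; apply: saturation_unit => //; left.
  by exists g => //; left; split=> //=; rewrite e.
- apply/seteqP; split=> [_ [g _ <-]|x ux]; first exact: units_rng.
  case: (pselect (N x)) => Nx; first by exists x; [right|exact: unit_rng].
  have [g tg e] : (r @` t) x.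
    by apply: contrapT => nx; apply: Nx; apply: saturation_unit => //; right.
  by exists g => //; left; split=> //= /saturation_inv; rewrite e.
apply/eqP; rewrite eq_le pm_ge0 andbT -[leRHS]N0; apply: pm_le => //.
  apply: image_src_meas; apply: (bisS ba); first exact: subDsetl.
  apply: measurableD; first exact: bis_meas.
  by apply: measurableU => //; apply: bis_meas; exact: bis_restr_src.
move=> _ [g [ag nb] <-]; apply: contrapT => nN; apply: nb; left; split => //.
exact: at'.
Qed.

(** Two arrows [g], [h] with sources in [B] and the same range are equal, because the inverse of [g]
    times [h] joins two points of [B] and is thus a unit. Hence the ranges of the pieces of the
    cover over [B] are disjoint, and the measures of their sources [E n] are summable. By
    aperiodicity each point of [B] lies in infinitely many [E n], and Borel-Cantelli applies. *)
Lemma aperiodic_trivial_null B : aperiodic G -> measurable B -> B `<=` G0 ->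
  (forall g, B (s g) -> B (r g) -> G0 g) -> pm B = 0.
Proof.
move=> aper mB BG triv; have [c [bc cdisj cT]] := bis_cover G.
pose D n := r @` (c n `&` s @^-1` B); pose E n := s @` (c n `&` s @^-1` B).
have bE n : bis (c n `&` s @^-1` B) by exact: bis_restr_src.
have mE n : measurable (E n) by exact: image_src_meas.
have mD n : measurable (D n) by exact: image_rng_meas.
have sumD : (\sum_(0 <= n <oo) mu (E n) < +oo)%E.
  rewrite (eq_eseriesr (g := fun n => mu (D n))); last first.
    by move=> n _; rewrite /E pmp_mu_invariant.
  have <- : mu (\bigcup_n D n) = (\sum_(0 <= n <oo) mu (D n))%E; last first.
    by rewrite (le_lt_trans (probability_le1 _ _)) ?ltry //; exact: bigcup_measurable.
  rewrite measure_bigcup //; first by apply: eq_eseriesl => n; rewrite in_setT.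
  apply/trivIsetP => m n _ _ mn; rewrite -subset0 => _ [[g [cg Bg] <-] [h [ch Bh] e]].
  have gh : g = h.
    apply: unit_divl => //; apply: triv.
      by rewrite src_mul ?src_inv.
    by rewrite rng_mul ?rng_inv ?src_inv.
  by move/eqP: mn; apply; apply: (cdisj _ _ g) => //; rewrite gh.
have L0 := lim_sup_set_cvg0 mE sumD.
have mL : measurable (lim_sup_set E) by apply: bigcapT_measurable => n; exact: bigcup_measurable.
apply/eqP; rewrite eq_le pm_ge0 andbT.
have <- : pm (lim_sup_set E) = 0 by rewrite /pm L0.
apply: pm_le => // x Bx n _.
apply: contrapT => nx; apply: (aper x (BG _ Bx)).
apply: (@sub_finite_set _ _ (\bigcup_(m in `I_n) (c m `&` s @^-1` [set x]))).
  move=> g /= gx; have [m cg] := cT g; exists m => //=; rewrite ltnNge; apply/negP => nm.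
  by apply: nx; exists m => //; exists g => //; split=> //=; rewrite gx.
apply: bigcup_finite; first exact: finite_II.
move=> m _; case: (pselect ((c m `&` s @^-1` [set x]) !=set0)) => [[g [cg gx]]|H].
  apply: (@sub_finite_set _ _ [set g]); last exact: finite_set1.
  by move=> h [ch hx] /=; apply: (bis_inj_src (bc m)) => //; rewrite hx gx.
apply: (@sub_finite_set _ _ set0); last exact: finite_set0.
by move=> h ch; apply: H; exists h.
Qed.

Definition mover a : Prop := [/\ bis a, s @` a = r @` a & forall g, a g -> ~ G0 g].

(** The building blocks of [support_exists]. A non-unit arrow either is isotropic or goes from some
    [C k] to its complement. Arrows of the second kind form a mover together with their inverses,
    which go the other way; those of the first kind already have equal source and range. [e n A] is
    built from the arrows of [d n] with both ends in [A]. *)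
Lemma mover_family : exists (d : nat -> set G) (e : nat -> set G -> set G),
  [/\ forall n A, measurable A -> mover (e n A) /\ s @` e n A `<=` A,
      forall n A g, d n g -> A (s g) -> A (r g) -> (s @` e n A) (s g)
    & forall g, ~ G0 g -> exists n, d n g].
Proof.
have [c [bc _ cT]] := bis_cover G.
have [B [mB sepB _ _]] := standard_borel_base (dmg_standard (pmp_dmg G)).
pose C (k : nat * bool) := if k.2 then B k.1 else ~` B k.1.
have mC k : measurable (C k) by rewrite /C; case: ifP => _; [|apply: measurableC].
pose iso := [set g | s g = r g].
have miso : measurable iso.
  rewrite (_ : iso = ~` \bigcup_k (s @^-1` C k `&` r @^-1` (~` C k))).
    apply: measurableC; apply: bigcup_count_measurable => k _; apply: measurableI.
      exact: src_preimage_meas.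
    by apply: rng_preimage_meas; exact: measurableC.
  apply/seteqP; split=> [g e [k _ [/= sC]]|g /= ng]; first by rewrite -e.
  apply: sepB => k; split=> H; apply: contrapT => nH; apply: ng.
    by exists (k, true).
  by exists (k, false) => //; split=> //= -[]; rewrite /C /=.
pose dc n (k : option (nat * bool)) := c n `&`
  (if k is Some k then s @^-1` C k `&` r @^-1` (~` C k) else iso `\` G0).
have bdc n k : bis (dc n k).
  apply: (bisS (bc n)); first exact: subIsetl.
  apply: measurableI; first exact: bis_meas.
  case: k => [k|]; last by apply: measurableD => //; exact: measurable_units.
  apply: measurableI; first exact: src_preimage_meas.
  by apply: rng_preimage_meas; exact: measurableC.
pose dA n k A := (dc n k `&` s @^-1` A) `&` r @^-1` A.
pose ec n k A := if k is Some _ then dA n k A `|` inv @` dA n k A else dA n k A.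
pose dec (i : nat) := odflt (0%N, None) (unpickle i : option (nat * option (nat * bool))).
exists (fun i => dc (dec i).1 (dec i).2), (fun i => ec (dec i).1 (dec i).2); split.
- move=> i A mA; case: (dec i) => n k /=.
  have bd : bis (dA n k A) by apply: bis_restr_rng => //; exact: bis_restr_src.
  case: k bd => [k|] bd /=.
    have bi : bis (inv @` dA n (Some k) A) by exact: inv_bisection.
    split; first split.
    + apply: bisU => //.
        move=> g _ [[[_ [Cg _]] _] _] [h [[[_ [_ nC]] _] _] <-]; rewrite src_inv => e.
        by apply: nC; rewrite /= -e.
      move=> g _ [[[_ [_ nC]] _] _] [h [[[_ [Ch _]] _] _] <-]; rewrite rng_inv => e.
      by apply: nC; rewrite /= e.
    + apply/seteqP; split=> _ [g [dg|[h dh <-]] <-].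
      * by exists (inv g); [right; exists g|rewrite rng_inv].
      * by exists h; [left|rewrite src_inv].
      * by exists (inv g); [right; exists g|rewrite src_inv].
      * by exists h; [left|rewrite rng_inv].
    + move=> g [dg|[h dh <-]] u.
        have [[[_ [Cg nC]] _] _] := dg; apply: nC; rewrite /= (unit_rng u).
        by rewrite -{1}(unit_src u).
      have [[[_ [Cg nC]] _] _] := dh; apply: nC.
      by rewrite /= -src_inv -[C k _]/(C k _) (unit_src u) -(unit_rng u) rng_inv.
    by move=> _ [g [[[_ ?] ?]|[h [[_ ?] ?] <-]] <-]; rewrite ?src_inv.
  split; last by move=> _ [g [[_ ?] ?] <-].
  split=> //; last by move=> g [[[_ []]]].
  by apply: eq_imagel => g [[[_ []]]].
- move=> i A g; case: (dec i) => n [k|] /= dg sg rg; exists g => //.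
  by left.
- move=> g ng; have [n cg] := cT g.
  have [k dg] : exists k, dc n k g.
    case: (pselect (iso g)) => ig; first by exists None.
    have [k kP] : exists k, ~ (B k (s g) <-> B k (r g)).
      by apply: contrapT => /forallNP H; apply: ig; apply: sepB => k; apply: contrapT; exact: H.
    case: (pselect (B k (s g))) => Bs.
      by exists (Some (k, true)); split=> //; split=> //= Br; apply: kP.
    exists (Some (k, false)); split=> //; split=> // nBr; apply: kP.
    by split=> [/Bs|/nBr].
  by exists (pickle (n, k)); rewrite /dec pickleK.
Qed.

(** Movers are adjoined greedily in what remains of [A]. Every arrow between points of the final
    remainder is a unit, so the remainder is null by [aperiodic_trivial_null]; outside the moved
    part the bisection is completed by units. *)
Lemma support_exists A : aperiodic G -> measurable A -> A `<=` G0 ->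
  exists b, [/\ full b, pm (A `&` b) = 0 & G0 `\` A `<=` b].
Proof.
move=> aper mA AG; have [d [e [eP dP dT]]] := mover_family.
pose F := fix F n := if n is m.+1 then F m `|` e m (A `\` s @` F m) else set0.
have bF n : mover (F n) /\ s @` F n `<=` A.
  elim: n => [|n [[bFn srF nuF] sF]].
    by split; [split=> //; [exact: bis0|rewrite !image_set0]|rewrite image_set0].
  have mAF : measurable (A `\` s @` F n) by apply: measurableD => //; exact: image_src_meas.
  have [[be sre nue] se] := eP n _ mAF.
  split; first split.
  + apply: bisU => // g h Fg eh sgh.
      by have [_ ] := se (s h) (ex_intro2 _ _ h eh erefl); apply; exists g.
    have [_] : (A `\` s @` F n) (r h) by apply: se; rewrite sre; exists h.
    by apply; rewrite srF; exists g.
  + by rewrite /= !image_setU [X in _ `|` X]sre [X in X `|` _]srF.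
  + by move=> g [/nuF|/nue].
  + by rewrite /= image_setU => x [/sF|/se[]].
have FS n : F n `<=` F n.+1 by move=> x Fx; left.
pose t := \bigcup_n F n.
have bt : bis t by apply: bis_bigcup => // n; case: (bF n) => -[].
have st : s @` t = r @` t.
  by rewrite !image_bigcup; apply: eq_bigcupr => n _; case: (bF n) => -[].
have nut g : t g -> ~ G0 g by move=> [n _ Fg]; case: (bF n) => -[_ _ +] _; apply.
have sA : s @` t `<=` A by rewrite image_bigcup => x [n _]; case: (bF n) => _ +; apply.
have ms := image_src_meas bt.
have mB : measurable (A `\` s @` t) by exact: measurableD.
have B0 : pm (A `\` s @` t) = 0.
  apply: aperiodic_trivial_null => //; first by move=> x [Ax _]; exact: AG.
  move=> g [Asg nsg] [Arg nrg]; apply: contrapT => /dT[n dg].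
  have : (s @` e n (A `\` s @` F n)) (s g).
    by apply: dP => //; split=> // -[h Fh hg];
      [apply: nsg|apply: nrg]; exists h => //; exists n.
  by move=> [h eh hg]; apply: nsg; exists h => //; exists n.+1 => //; right.
have mU : measurable (G0 `\` s @` t) by apply: measurableD => //; exact: measurable_units.
have bU : bis (G0 `\` s @` t) by apply: bis_units => // x [].
exists (t `|` (G0 `\` s @` t)); split; first split.
- apply: bisU => // g h tg [uh nh] gh; apply: nh; first by exists g; rewrite // gh unit_src.
  by rewrite st; exists g; rewrite // gh unit_rng.
- apply/seteqP; split=> [_ [g _ <-]|x ux]; first exact: units_src.
  case: (pselect ((s @` t) x)) => [[g tg <-]|nx]; first by exists g => //; left.
  by exists x; [right|exact: unit_src].
- apply/seteqP; split=> [_ [g _ <-]|x ux]; first exact: units_rng.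
  case: (pselect ((r @` t) x)) => [[g tg <-]|nx]; first by exists g => //; left.
  by exists x; [right; split=> //; rewrite st|exact: unit_rng].
- rewrite (_ : A `&` _ = A `\` s @` t) //; apply/seteqP; split=> x.
    by move=> [Ax [tx|[]//]]; case: (nut x tx); exact: AG.
  by move=> [Ax nx]; split=> //; right; split=> //; exact: AG.
- by move=> x [ux nA]; right; split=> // /sA.
Qed.

End Pmp.

(** * Metric quotients and ultraproducts *)

(* Inversion on a full semigroup is 2-Lipschitz but not isometric. *)
Record lawful (R : realType) (X : metricMonoid R) : Prop := Lawful {
  ldist0 : forall x : X, mdist x x = 0;
  ldistC : forall x y : X, mdist x y = mdist y x;
  ldist_tri : forall x y z : X, mdist x z <= mdist x y + mdist y z;
  ldist_ge0 : forall x y : X, 0 <= mdist x y;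
  ldist_le1 : forall x y : X, mdist x y <= 1;
  ldist_mul : forall x x' y y' : X,
    mdist (mmul x y) (mmul x' y') <= mdist x x' + mdist y y';
  ldist_inv : forall x y : X, mdist (minv x) (minv y) <= 2 * mdist x y
}.

Lemma ldist_eq (R : realType) (X : metricMonoid R) (lX : lawful X) (x x' y y' : X) :
  mdist x x' = 0 -> mdist y y' = 0 -> mdist x y = mdist x' y'.
Proof.
move=> xx yy; have t1 := ldist_tri lX x x' y; have t2 := ldist_tri lX x' y' y.
have t3 := ldist_tri lX x' x y'; have t4 := ldist_tri lX x y y'.
rewrite (ldistC lX x' x) in t3; rewrite (ldistC lX y' y) in t2.
by apply: le_anti; apply/andP; split; lra.
Qed.

Section Quotient.
Context {R : realType} (X : metricMonoid R).
Hypothesis lX : lawful X.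
Implicit Types x y : X.
Local Notation pi := (@mpi R X).

Lemma mpi_eqP x y : pi x = pi y <-> mdist x y = 0.
Proof.
split=> [/(congr1 val) /= /seteqP[_ H]|xy].
  by apply: H; rewrite /zero_class /= ldist0.
apply: val_inj; apply/seteqP; rewrite /= /zero_class; split => z /= xz.
  by rewrite -(ldist_eq lX (x := x) xy (ldist0 lX z)).
by rewrite (ldist_eq lX (x := x) xy (ldist0 lX z)).
Qed.

Lemma mrepr_mpi x : mdist (mrepr (pi x)) x = 0.
Proof. by apply/mpi_eqP; rewrite mreprK. Qed.

Lemma mquot_dist x y : mdist (pi x : mquot X) (pi y) = mdist x y.
Proof. by apply: (ldist_eq lX); exact: mrepr_mpi. Qed.

Lemma mquot_mul x y : mmul (pi x : mquot X) (pi y) = pi (mmul x y).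
Proof.
apply/mpi_eqP; apply: le_anti; rewrite ldist_ge0 // andbT.
by apply: (le_trans (ldist_mul lX _ _ _ _)); rewrite !mrepr_mpi addr0.
Qed.

Lemma mquot_inv x : minv (pi x : mquot X) = pi (minv x).
Proof.
apply/mpi_eqP; apply: le_anti; rewrite ldist_ge0 // andbT.
by apply: (le_trans (ldist_inv lX _ _)); rewrite mrepr_mpi mulr0.
Qed.

Lemma mquot_eq (c d : mquot X) : mdist c d = 0 -> c = d.
Proof. by move=> cd; rewrite -(mreprK c) -(mreprK d); apply/mpi_eqP. Qed.

Lemma mquot_surj (c : mquot X) : exists x, c = pi x.
Proof. by exists (mrepr c); rewrite mreprK. Qed.

Lemma mquot_lawful : lawful (mquot X).
Proof.
split=> *; [exact: (ldist0 lX)|exact: (ldistC lX)|exact: (ldist_tri lX)|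
  exact: (ldist_ge0 lX)|exact: (ldist_le1 lX)|..].
  apply: le_trans (ldist_mul lX _ _ _ _); rewrite le_eqVlt; apply/orP; left.
  by apply/eqP; apply: (ldist_eq lX); exact: mrepr_mpi.
apply: le_trans (ldist_inv lX _ _); rewrite le_eqVlt; apply/orP; left.
by apply/eqP; apply: (ldist_eq lX); exact: mrepr_mpi.
Qed.

End Quotient.

Lemma mquot_lift (R : realType) (X Y : metricMonoid R) (F : X -> mquot Y) :
  lawful X -> lawful Y -> isometric_embedding F ->
  isometric_embedding (fun c : mquot X => F (mrepr c)).
Proof.
move=> lX lY [F1 FM FV Fd].
have Feq x y : mdist x y = 0 -> F x = F y.
  by move=> xy; apply: (mquot_eq lY); rewrite Fd.
split=> [|x y|x|x y].
- by rewrite -F1; apply: Feq; exact: mrepr_mpi.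
- by rewrite -FM; apply: Feq; exact: mrepr_mpi.
- by rewrite -FV; apply: Feq; exact: mrepr_mpi.
- by rewrite Fd.
Qed.

Section Ultralimit.
Context {R : realType} (U : set_system nat) {UU : UltraFilter U}.
Implicit Types u v : nat -> R.

Definition ulim u : R := lim (u @ U).

(** An ultrafilter on the compact interval [[0, 1]] has a cluster point and converges to it. *)
Lemma ulim_cvg u : (forall k, 0 <= u k <= 1) -> u @ U --> ulim u.
Proof.
move=> u01.
have U01 : (u @ U) `[0, 1]%classic by apply: (@filterE _ U) => k; rewrite /= in_itv /= u01.
have [l [_ ul]] := segment_compact _ U01.
apply/cvg_ex; exists l => V lV; have [//|nV] := in_ultra_setVsetC (u @^-1` V) UU.
have nV' : (u @ U) (~` V) by [].
by have [x []] := ul _ _ nV' lV.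
Qed.

Lemma cvg_ulim u l : u @ U --> l -> ulim u = l.
Proof. by move=> /cvg_lim; apply. Qed.

Lemma ulim_cst l : ulim (fun=> l) = l.
Proof. by apply: cvg_ulim; exact: cvg_cst. Qed.

Lemma ulim_le u v : (forall k, 0 <= u k <= 1) -> (forall k, 0 <= v k <= 1) ->
  (forall k, u k <= v k) -> ulim u <= ulim v.
Proof.
move=> u01 v01 uv; apply: (ler_cvg_to (ulim_cvg u01) (ulim_cvg v01)).
by apply: (@filterE _ U).
Qed.

Lemma ulimD u v : (forall k, 0 <= u k <= 1) -> (forall k, 0 <= v k <= 1) ->
  ulim (fun k => u k + v k) = ulim u + ulim v.
Proof. by move=> u01 v01; apply: cvg_ulim; apply: cvgD; exact: ulim_cvg. Qed.

Lemma ulim_leD w u v : (forall k, 0 <= w k <= 1) -> (forall k, 0 <= u k <= 1) ->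
  (forall k, 0 <= v k <= 1) -> (forall k, w k <= u k + v k) ->
  ulim w <= ulim u + ulim v.
Proof.
move=> w01 u01 v01 wuv.
apply: (ler_cvg_to (ulim_cvg w01) (cvgD (ulim_cvg u01) (ulim_cvg v01))).
by apply: (@filterE _ U).
Qed.

Lemma ulim_ge0 u : (forall k, 0 <= u k <= 1) -> 0 <= ulim u.
Proof.
move=> u01; rewrite -[leLHS](ulim_cst 0); apply: ulim_le => // k.
  by rewrite lexx ler01.
by case/andP: (u01 k).
Qed.

Lemma ulim_le1 u : (forall k, 0 <= u k <= 1) -> ulim u <= 1.
Proof.
move=> u01; rewrite -[leRHS](ulim_cst 1); apply: ulim_le => // k.
  by rewrite lexx ler01.
by case/andP: (u01 k).
Qed.

Lemma prod_monoid_lawful (M : nat -> metricMonoid R) :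
  (forall k, lawful (M k)) -> lawful (prod_monoid U M).
Proof.
move=> lM; have d01 (x y : prod_monoid U M) k : 0 <= mdist (x k) (y k) <= 1.
  by rewrite (ldist_ge0 (lM k)) (ldist_le1 (lM k)).
split.
- move=> x; rewrite -[RHS](ulim_cst 0); congr ulim; apply/funext => k.
  exact: (ldist0 (lM k)).
- by move=> x y; congr ulim; apply/funext => k; exact: (ldistC (lM k)).
- by move=> x y z; apply: ulim_leD => // k; exact: (ldist_tri (lM k)).
- by move=> x y; exact: ulim_ge0.
- by move=> x y; exact: ulim_le1.
- by move=> x x' y y'; apply: ulim_leD => // k; exact: (ldist_mul (lM k)).
- move=> x y; rewrite (_ : 2 = 1 + 1) // mulrDl !mul1r.
  apply: ulim_leD => // k.
  by apply: (le_trans (ldist_inv (lM k) _ _)); rewrite (_ : 2 = 1 + 1) // mulrDl !mul1r.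
Qed.

End Ultralimit.

Lemma sym_group_lawful (R : realType) n : lawful (sym_group R n.+1).
Proof.
have n0 : (0 : R) < n.+1%:R by rewrite ltr0n.
have H (A B C : {set 'I_n.+1}) : A \subset B :|: C ->
    #|A|%:R / n.+1%:R <= #|B|%:R / n.+1%:R + #|C|%:R / n.+1%:R :> R.
  move=> /subset_leq_card ABC; rewrite -mulrDl ler_pM2r ?invr_gt0 // -natrD ler_nat.
  by apply: (leq_trans ABC); rewrite cardsU leq_subr.
have H2 (A B : {set 'I_n.+1}) : A \subset B ->
    #|A|%:R / n.+1%:R <= #|B|%:R / n.+1%:R :> R.
  by move=> AB; rewrite ler_pM2r ?invr_gt0 // ler_nat subset_leq_card.
split => /=.
- move=> x; rewrite (_ : finset _ = finset.set0) ?cards0 ?mul0r //.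
  by apply/setP => y; rewrite !inE eqxx.
- move=> x y; congr (_%:R / _); apply: eq_card => z; rewrite !inE eq_sym //.
- move=> x y z; apply: H; apply/fintype.subsetP => t; rewrite !inE.
  by apply: contraR; rewrite negb_or !negbK => /andP[/eqP -> /eqP ->].
- by move=> x y; rewrite divr_ge0.
- move=> x y; rewrite ler_pdivrMr // mul1r ler_nat -[leqRHS]card_ord.
  exact: max_card.
- move=> x x' y y'.
  pose A := [set z | x z != x' z]%SET; pose B := [set z | y z != y' z]%SET.
  rewrite -[#|A|](card_imset A (perm_inj (s := y^-1%g))).
  apply: H; apply/fintype.subsetP => t; rewrite !inE !permM.
  case: (eqVneq (y t) (y' t)) => [<- ne|]; last by rewrite orbT.
  by rewrite orbF; apply/imsetP; exists (y t); rewrite ?inE // permK.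
- move=> x y; rewrite (_ : 2 = 1 + 1) // mulrDl mul1r -[leLHS]addr0.
  apply: lerD; last by rewrite divr_ge0.
  pose A := [set z | x z != y z]%SET.
  rewrite -[#|A|](card_imset A (perm_inj (s := y))).
  apply: H2; apply/fintype.subsetP => t; rewrite !inE => ne.
  apply/imsetP; exists (y^-1%g t); rewrite ?permKV // inE permKV.
  apply: contraNneq ne => e; rewrite -{1}e permK //.
Qed.

(** * The pseudometric of the Borel full semigroup *)

Section BorelFullSemigroup.
Context {R : realType} (G : pmpGroupoid R).
Local Notation mul := (@pmp_mul R G).
Local Notation inv := (@pmp_inv R G).
Local Notation s := (src mul inv).
Local Notation r := (rng mul inv).
Local Notation bis := (bisections mul inv).
Implicit Types a b : set G.

Let Ggrp : is_groupoid mul inv := dmg_groupoid (pmp_dmg G).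

Lemma bisD a b : bis a -> bis b -> bis (a `\` b).
Proof.
move=> ba bb; apply: (bisS ba); first exact: subDsetl.
by apply: measurableD; exact: bis_meas.
Qed.

Lemma image_symdiff (f : G -> G) a b : f @` (a `+` b) = f @` (a `\` b) `|` f @` (b `\` a).
Proof. by rewrite image_setU. Qed.

Lemma src_symdiff_meas a b : bis a -> bis b -> measurable (s @` (a `+` b)).
Proof.
move=> ba bb; rewrite image_symdiff.
by apply: measurableU; apply: image_src_meas; exact: bisD.
Qed.

Lemma setmul_src_diff a b a' b' :
  s @` (setmul mul inv a b `\` setmul mul inv a' b') `<=`
  s @` (b `\` b') `|` s @` ((b `&` b') `&` r @^-1` (s @` (a `\` a'))).
Proof.
move=> _ [_ [[h [k [ah bk hk ->]]] n] <-]; rewrite src_mul //.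
case: (pselect (b' k)) => b'k; last by left; exists k.
right; exists k => //; split=> //=; exists h => //; split=> // a'h.
by apply: n; exists h, k.
Qed.

Lemma borel_full_semigroup_lawful : lawful (borel_full_semigroup G).
Proof.
have bv (a : borel_full_semigroup G) := bis_val a.
have mE (a b : borel_full_semigroup G) : measurable (s @` (val a `+` val b)).
  exact: src_symdiff_meas.
have dE (a b : borel_full_semigroup G) : mdist a b = pm (s @` (val a `+` val b)) by [].
split.
- by move=> a; rewrite dE setYK image_set0 pm0.
- by move=> a b; rewrite !dE setYC.
- move=> a b c; rewrite !dE; apply: le_trans (pmU_le _ _) => //.
  apply: pm_le => //; first exact: measurableU.
  rewrite -image_setU; apply: image_subset => x.
  case=> -[? ?]; case: (pselect (val b x)) => bx.
  + by right; left.
  + by left; left.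
  + by left; right.
  + by right; right.
- by move=> a b; exact: pm_ge0.
- by move=> a b; exact: pm_le1.
- move=> a a' b b'; rewrite !dE !val_bmul.
  set E := s @` (val a `+` val a').
  (* At the arrows common to [b] and [b'] the products can differ only where the range lies in [E];
     invariance bounds the measure of the sources of these arrows by that of [E]. *)
  pose t := (val b `&` val b') `&` r @^-1` E.
  have bt : bis t.
    have bbI : bis (val b `&` val b').
      apply: (bisS (bv b)); first exact: subIsetl.
      by apply: measurableI; apply: bis_meas; exact: bv.
    exact: (bis_restr_rng bbI (mE a a')).
  have tE : pm (s @` t) <= pm E.
    rewrite (pm_bis bt); apply: (pm_le _ (mE a a')); first exact: image_rng_meas.
    by move=> _ [g [_ Eg] <-].
  rewrite addrC; apply: (@le_trans _ _ (pm (s @` (val b `+` val b')) + pm (s @` t)));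
    last by rewrite lerD2l.
  have mt := image_src_meas bt.
  have mEb := mE b b'.
  apply: le_trans (pmU_le mEb mt); apply: pm_le.
  + by apply: src_symdiff_meas; exact: bis_mul.
  + exact: measurableU.
  rewrite image_symdiff => x [|] /setmul_src_diff[[k [bk nb] <-]|[k [[bk b'k] [h [ah nah] e]] <-]].
  + by left; exists k => //; left.
  + by right; exists k => //; split=> //=; exists h => //; left.
  + by left; exists k => //; right.
  + by right; exists k => //; split=> //=; exists h => //; right.
- move=> a b; rewrite !dE.
  have e : s @` (val (minv a) `+` val (minv b)) = r @` (val a `+` val b).
    rewrite !image_symdiff.
    have inj := inv_inj (ginvK Ggrp).
    have half (c d : set G) : s @` (inv @` c `\` inv @` d) = r @` (c `\` d).
      apply/seteqP; split=> [_ [_ [[g cg <-] nd] <-]|_ [g [cg nd] <-]].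
        by exists g; [split=> // dg; apply: nd; exists g|rewrite src_inv].
      exists (inv g); last by rewrite src_inv.
      by split; [exists g|move=> [h dh /inj hg]; apply: nd; rewrite -hg].
    by rewrite /= !half.
  rewrite e image_symdiff.
  have ra := image_rng_meas (bisD (bv a) (bv b)).
  have rb := image_rng_meas (bisD (bv b) (bv a)).
  (* Inversion exchanges sources and ranges. The two differences may have common sources even when
     their ranges are disjoint, whence the factor 2. *)
  apply: (le_trans (pmU_le ra rb)).
  rewrite -!pm_bis; try exact: bisD.
  rewrite (_ : 2 = 1 + 1) // mulrDl !mul1r; apply: lerD; apply: pm_le => //.
  + by apply: image_src_meas; exact: bisD.
  + by rewrite image_symdiff; left.
  + by apply: image_src_meas; exact: bisD.
  + by rewrite image_symdiff; right.
Qed.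

Lemma full_semigroup_lawful : lawful (full_semigroup G).
Proof. by apply: mquot_lawful; exact: borel_full_semigroup_lawful. Qed.

End BorelFullSemigroup.

(** * Densities along the ultrafilter *)

(** The complements of the domain and of the image have the same cardinality; matching their
    enumerations completes [f]. *)
Lemma perm_extend (T : finType) (p : pred T) (f : T -> T) :
  {in p &, injective f} -> exists t : {perm T}, forall y, p y -> t y = f y.
Proof.
move=> finj; pose A : {set T} := [set y | p y]%SET.
have cA : #|finset.setC A| = #|finset.setC (f @: A)%SET|.
  have e : #|(f @: A)%SET| = #|A|.
    by apply: card_in_imset => x y; rewrite !inE; exact: finj.
  by apply: (@addnI #|A|); rewrite cardsC -[in RHS]e cardsC.
pose g y := if p y then f y else
  nth y (enum (finset.setC (f @: A)%SET)) (index y (enum (finset.setC A))).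
have sz y : ~~ p y -> (index y (enum (finset.setC A)) < size (enum (finset.setC (f @: A)%SET)))%N.
  by move=> py; rewrite -cardE -cA cardE index_mem mem_enum !inE.
have gC y : ~~ p y -> g y \notin (f @: A)%SET.
  move=> py; rewrite /g (negbTE py); have := mem_nth y (sz y py).
  by rewrite mem_enum !inE.
have ginj : injective g.
  move=> x y; have [px|px] := boolP (p x); have [py|py] := boolP (p y).
  - by rewrite /g px py; exact: finj.
  - move=> e; have := gC y py; rewrite -e /g px => /negP[].
    by apply: imset_f; rewrite inE.
  - move=> e; have := gC x px; rewrite e /g py => /negP[].
    by apply: imset_f; rewrite inE.
  - rewrite /g (negbTE px) (negbTE py) (set_nth_default y x) ?sz // => /eqP.
    rewrite nth_uniq ?enum_uniq ?sz // => /eqP.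
    have xs : x \in enum (finset.setC A) by rewrite mem_enum !inE.
    have ys : y \in enum (finset.setC A) by rewrite mem_enum !inE.
    by move=> e; rewrite -(nth_index x xs) e nth_index.
by exists (perm ginj) => y py; rewrite permE /g py.
Qed.

Section Density.
Context {R : realType} (U : set_system nat) {UU : UltraFilter U}.
Implicit Types P Q S V : forall k, pred 'I_k.+1.
Implicit Types t : forall k, {perm 'I_k.+1}.

Definition freq k (p : pred 'I_k.+1) : R := #|[set y | p y]%SET|%:R / k.+1%:R.

Lemma freq01 k p : 0 <= @freq k p <= 1.
Proof.
rewrite divr_ge0 //= ler_pdivrMr ?ltr0n // mul1r ler_nat -[leqRHS]card_ord.
exact: max_card.
Qed.

Lemma freq_le k (p q : pred 'I_k.+1) : (forall y, p y -> q y) -> freq p <= freq q.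
Proof.
move=> pq; rewrite ler_pM2r ?invr_gt0 ?ltr0n // ler_nat subset_leq_card //.
by apply/fintype.subsetP => y; rewrite !inE; exact: pq.
Qed.

Lemma freqU k (p q : pred 'I_k.+1) :
  freq (fun y => p y || q y) + freq (fun y => p y && q y) = freq p + freq q.
Proof.
rewrite -!mulrDl -!natrD; congr (_%:R / _); rewrite -[RHS]cardsUI.
by congr (_ + _)%N; apply: eq_card => y; rewrite !inE.
Qed.

Lemma freq_perm k (p : pred 'I_k.+1) (t : {perm 'I_k.+1}) :
  freq (fun y => p (t y)) = freq p.
Proof.
congr (_%:R / _); rewrite -(card_imset _ (@perm_inj _ t)).
apply: eq_card => y; rewrite !inE; apply/imsetP/idP.
  by move=> [x]; rewrite inE => px ->.
by move=> py; exists (t^-1%g y); rewrite ?inE permKV.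
Qed.

(** The Loeb measure of the internal set whose section at [k] is [P k]. *)
Definition dens P : R := ulim U (fun k => freq (P k)).
Definition ae P : Prop := dens (fun k y => ~~ P k y) = 0.

Lemma dens_ge0 P : 0 <= dens P.
Proof. by apply: ulim_ge0 => k; exact: freq01. Qed.

Lemma dens_le P Q : (forall k y, P k y -> Q k y) -> dens P <= dens Q.
Proof.
by move=> PQ; apply: ulim_le => k; [exact: freq01|exact: freq01|apply: freq_le; exact: PQ].
Qed.

Lemma densU P Q :
  dens (fun k y => P k y || Q k y) + dens (fun k y => P k y && Q k y) = dens P + dens Q.
Proof.
rewrite /dens -!ulimD; try by move=> k; exact: freq01.
by congr ulim; apply/funext => k; exact: freqU.
Qed.

Lemma dens0 : dens (fun k y => false) = 0.
Proof.
rewrite /dens (_ : (fun _ => _) = fun=> 0) ?ulim_cst //; apply/funext => k.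
by rewrite /freq (eq_card0 (A := mem [set y | false]%SET)) ?mul0r // => y; rewrite !inE.
Qed.

Lemma dens1 : dens (fun k y => true) = 1.
Proof.
rewrite /dens (_ : (fun _ => _) = fun=> 1) ?ulim_cst //; apply/funext => k.
rewrite /freq (eq_card (B := predT)) ?card_ord ?divff ?pnatr_eq0 // => y.
by rewrite !inE.
Qed.

Lemma dens_eq P Q : (forall k y, P k y = Q k y) -> dens P = dens Q.
Proof. by move=> PQ; apply: le_anti; rewrite !dens_le // => k y; rewrite PQ. Qed.

Lemma densC P : dens P + dens (fun k y => ~~ P k y) = 1.
Proof.
rewrite -densU (@dens_eq _ (fun=> xpredT)) => [|k y]; last by rewrite orbN.
by rewrite dens1 (@dens_eq _ (fun=> xpred0)) ?dens0 ?addr0 // => k y; rewrite andbN.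
Qed.

Lemma ae1 P : dens P = 1 -> ae P.
Proof. by have := densC P => + P1; rewrite P1 /ae; lra. Qed.

Lemma ae_imp P Q : ae P -> (forall k y, P k y -> Q k y) -> ae Q.
Proof.
move=> P0 PQ; apply: le_anti; rewrite dens_ge0 andbT -[leRHS]P0.
by apply: dens_le => k y; apply: contraNN; exact: PQ.
Qed.

Lemma ae_all P : (forall k y, P k y) -> ae P.
Proof.
by move=> PT; apply: le_anti; rewrite dens_ge0 andbT -[leRHS]dens0 dens_le // => k y; rewrite PT.
Qed.

Lemma ae_and P Q : ae P -> ae Q -> ae (fun k y => P k y && Q k y).
Proof.
move=> P0 Q0; apply: le_anti; rewrite dens_ge0 andbT.
have := densU (fun k y => ~~ P k y) (fun k y => ~~ Q k y); rewrite P0 Q0 addr0 => e.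
rewrite -[leRHS]e (@dens_eq _ (fun k y => ~~ P k y || ~~ Q k y)) => [|k y].
  by rewrite lerDl dens_ge0.
by rewrite negb_and.
Qed.

Lemma ae_imp2 P Q S : ae P -> ae Q -> (forall k y, P k y -> Q k y -> S k y) -> ae S.
Proof.
move=> P0 Q0 PQS; apply: (ae_imp (ae_and P0 Q0)) => k y /andP[]; exact: PQS.
Qed.

Lemma ae_imp3 P Q S V : ae P -> ae Q -> ae S ->
  (forall k y, P k y -> Q k y -> S k y -> V k y) -> ae V.
Proof.
move=> P0 Q0 S0 H; apply: (ae_imp2 (ae_and P0 Q0) S0) => k y /andP[]; exact: H.
Qed.

Lemma dens_perm P t : dens (fun k y => P k (t k y)) = dens P.
Proof. by congr ulim; apply/funext => k; exact: freq_perm. Qed.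

Lemma ae_perm P t : ae P -> ae (fun k y => P k (t k y)).
Proof. by rewrite /ae (dens_perm (fun k y => ~~ P k y)). Qed.

Lemma dens_ae_le P Q : ae (fun k y => P k y ==> Q k y) -> dens P <= dens Q.
Proof.
move=> PQ; apply: (@le_trans _ _ (dens (fun k y => Q k y || ~~ (P k y ==> Q k y)))).
  by apply: dens_le => k y Py; rewrite Py /=; case: (Q k y).
have := densU Q (fun k y => ~~ (P k y ==> Q k y)); rewrite PQ addr0 => <-.
by rewrite lerDl dens_ge0.
Qed.

Lemma dens_ae_eq P Q : ae (fun k y => P k y == Q k y) -> dens P = dens Q.
Proof.
move=> PQ; apply: le_anti; rewrite !dens_ae_le //;
by apply: (ae_imp PQ) => k y /eqP ->; rewrite implybb.
Qed.

Lemma densD P Q : ae (fun k y => ~~ (P k y && Q k y)) ->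
  dens (fun k y => P k y || Q k y) = dens P + dens Q.
Proof.
rewrite -densU /ae (@dens_eq (fun k y => ~~ ~~ _) (fun k y => P k y && Q k y)).
  by move=> ->; rewrite addr0.
by move=> k y; rewrite negbK.
Qed.

(** A difference of density 0 is negligible. This is how the reverse inclusions are obtained in the
    extension argument. *)
Lemma ae_sub_eq P Q : ae (fun k y => P k y ==> Q k y) -> dens P = dens Q ->
  ae (fun k y => P k y == Q k y).
Proof.
move=> PQ e.
have disj : ae (fun k y => ~~ (P k y && (Q k y && ~~ P k y))).
  by apply: ae_all => k y; case: (P k y) => //=; rewrite andbF.
have H := densD disj; rewrite (@dens_ae_eq _ Q) -?e in H; last first.
  by apply: (ae_imp PQ) => k y; case: (P k y) => /=; [move=> ->|rewrite andbT].
have QP : dens (fun k y => Q k y && ~~ P k y) = 0 by lra.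
apply: (ae_imp2 PQ (_ : ae (fun k y => ~~ (Q k y && ~~ P k y)))).
  by rewrite /ae -[RHS]QP; apply: dens_eq => k y; exact: negbK.
by move=> k y; case: (P k y); case: (Q k y).
Qed.

End Density.

(** * Partial bijections of a finite set and their ultraproduct *)

Section PartialPerm.
Context {R : realType} (n : nat).
Implicit Types (t : {perm 'I_n.+1}) (p q : pred 'I_n.+1).

Definition pperm_set t p : set (square n) := [set z | z.1 = t z.2 /\ p z.2].

Lemma pperm_bis t p : bisections (@sq_mul n) (@sq_inv n) (pperm_set t p).
Proof.
split=> // -[x y] [z w] /set_mem[/= -> _] /set_mem[/= -> _].
  by rewrite !sq_src /= => -[->].
by rewrite !sq_rng /= => -[/perm_inj ->].
Qed.

(* A partial bijection is encoded by a permutation extending it and its domain. *)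
Definition pperm t p : borel_full_semigroup (sq_pmp R n) :=
  exist _ (pperm_set t p) (mem_set (pperm_bis t p)).

Lemma pperm_dist t p t' p' : mdist (pperm t p) (pperm t' p') =
  freq (fun y => (p y != p' y) || [&& p y, p' y & t y != t' y]) :> R.
Proof.
rewrite /= /bdist /= sq_muE /freq /=; congr (_%:R / _); apply: eq_card => y.
rewrite !inE; apply/idP/idP.
  move=> /set_mem[[x z] /= H [zy _]]; rewrite zy in H => {zy}.
  case: H => -[[/= -> py] n'].
    rewrite py; have [p'y|//] := boolP (p' y) => /=.
    by apply/eqP => e; apply: n'; split.
  rewrite py; have [p'y|//] := boolP (p y) => /=.
  by apply/eqP => e; apply: n'; split.
move=> H; apply/mem_set.
have [py|py] := boolP (p y).
  exists (t y, y) => //; left; split=> //= -[/= e p'y].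
  by move: H; rewrite py p'y /= e eqxx.
exists (t' y, y) => //; right; split; last by move=> [/=]; rewrite (negbTE py).
by split=> //=; move: H; rewrite (negbTE py) /=; case: (p' y).
Qed.

Lemma pperm_mul t p t' p' : mmul (pperm t p) (pperm t' p') =
  pperm (t' * t)%g (fun y => p' y && p (t' y)).
Proof.
apply: val_inj; rewrite [LHS](val_bmul (G := sq_pmp R n)) /=; apply/seteqP; split=> -[x z].
  move=> [[a b] [[c d] [[/= -> pb] [/= -> pd] ]]].
  rewrite /src /rng /sq_mul /sq_inv /= => -[e] -[-> ->].
  by rewrite /pperm_set /= permM -e pd pb.
move=> [/= -> /andP[p'z pz]]; exists (t (t' z), t' z), (t' z, z).
by split=> //; rewrite permM.
Qed.

Lemma pperm_inv t p : minv (pperm t p) = pperm t^-1%g (fun y => p (t^-1%g y)).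
Proof.
apply: val_inj; apply/seteqP; split=> -[x z] /=.
  by move=> [[a b] [/= -> pb] [<- <-]]; rewrite /pperm_set /= permK.
move=> [/= -> pz]; exists (z, t^-1%g z) => //.
by rewrite /pperm_set /= permKV.
Qed.

Lemma pperm1 : mone = pperm 1%g xpredT.
Proof.
apply: val_inj; apply/seteqP; split=> -[x z] /=.
  by move=> [[a b] _ [<- <-]]; rewrite /pperm_set /= perm1.
by move=> [/= -> _]; exists (z, z); rewrite //= perm1.
Qed.

Lemma perm_inclE t : @perm_incl R n t = mpi (pperm t xpredT).
Proof.
congr mpi; apply: val_inj; apply/seteqP; split=> -[x z] /=; last by case.
by rewrite /perm_graph /= => ->.
Qed.

Lemma pperm_surj (b : borel_full_semigroup (sq_pmp R n)) : exists t p, b = pperm t p.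
Proof.
have [_ sb rb] := bis_val b.
pose p y := `[<exists x, val b (x, y)>].
have /choice[f fP] y : exists x, p y -> val b (x, y).
  by case: (pselect (exists x, val b (x, y))) => [[x bx]|H]; [exists x|exists y => /asboolP].
have [|t tP] := @perm_extend _ p f.
  move=> x y px py e; have bx := fP _ px; have by' := fP _ py.
  have rr : rng (@sq_mul n) (@sq_inv n) (f x, x) = rng (@sq_mul n) (@sq_inv n) (f y, y).
    by rewrite !sq_rng /= e.
  by have [] := rb (f x, x) (f y, y) (mem_set bx) (mem_set by') rr.
exists t, p; apply: val_inj; apply/seteqP; split=> -[x y] /=.
  move=> bxy; have py : p y by apply/asboolP; exists x.
  split=> //=; rewrite tP //.
  by have [] := sb (x, y) (f y, y) (mem_set bxy) (mem_set (fP _ py)) erefl.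
by move=> [/= -> py]; rewrite tP //; exact: fP.
Qed.

End PartialPerm.

Section SquareUltraproduct.
Context {R : realType} (U : set_system nat) {UU : UltraFilter U}.
Local Notation dens := (@dens R U).
Local Notation ae := (@ae R U).
Implicit Types (t : forall k, {perm 'I_k.+1}) (p : forall k, pred 'I_k.+1).

Lemma square_prod_lawful :
  lawful (prod_monoid U (fun k => full_semigroup (sq_pmp R k))).
Proof. by apply: prod_monoid_lawful => k; exact: full_semigroup_lawful. Qed.

Lemma sym_prod_lawful : lawful (prod_monoid U (fun k => sym_group R k.+1)).
Proof. by apply: prod_monoid_lawful => k; exact: sym_group_lawful. Qed.

Let sqB n := borel_full_semigroup_lawful (sq_pmp R n).

Definition upperm t p : square_ultraprod U :=
  mpi ((fun k => mpi (pperm (t k) (p k)))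
    : prod_monoid U (fun k => full_semigroup (sq_pmp R k))).

Lemma upperm_dist t p t' p' : mdist (upperm t p) (upperm t' p') =
  dens (fun k y => (p k y != p' k y) || [&& p k y, p' k y & t k y != t' k y]).
Proof.
rewrite mquot_dist; last exact: square_prod_lawful.
congr ulim; apply/funext => k; rewrite -pperm_dist; exact: mquot_dist.
Qed.

Lemma upperm_eq t p t' p' :
  ae (fun k y => (p k y == p' k y) && (p k y ==> (t k y == t' k y))) ->
  upperm t p = upperm t' p'.
Proof.
move=> H; apply: (mquot_eq square_prod_lawful); rewrite [LHS]upperm_dist.
rewrite -[RHS]H; apply: dens_eq => k y.
by case: (p k y); case: (p' k y).
Qed.

Lemma upperm_inj t p t' p' : upperm t p = upperm t' p' ->
  ae (fun k y => (p k y == p' k y) && (p k y ==> (t k y == t' k y))).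
Proof.
move=> e; have := upperm_dist t p t' p'; rewrite e.
rewrite (ldist0 (mquot_lawful square_prod_lawful)) => D.
rewrite /ae [RHS]D; apply: dens_eq => k y.
by case: (p k y); case: (p' k y).
Qed.

Lemma upperm_mul t p t' p' : mmul (upperm t p) (upperm t' p') =
  upperm (fun k => t' k * t k)%g (fun k y => p' k y && p k (t' k y)).
Proof.
rewrite [LHS](mquot_mul square_prod_lawful); congr mpi.
apply: functional_extensionality_dep => k; rewrite -pperm_mul.
exact: (mquot_mul (@sqB k)).
Qed.

Lemma upperm_inv t p : minv (upperm t p) =
  upperm (fun k => (t k)^-1)%g (fun k y => p k ((t k)^-1%g y)).
Proof.
rewrite [LHS](mquot_inv square_prod_lawful); congr mpi.
apply: functional_extensionality_dep => k; rewrite -pperm_inv.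
exact: (mquot_inv (@sqB k)).
Qed.

Lemma upperm1 : mone = upperm (fun=> 1%g) (fun=> xpredT).
Proof.
by congr mpi; apply: functional_extensionality_dep => k; rewrite -pperm1.
Qed.

Lemma upperm_surj (x : square_ultraprod U) : exists t p, x = upperm t p.
Proof.
have [f ->] := mquot_surj x.
have H k : {tp : {perm 'I_k.+1} * pred 'I_k.+1 | f k = mpi (pperm tp.1 tp.2)}.
  apply: cid; have [b fb] := mquot_surj (f k); have [t [p bE]] := pperm_surj b.
  by exists (t, p); rewrite fb bE.
exists (fun k => (sval (H k)).1), (fun k => (sval (H k)).2); congr mpi.
by apply: functional_extensionality_dep => k; case: (H k).
Qed.

Lemma sym_ultraprod_inclE (c : sym_ultraprod U) :
  sym_ultraprod_incl c = upperm (mrepr c) (fun=> xpredT) :> square_ultraprod U.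
Proof.
by congr mpi; apply: functional_extensionality_dep => k; exact: perm_inclE.
Qed.

Lemma sym_ultraprod_dist (x y : sym_ultraprod U) :
  mdist x y = dens (fun k i => (mrepr x k : {perm _}) i != (mrepr y k : {perm _}) i).
Proof. by []. Qed.

Lemma mrepr_sym (t : forall k, {perm 'I_k.+1}) :
  ae (fun k i => (mrepr (@mpi R (prod_monoid U (fun k => sym_group R k.+1)) t) k
                  : {perm _}) i == t k i).
Proof. exact: (mrepr_mpi sym_prod_lawful). Qed.

End SquareUltraproduct.

(** * Null sets and supports *)

Ltac meas := repeat first [ assumption | lazymatch goal with
  | |- bisections _ _ (_ `\` _) => apply: bisD
  | |- bisections _ _ (_ `&` (src _ _) @^-1` _) => apply: bis_restr_src
  | |- bisections _ _ (_ `&` (rng _ _) @^-1` _) => apply: bis_restr_rng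
  | |- bisections _ _ (units _ _) => apply: units_bisection
  | |- bisections _ _ (setmul _ _ _ _) => apply: bis_mul
  | |- bisections _ _ (_ @` _) => apply: inv_bisection
  | |- bisections _ _ _ => apply: bis_val
  | |- _ (units _ _) => apply: measurable_units
  | |- _ (_ `\` _) => apply: measurableD
  | |- _ (_ `&` _) => apply: measurableI
  | |- _ (_ `|` _) => apply: measurableU
  | |- _ ((src _ _) @` _) => apply: image_src_meas
  | |- _ ((rng _ _) @` _) => apply: image_rng_meas
  | |- _ ((src _ _) @^-1` _) => apply: src_preimage_meas
  | |- _ ((rng _ _) @^-1` _) => apply: rng_preimage_meas
  | |- _ => apply: bis_meas
  end ].

Section NullSets.
Context {R : realType} (G : pmpGroupoid R).
Local Notation mul := (@pmp_mul R G).
Local Notation inv := (@pmp_inv R G).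
Local Notation s := (src mul inv).
Local Notation r := (rng mul inv).
Local Notation G0 := (units mul inv).
Local Notation bis := (bisections mul inv).
Local Notation BS := (borel_full_semigroup G).
Implicit Types (A B N : set G) (a b : set G) (f g h : BS).

Let Ggrp : is_groupoid mul inv := dmg_groupoid (pmp_dmg G).

Lemma null_sub A B : measurable A -> measurable B -> A `<=` B -> pm B = 0 -> pm A = 0.
Proof. by move=> mA mB AB B0; apply: le_anti; rewrite pm_ge0 andbT -B0 pm_le. Qed.

Lemma nullU A B : measurable A -> measurable B -> pm A = 0 -> pm B = 0 -> pm (A `|` B) = 0.
Proof.
move=> mA mB A0 B0; apply: le_anti; rewrite pm_ge0 andbT.
by apply: (le_trans (pmU_le mA mB)); rewrite A0 B0 addr0.
Qed.

Lemma null_src_image a N : bis a -> measurable N -> pm N = 0 ->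
  pm (s @` (a `&` r @^-1` N)) = 0.
Proof.
move=> ba mN N0; rewrite pm_bis; last exact: bis_restr_rng.
apply: null_sub N0 => //; first by meas.
by move=> _ [g [_ ?] <-].
Qed.

Lemma null_rng_image a N : bis a -> measurable N -> pm N = 0 ->
  pm (r @` (a `&` s @^-1` N)) = 0.
Proof.
move=> ba mN N0; rewrite -pm_bis; last exact: bis_restr_src.
apply: null_sub N0 => //; first by meas.
by move=> _ [g [_ ?] <-].
Qed.

Lemma pm_null_eq A B : measurable A -> measurable B -> pm (A `\` B) = 0 ->
  pm (B `\` A) = 0 -> pm A = pm B.
Proof.
by move=> mA mB AB BA; rewrite (pmDI mA mB) (pmDI mB mA) AB BA setIC.
Qed.

Lemma pmU_null A B : measurable A -> measurable B -> pm (A `&` B) = 0 ->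
  pm (A `|` B) = pm A + pm B.
Proof.
move=> mA mB AB; rewrite (pmDI mA mB) AB addr0 -pmU //; last 2 first.
- exact: measurableD.
- by move=> x [].
congr pm; apply/seteqP; split=> x [|]; try by [left|right].
- by move=> Ax; case: (pselect (B x)); [right|left].
- by move=> [Ax _]; left.
Qed.

Definition supp g : set G := G0 `\` val g.

Lemma supp_meas g : measurable (supp g). Proof. by rewrite /supp; meas. Qed.

Lemma supp_units g : supp g `<=` G0. Proof. by move=> x []. Qed.

Lemma src_in g x : full (val g) -> G0 x -> exists2 k, val g k & s k = x.
Proof. by move=> [_ sg _] ux; move: ux; rewrite -sg => -[k]; exists k. Qed.

Lemma rng_in g x : full (val g) -> G0 x -> exists2 k, val g k & r k = x.
Proof. by move=> [_ _ rg] ux; move: ux; rewrite -rg => -[k]; exists k. Qed.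

Lemma full_bone : full (val (bone G)).
Proof.
by split; [exact: bis_val|exact: image_src_units|exact: image_rng_units].
Qed.

Lemma full_bmul f g : full (val f) -> full (val g) -> full (val (bmul f g)).
Proof.
move=> Ff Fg; split; first exact: bis_val; rewrite val_bmul; apply/seteqP; split.
- by move=> _ [x _ <-]; exact: units_src.
- move=> x ux; have [k gk kx] := src_in Fg ux.
  have [h fh hk] := src_in Ff (units_rng k).
  by exists (mul h k); [exists h, k|rewrite src_mul].
- by move=> _ [x _ <-]; exact: units_rng.
- move=> x ux; have [h fh hx] := rng_in Ff ux.
  have [k gk kh] := rng_in Fg (units_src h).
  by exists (mul h k); [exists h, k|rewrite rng_mul].
Qed.

Lemma full_binv g : full (val g) -> full (val (binv g)).
Proof.
move=> Fg; split; first exact: bis_val; apply/seteqP; split.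
- by move=> _ [x _ <-]; exact: units_src.
- move=> x ux; have [k gk kx] := rng_in Fg ux.
  by exists (inv k); [exists k|rewrite src_inv].
- by move=> _ [x _ <-]; exact: units_rng.
- move=> x ux; have [k gk kx] := src_in Fg ux.
  by exists (inv k); [exists k|rewrite rng_inv].
Qed.

Lemma binvP g x : val (binv g) x <-> val g (inv x).
Proof.
split=> [[k gk <-]|gx]; first by rewrite (ginvK Ggrp).
by exists (inv x) => //; rewrite (ginvK Ggrp).
Qed.

Lemma dist_bone g : full (val g) -> mdist g (bone G) = pm (supp g).
Proof.
move=> Fg; rewrite /= /bdist -/(pm _); congr pm; apply/seteqP; split.
  move=> _ [k [[gk nk]|[uk nk]] <-].
    split; first exact: units_src.
    move=> gs; apply: nk => /=; rewrite (bis_inj_src (bis_val g) gk gs) ?src_src //.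
    exact: units_src.
  by rewrite (unit_src uk); split.
by move=> x [ux nx]; exists x; [right|exact: unit_src].
Qed.

Lemma supp_bdiv f g : full (val f) -> full (val g) ->
  supp (bmul (binv g) f) = s @` (val f `\` val g).
Proof.
move=> Ff Fg; rewrite /supp val_bmul; apply/seteqP; split=> x.
  move=> [ux nx]; have [k fk kx] := src_in Ff ux; exists k => //; split=> // gk.
  apply: nx; exists (inv k), k; split=> //; first by apply/binvP; rewrite (ginvK Ggrp).
  by rewrite src_inv.
move=> [k [fk ngk] <-]; split; first exact: units_src.
move=> [h [k' [/binvP gh fk' hk e]]].
have kk : k' = k by apply: (bis_inj_src (bis_val f)) => //; rewrite -(src_mul hk) -e src_src.
rewrite {}kk in hk e fk'; apply: ngk; suff <- : inv h = k by [].
apply: unit_divl; first by rewrite rng_inv.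
by rewrite (ginvK Ggrp) -e; exact: units_src.
Qed.

(* [g] preserves its support: a unit it moves is sent to a unit that [f] fixes,
   off the null set where the supports meet. *)
Lemma supp_bmul_ge f g : full (val f) -> full (val g) -> pm (supp f `&` supp g) = 0 ->
  pm (supp f) + pm (supp g) <= pm (supp (bmul f g)).
Proof.
move=> Ff Fg fg0; have mf := supp_meas f; have mg := supp_meas g.
rewrite -(pmU_null mf mg fg0); pose N := supp f `&` supp g.
have mN : measurable N by exact: measurableI.
pose M := N `|` s @` (val g `&` r @^-1` N).
have mM : measurable M by rewrite /M; meas.
have M0 : pm M = 0.
  apply: nullU => //; first by meas.
  by apply: null_src_image => //; exact: bis_val.
apply: (@le_trans _ _ (pm (supp (bmul f g) `|` M))); last first.
  by apply: (le_trans (pmU_le (supp_meas _) mM)); rewrite M0 addr0.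
apply: pm_le; [exact: measurableU|apply: measurableU => //; exact: supp_meas|].
move=> x xfg; have ux : G0 x by case: xfg => -[].
case: (pselect (M x)) => [Mx|nM]; [by right|left; split=> //].
rewrite val_bmul => -[h [k [fh gk hk e]]].
have kx : s k = x by rewrite -(src_mul hk) -e unit_src.
have hx : r h = x by rewrite -(rng_mul hk) -e unit_rng.
case: (pselect (val g x)) => [gx|ngx].
  have kxx : k = x by apply: (bis_inj_src (bis_val g)) => //; rewrite kx unit_src.
  have sx : s h = x by rewrite hk kxx unit_rng.
  rewrite kxx (mul_src_unit sx) in e.
  by case: xfg => [[_ nfx]|[_ //]]; apply: nfx; rewrite e.
have fx : val f x.
  by apply: contrapT => nfx; apply: nM; left; split.
have hxx : h = x by apply: (bis_inj_rng (bis_val f)) => //; rewrite hx unit_rng.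
apply: ngx; rewrite e hxx mul_rng_unit // -hk hxx; exact: unit_src.
Qed.

(** By [full_extension] a suitable [f] exists, so the default [bone G] is never resorted to. *)
Definition extension g : BS :=
  xget (bone G) [set f | full (val f) /\ pm (s @` (val g `\` val f)) = 0].

Lemma extensionP g : full (val (extension g)) /\
  pm (s @` (val g `\` val (extension g))) = 0.
Proof.
apply: (@xgetPex _ (bone G) [set f : BS | full (val f) /\ pm (s @` (val g `\` val f)) = 0]).
have [b Fb b0] := full_extension (bis_val g).
have [bb _ _] := Fb.
by exists (exist _ b (mem_set bb)).
Qed.

Definition with_support A : BS :=
  xget (bone G) [set f | [/\ full (val f), pm (A `&` val f) = 0 & G0 `\` A `<=` val f]].

Lemma with_supportP A : aperiodic G -> measurable A -> A `<=` G0 ->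
  [/\ full (val (with_support A)), pm (A `&` val (with_support A)) = 0
    & G0 `\` A `<=` val (with_support A)].
Proof.
move=> aper mA AG.
apply: (@xgetPex _ (bone G) [set f : BS | [/\ full (val f), pm (A `&` val f) = 0 &
  G0 `\` A `<=` val f]]).
have [b [Fb b0 Ab]] := support_exists aper mA AG; have [bb _ _] := Fb.
by exists (exist _ b (mem_set bb)).
Qed.

End NullSets.

(** * The extension of an embedding of the full group *)

Section FullGroupElt.
Context {R : realType} (G : pmpGroupoid R).
Local Notation BS := (borel_full_semigroup G).
Implicit Types f g : BS.

(* The class of [f] if [f] is full; the unit is a junk value. *)
Definition full_group_elt f : full_group G :=
  insubd (mone : full_group G) (mpi f : full_semigroup G).

Lemma full_group_eltE f : full (val f) -> full_group_incl (full_group_elt f) = mpi f.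
Proof.
move=> [_ sf rf]; rewrite /full_group_incl val_insubd ifT //.
by apply: mem_set; exists f.
Qed.

Lemma full_group_elt_dist f g : full (val f) -> full (val g) ->
  mdist (full_group_elt f) (full_group_elt g) = mdist f g.
Proof.
move=> Ff Fg; rewrite -(mquot_dist (borel_full_semigroup_lawful G)).
by rewrite -!full_group_eltE.
Qed.

Lemma full_group_elt_mul f g : full (val f) -> full (val g) ->
  full_group_elt (bmul f g) = mmul (full_group_elt f) (full_group_elt g).
Proof.
move=> Ff Fg; rewrite /= /submonoid /=; congr insubd.
have := full_group_eltE Ff; have := full_group_eltE Fg; rewrite /full_group_incl => -> ->.
by rewrite [RHS](mquot_mul (borel_full_semigroup_lawful G)).
Qed.

Lemma full_group_elt_inv f : full (val f) ->
  full_group_elt (binv f) = minv (full_group_elt f).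
Proof.
move=> Ff; congr insubd.
have := full_group_eltE Ff; rewrite /full_group_incl => ->.
by rewrite [RHS](mquot_inv (borel_full_semigroup_lawful G)).
Qed.

Lemma full_group_elt1 : full_group_elt (bone G) = mone.
Proof. by apply: val_inj; exact: (full_group_eltE (full_bone G)). Qed.

Lemma full_group_surj (x : full_group G) :
  exists2 f, full (val f) & x = full_group_elt f.
Proof.
have [f [sf rf xf]] := set_mem (valP x).
have Ff : full (val f) by split=> //; exact: bis_val.
by exists f => //; apply: val_inj; rewrite xf; exact/esym/full_group_eltE.
Qed.

End FullGroupElt.

Section Extension.
Context {R : realType} (U : set_system nat) {UU : UltraFilter U}.
Context (G : pmpGroupoid R).
Hypothesis aper : aperiodic G.
Variable theta : full_group G -> @sym_ultraprod R U.
Hypothesis theta_emb : isometric_embedding theta.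
Local Notation mul := (@pmp_mul R G).
Local Notation inv := (@pmp_inv R G).
Local Notation s := (src mul inv).
Local Notation r := (rng mul inv).
Local Notation G0 := (units mul inv).
Local Notation bis := (bisections mul inv).
Local Notation BS := (borel_full_semigroup G).
Local Notation dens := (@dens R U).
Local Notation ae := (@ae R U).
Local Notation upperm := (@upperm R U).
Implicit Types (A B N : set G) (a b f g h : BS).

(** Permutations representing the image of [f]. They are chosen in a class of the ultraproduct, so
    the homomorphism identities hold for them only up to [ae]. *)
Definition lift f : forall k, {perm 'I_k.+1} := mrepr (theta (full_group_elt f)).

Lemma lift_dist f g : full (val f) -> full (val g) ->
  dens (fun k y => lift f k y != lift g k y) = mdist f g.
Proof.
move=> Ff Fg; rewrite -full_group_elt_dist // -(emb_dist theta_emb).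
by rewrite sym_ultraprod_dist.
Qed.

Lemma lift_mul f g : full (val f) -> full (val g) ->
  ae (fun k y => lift (bmul f g) k y == lift f k (lift g k y)).
Proof.
move=> Ff Fg; rewrite /lift full_group_elt_mul // (emb_mul theta_emb).
apply: (ae_imp (mrepr_sym (fun k => lift g k * lift f k)%g)) => k y /eqP ->.
by rewrite permM.
Qed.

Lemma lift_inv f : full (val f) ->
  ae (fun k y => lift (binv f) k y == (lift f k)^-1%g y).
Proof.
move=> Ff; rewrite /lift full_group_elt_inv // (emb_inv theta_emb).
exact: (mrepr_sym (fun k => (lift f k)^-1)%g).
Qed.

Lemma lift1 : ae (fun k y => lift (bone G) k y == y).
Proof.
rewrite /lift full_group_elt1 (emb_one theta_emb).
by apply: (ae_imp (mrepr_sym (fun=> 1%g))) => k y /eqP ->; rewrite perm1.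
Qed.

Definition moved f k : pred 'I_k.+1 := fun y => lift f k y != y.
Arguments moved : clear implicits.

Lemma dens_moved f : full (val f) -> dens (moved f) = pm (supp f).
Proof.
move=> Ff; rewrite -dist_bone // -lift_dist //; last exact: full_bone.
by apply: dens_ae_eq; apply: (ae_imp lift1) => k y /eqP; rewrite /moved => ->.
Qed.

(** The support of the product is almost contained in the union of the two supports, while by
    [supp_bmul_ge] its density is at least the sum of theirs; so the intersection has density 0. *)
Lemma moved_disjoint f g : full (val f) -> full (val g) ->
  pm (supp f `&` supp g) = 0 -> ae (fun k y => ~~ (moved f k y && moved g k y)).
Proof.
move=> Ff Fg fg0; rewrite /ae; apply: le_anti; rewrite dens_ge0 andbT.
have e := @densU R U UU (moved f) (moved g); rewrite !dens_moved // in e.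
have l1 := supp_bmul_ge Ff Fg fg0.
rewrite -(dens_moved (full_bmul Ff Fg)) in l1.
have l2 : dens (moved (bmul f g)) <= dens (fun k y => moved f k y || moved g k y).
  apply: dens_ae_le; apply: (ae_imp (lift_mul Ff Fg)) => k y /eqP; rewrite /moved => ->.
  apply/implyP; apply: contraR; rewrite negb_or !negbK => /andP[/eqP fy /eqP ->].
  by rewrite fy.
rewrite (dens_eq (Q := fun k y => moved f k y && moved g k y)); last first.
  by move=> k y; rewrite negbK.
by have := le_trans l1 l2; rewrite -e gerDl.
Qed.

(** The set written P_A in the overview. *)
Definition inside A : forall k, pred 'I_k.+1 := moved (with_support A).
Arguments inside : clear implicits.

Definition unitset A : Prop := measurable A /\ A `<=` G0.

Lemma with_support_supp A : unitset A -> supp (with_support A) `<=` A.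
Proof.
move=> [mA AG] x [ux nx]; have [_ _ H] := with_supportP aper mA AG.
by apply: contrapT => nA; apply: nx; apply: H.
Qed.

Lemma full_with_support A : unitset A -> full (val (with_support A)).
Proof. by move=> [mA AG]; have [] := with_supportP aper mA AG. Qed.

Lemma dens_inside A : unitset A -> dens (inside A) = pm A.
Proof.
move=> uA; rewrite dens_moved; last exact: full_with_support.
have [mA AG] := uA; apply: pm_null_eq => //; first exact: supp_meas.
  rewrite (_ : _ `\` _ = set0) ?pm0 // -subset0 => x [/(with_support_supp uA)].
  by [].
have [_ A0 _] := with_supportP aper mA AG.
apply: null_sub A0; [by rewrite /supp; meas|by meas|].
move=> x [Ax nx]; split=> //; apply: contrapT => nW; apply: nx; split=> //; exact: AG.
Qed.

Lemma unitset_supp g : unitset (supp g).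
Proof. by split; [exact: supp_meas|exact: supp_units]. Qed.

Lemma unitsetC A : unitset A -> unitset (G0 `\` A).
Proof. by move=> [mA _]; split; [meas|move=> x []]. Qed.

Lemma unitsetI A B : unitset A -> unitset B -> unitset (A `&` B).
Proof. by move=> [mA AG] [mB _]; split; [meas|move=> x [/AG]]. Qed.

Lemma unitsetD A B : unitset A -> unitset B -> unitset (A `\` B).
Proof. by move=> [mA AG] [mB _]; split; [meas|move=> x [/AG]]. Qed.

Lemma unitsetU A B : unitset A -> unitset B -> unitset (A `|` B).
Proof. by move=> [mA AG] [mB BG]; split; [meas|move=> x [/AG|/BG]]. Qed.

Lemma unitset_src (b : set G) : bis b -> unitset (s @` b).
Proof. by split; [meas|move=> _ [x _ <-]; exact: units_src]. Qed.

Lemma unitset_rng (b : set G) : bis b -> unitset (r @` b).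
Proof. by split; [meas|move=> _ [x _ <-]; exact: units_rng]. Qed.

Lemma inside_fixed g A : full (val g) -> unitset A -> pm (supp g `&` A) = 0 ->
  ae (fun k y => inside A k y ==> ~~ moved g k y).
Proof.
move=> Fg uA gA0.
have H : pm (supp g `&` supp (with_support A)) = 0.
  have [mA _] := uA; apply: null_sub gA0; [by rewrite /supp; meas|by rewrite /supp; meas|].
  by move=> x [gx /(with_support_supp uA)].
apply: (ae_imp (moved_disjoint Fg (full_with_support uA) H)) => k y.
by rewrite negb_and /inside; case: (moved (with_support A) k y); rewrite //= orbF.
Qed.

Lemma inside_compl A : unitset A -> ae (fun k y => inside A k y == ~~ inside (G0 `\` A) k y).
Proof.
move=> uA; have uC := unitsetC uA; have [mA AG] := uA; apply: ae_sub_eq.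
  apply: inside_fixed => //; first exact: full_with_support.
  rewrite (_ : _ `&` _ = set0) ?pm0 // -subset0 => x [/(with_support_supp uC)[_ nA]].
  by [].
have := @densC R U UU (inside (G0 `\` A)); rewrite !dens_inside //.
have := pmDI (measurable_units G) mA; rewrite pm_units (setIidr AG); lra.
Qed.

(** The support of the image of [g] is disjoint from the set attached to the complement of [supp g],
    hence contained in the one attached to [supp g], and it has the same density. So it depends on
    the support of [g] only. *)
Lemma moved_inside g : full (val g) -> ae (fun k y => moved g k y == inside (supp g) k y).
Proof.
move=> Fg; have ug := unitset_supp g; apply: ae_sub_eq.
  have H : pm (supp g `&` (G0 `\` supp g)) = 0.
    by rewrite (_ : _ `&` _ = set0) ?pm0 // -subset0 => x [gx []].
  apply: (ae_imp2 (inside_fixed Fg (unitsetC ug) H) (inside_compl ug)) => k y.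
  by move=> + /eqP ->; case: (inside (G0 `\` _) k y); case: (moved g k y).
by rewrite dens_moved // dens_inside.
Qed.

Lemma inside_mono A B : unitset A -> unitset B -> pm (A `\` B) = 0 ->
  ae (fun k y => inside A k y ==> inside B k y).
Proof.
move=> uA uB AB0; have [mA AG] := uA; have [mB _] := uB.
have H : pm (supp (with_support A) `&` (G0 `\` B)) = 0.
  apply: null_sub AB0; [by rewrite /supp; meas|by meas|].
  by move=> x [/(with_support_supp uA) Ax [_ nB]].
apply: (ae_imp2 (inside_fixed (full_with_support uA) (unitsetC uB) H) (inside_compl uB)) => k y.
rewrite /inside => + /eqP ->; case: (moved (with_support (G0 `\` B)) k y) => /=.
  by move/negbTE => ->.
by rewrite implybT.
Qed.

Lemma inside_ae_eq A B : unitset A -> unitset B -> pm (A `\` B) = 0 ->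
  pm (B `\` A) = 0 -> ae (fun k y => inside A k y == inside B k y).
Proof.
move=> uA uB AB BA; apply: (ae_imp2 (inside_mono uA uB AB) (inside_mono uB uA BA)) => k y.
by case: (inside A k y); case: (inside B k y).
Qed.

Lemma inside_sub A B : unitset A -> unitset B -> A `<=` B ->
  ae (fun k y => inside A k y ==> inside B k y).
Proof.
move=> uA uB AB; apply: inside_mono => //.
by rewrite (_ : _ `\` _ = set0) ?pm0 // -subset0 => x [/AB].
Qed.

(** The sets attached to the intersection and to the difference are disjoint parts of the one
    attached to [A], and their densities add up to its density, so they fill it. The part attached
    to the difference avoids the set attached to [B]. *)
Lemma insideI A B : unitset A -> unitset B ->
  ae (fun k y => inside (A `&` B) k y == (inside A k y && inside B k y)).
Proof.
move=> uA uB; have uI := unitsetI uA uB; have uD := unitsetD uA uB.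
have [mA AG] := uA; have [mB BG] := uB.
have IA := inside_sub uI uA (@subIsetl _ A B).
have IB := inside_sub uI uB (@subIsetr _ A B).
have DA := inside_sub uD uA (@subDsetl _ A B).
have DB : ae (fun k y => inside (A `\` B) k y ==> ~~ inside B k y).
  have H : A `\` B `<=` G0 `\` B by move=> x [/AG].
  apply: (ae_imp2 (inside_sub uD (unitsetC uB) H) (inside_compl uB)) => k y.
  by move=> + /eqP ->; rewrite negbK.
have disj : ae (fun k y => ~~ (inside (A `&` B) k y && inside (A `\` B) k y)).
  apply: (ae_imp2 IB DB) => k y.
  by case: (inside _ k y) => //= ->; case: (inside _ k y).
have sub : ae (fun k y => (inside (A `&` B) k y || inside (A `\` B) k y) ==> inside A k y).
  by apply: (ae_imp2 IA DA) => k y; case: (inside (A `&` B) k y) => //=.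
have deq : dens (fun k y => inside (A `&` B) k y || inside (A `\` B) k y) = dens (inside A).
  by rewrite densD // !dens_inside // (pmDI mA mB) addrC.
have eqA := ae_sub_eq (UU := UU) sub deq.
apply: (ae_imp3 eqA IB DB) => k y /eqP <-.
by case: (inside (A `&` B) k y) => /= [->|] //; case: (inside (A `\` B) k y) => //= /negbTE ->.
Qed.

Lemma lift_divK f g : full (val f) -> full (val g) ->
  ae (fun k y => moved (bmul (binv g) f) k y == (lift f k y != lift g k y)).
Proof.
move=> Ff Fg; have Fi := full_binv Fg.
apply: (ae_imp2 (lift_mul Fi Ff) (ae_perm (lift f) (lift_inv Fg))) => k y.
rewrite /moved => /eqP -> /eqP ->; apply/eqP; congr (~~ _).
by apply/eqP/eqP => [{2}<-|->]; rewrite ?permKV ?permK.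
Qed.

(** [inside_fixed] is applied to the inverse of [g] times [f], whose support consists of the sources
    at which [f] and [g] differ. *)
Lemma inside_agree f g A : full (val f) -> full (val g) -> unitset A ->
  pm (s @` (val f `\` val g) `&` A) = 0 ->
  ae (fun k y => inside A k y ==> (lift f k y == lift g k y)).
Proof.
move=> Ff Fg uA fgA.
have Fe := full_bmul (full_binv Fg) Ff.
have H := inside_fixed Fe uA; rewrite supp_bdiv // in H.
apply: (ae_imp2 (H fgA) (lift_divK Ff Fg)) => k y + /eqP e.
by rewrite e negbK.
Qed.

(** Equivariance, by conjugation: the conjugate [e] of [W] by [g] has its support in the image [C]
    of [A], while the support of its lift is the image of [inside A] under the lift of [g]. Both
    have the measure of [A]. *)
Lemma inside_image g A : full (val g) -> unitset A ->
  ae (fun k y => inside (r @` (val g `&` s @^-1` A)) k (lift g k y) == inside A k y).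
Proof.
move=> Fg uA; have [mA AG] := uA; have FW := full_with_support uA.
pose W := with_support A; pose C := r @` (val g `&` s @^-1` A).
have bg := bis_val g.
have uC : unitset C by apply: unitset_rng; exact: bis_restr_src.
have Fi := full_binv Fg; have FgW := full_bmul Fg FW; have Fe := full_bmul FgW Fi.
pose e := bmul (bmul g W) (binv g).
have eC : supp e `<=` C.
  move=> x [ux ne]; have [k gk kx] := rng_in Fg ux; exists k => //; split=> //=.
  apply: contrapT => nA; apply: ne; rewrite val_bmul.
  have kW : val W (s k).
    by have [_ _] := with_supportP aper mA AG; apply; split=> //; exact: units_src.
  exists k, (inv k); split=> //.
  - by rewrite val_bmul; exists k, (s k); split=> //; rewrite ?rng_src ?mul_src_unit.
  - by exists k.
  - by rewrite rng_inv.
have me : ae (fun k y => moved e k (lift g k y) == inside A k y).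
  have i1 := ae_perm (lift g) (lift_mul FgW Fi).
  have i2 := ae_perm (lift g) (lift_inv Fg).
  apply: (ae_imp3 i1 i2 (lift_mul Fg FW)) => k y /eqP i1' /eqP i2' /eqP i3'.
  rewrite /moved i1' i2' permK i3' /inside /moved.
  by apply/eqP; congr (~~ _); rewrite (inj_eq perm_inj).
have mC : ae (fun k y => moved e k y ==> inside C k y).
  apply: (ae_imp2 (moved_inside Fe) (inside_sub (unitset_supp e) uC eC)) => k y.
  by move=> /eqP ->.
have deq : dens (moved e) = dens (inside C).
  rewrite dens_inside // -(@dens_perm R U (moved e) (lift g)) (dens_ae_eq me) dens_inside //.
  rewrite -pm_bis; last exact: bis_restr_src.
  congr pm; apply/seteqP; split=> [x Ax|_ [k [_ Ak] <-]//].
  by have [k gk kx] := src_in Fg (AG _ Ax); exists k => //; split=> //=; rewrite kx.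
apply: (ae_imp2 (ae_perm (lift g) (ae_sub_eq mC deq)) me) => k y /eqP <- //.
Qed.

Definition extend a : square_ultraprod U :=
  upperm (lift (extension a)) (inside (s @` val a)).

Let Fx a : full (val (extension a)). Proof. by case: (extensionP a). Qed.
Let x0 a : pm (s @` (val a `\` val (extension a))) = 0. Proof. by case: (extensionP a). Qed.
Let ud a : unitset (s @` val a). Proof. by apply: unitset_src; exact: bis_val. Qed.

Lemma insideT : ae (inside G0).
Proof.
apply: ae1; rewrite dens_inside ?pm_units //; split=> //; exact: measurable_units.
Qed.

Lemma null_full_diff f g : full (val f) -> full (val g) ->
  pm (s @` (val g `\` val f)) = 0 -> pm (s @` (val f `\` val g)) = 0.
Proof.
move=> Ff Fg; apply: null_sub; [by meas|by meas|].
move=> _ [k [fk ngk] <-]; have [h gh hk] := src_in Fg (units_src k).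
exists h => //; split=> // fh; apply: ngk.
by rewrite -(bis_inj_src (bis_val f) fh fk).
Qed.

Lemma extend_full f : full (val f) -> extend f = upperm (lift f) (fun=> xpredT).
Proof.
move=> Ff; have [_ sf _] := Ff; apply: upperm_eq; rewrite sf.
have uG : unitset G0 by split=> //; exact: measurable_units.
have H : pm (s @` (val (extension f) `\` val f) `&` G0) = 0.
  apply: (null_sub _ _ _ (null_full_diff (Fx f) Ff (x0 f))); [by meas|by meas|].
  by move=> x [].
apply: (ae_imp2 insideT (inside_agree (Fx f) Ff uG H)) => k y ->.
by rewrite eqxx.
Qed.

Lemma extend_one : extend (bone G) = mone.
Proof.
rewrite extend_full; last exact: full_bone.
rewrite [RHS]upperm1; apply: upperm_eq; apply: (ae_imp lift1) => k y /eqP ->.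
by rewrite perm1 !eqxx.
Qed.

(** Let [M] be the set where the extensions [f] and [g] differ. The two partial permutations differ
    on the set attached to the union of [A] and [B] minus the part of their intersection off [M].
    Away from the null set [N0], where [a] or [b] leaves its extension, this is the source of the
    symmetric difference. *)
Lemma extend_dist a b : mdist (extend a) (extend b) = mdist a b.
Proof.
rewrite upperm_dist; set A := s @` val a; set B := s @` val b.
have uA : unitset A := ud a; have uB : unitset B := ud b.
have [mA AG] := uA; have [mB BG] := uB.
pose f := extension a; pose g := extension b.
pose M := s @` (val f `\` val g).
have uM : unitset M by apply: unitset_src; apply: bisD; exact: bis_val.
have [mM _] := uM.
have ePM : ae (fun k y => (lift f k y != lift g k y) == inside M k y).
  apply: (ae_imp2 (lift_divK (Fx a) (Fx b)) (moved_inside (full_bmul (full_binv (Fx b)) (Fx a)))).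
  by move=> k y /eqP -> ; rewrite supp_bdiv; [|exact: Fx|exact: Fx].
have uAB := unitsetI uA uB; have uN := unitsetD uAB uM; have uV := unitsetU uA uB.
have eN : ae (fun k y => inside ((A `&` B) `\` M) k y ==
    [&& inside A k y, inside B k y & ~~ inside M k y]).
  have <- : (A `&` B) `&` (G0 `\` M) = (A `&` B) `\` M.
    by apply/seteqP; split=> [x [AB []]|x [AB nM]] //; split=> //; split=> //; apply: AG; case: AB.
  apply: (ae_imp3 (insideI uAB (unitsetC uM)) (insideI uA uB) (inside_compl uM)) => k y.
  by move=> /eqP -> /eqP -> /eqP ->; rewrite negbK andbA.
have eV : ae (fun k y => inside (A `|` B) k y == (inside A k y || inside B k y)).
  have e : G0 `\` (A `|` B) = (G0 `\` A) `&` (G0 `\` B).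
    apply/seteqP; split=> [x [ux nx]|x [[ux nA] [_ nB]]].
      by split; split=> // ?; apply: nx; [left|right].
    by split=> // -[].
  apply: (ae_imp2 (ae_and (inside_compl uV) (insideI (unitsetC uA) (unitsetC uB)))
    (ae_and (inside_compl uA) (inside_compl uB))) => k y.
  by move=> /andP[/eqP -> /eqP]; rewrite e => -> /andP[/eqP -> /eqP ->]; rewrite negb_and.
have eE : ae (fun k y => inside ((A `|` B) `\` ((A `&` B) `\` M)) k y ==
    ((inside A k y || inside B k y) && ~~ [&& inside A k y, inside B k y & ~~ inside M k y])).
  have <- : (A `|` B) `&` (G0 `\` ((A `&` B) `\` M)) = (A `|` B) `\` ((A `&` B) `\` M).
    apply/seteqP; split=> [x [AB []]|x [AB nN]] //; split=> //; split=> //.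
    by case: AB => [/AG|/BG].
  apply: (ae_imp2 (ae_and eV eN) (ae_and (insideI uV (unitsetC uN)) (inside_compl uN))) => k y.
  by move=> /andP[/eqP <- /eqP <-] /andP[/eqP -> /eqP ->]; rewrite negbK.
have uE := unitsetD uV uN.
rewrite (@dens_ae_eq _ _ _ _ (inside ((A `|` B) `\` ((A `&` B) `\` M)))); last first.
  apply: (ae_imp2 ePM eE) => k y /eqP -> /eqP ->.
  by case: (inside A k y); case: (inside B k y); case: (inside M k y).
rewrite dens_inside // /= /bdist -/(pm _).
pose N0 := s @` (val a `\` val f) `|` s @` (val b `\` val g).
have mN0 : measurable N0 by rewrite /N0; meas.
have N00 : pm N0 = 0 by apply: nullU; [meas|meas|exact: x0|exact: x0].
have mE : measurable (s @` (val a `+` val b)).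
  by apply: src_symdiff_meas; exact: bis_val.
have [mV _] := uE.
have in_f k : val a k -> ~ N0 (s k) -> val f k.
  by move=> ak nN; apply: contrapT => nf; apply: nN; left; exists k.
have in_g k : val b k -> ~ N0 (s k) -> val g k.
  by move=> bk nN; apply: contrapT => nf; apply: nN; right; exists k.
apply: pm_null_eq => //.
  apply: null_sub N00 => //; first exact: measurableD.
  move=> x [[ABx nN] nE]; apply: contrapT => nN0; apply: nN.
  have abx k : val a k -> s k = x -> val b k.
    by move=> ak kx; apply: contrapT => nb; apply: nE; exists k => //; left.
  have bax k : val b k -> s k = x -> val a k.
    by move=> bk kx; apply: contrapT => na; apply: nE; exists k => //; right.
  have [k [ak bk kx]] : exists k, [/\ val a k, val b k & s k = x].
    by case: ABx => -[k kk kx]; exists k; split=> //; [exact: abx|exact: bax].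
  have fk : val f k by apply: in_f => //; rewrite kx.
  have gk : val g k by apply: in_g => //; rewrite kx.
  split; first by split; exists k.
  move=> [h [fh ngh] hx]; apply: ngh.
  by rewrite (bis_inj_src (bis_val f) fh fk) // hx kx.
apply: null_sub N00 => //; first exact: measurableD.
move=> x [Ex nV]; apply: contrapT => nN0; apply: nV; split.
  by case: Ex => k [[ak _]|[bk _]] <-; [left|right]; exists k.
move=> [[[k ak kx] [h bh hx]] nM].
have fk : val f k by apply: in_f => //; rewrite kx.
have gh : val g h by apply: in_g => //; rewrite hx.
have kh : k = h.
  apply: (bis_inj_src (bis_val g)) => //; last by rewrite kx hx.
  by apply: contrapT => ngk; apply: nM; exists k.
case: Ex => l [[al nbl]|[bl nal]] lx.
  by apply: nbl; rewrite (bis_inj_src (bis_val a) al ak) ?kh // lx -kx kh.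
by apply: nal; rewrite (bis_inj_src (bis_val b) bl bh) -?kh // lx -hx -kh.
Qed.

(** Up to null sets the source of the product is the intersection of [B] with the preimage [A'] of
    [A] under [g]. By [inside_image] this corresponds to the domain of the product of the partial
    permutations, on which the extension of the product agrees with the product of the
    extensions. *)
Lemma extend_mul a b : extend (bmul a b) = mmul (extend a) (extend b).
Proof.
rewrite upperm_mul; apply: upperm_eq.
pose f := extension a; pose g := extension b; pose c := bmul a b.
pose A := s @` val a; pose B := s @` val b; pose C := s @` val c.
have uA : unitset A := ud a; have uB : unitset B := ud b; have uC : unitset C := ud c.
have [mA AG] := uA; have [mB BG] := uB; have [mC CG] := uC.
have Ff : full (val f) := Fx a; have Fg : full (val g) := Fx b.
have bg := bis_val g; have bb := bis_val b; have ba := bis_val a.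
pose A' := s @` (val g `&` r @^-1` A).
have uA' : unitset A' by apply: unitset_src; exact: bis_restr_rng.
have [mA' _] := uA'.
have AE : r @` (val g `&` s @^-1` A') = A.
  apply/seteqP; split=> [_ [k [gk [h [gh Ah] hk]] <-]|x Ax].
    by rewrite -(bis_inj_src bg gh gk).
  have [k gk kx] := rng_in Fg (AG _ Ax); exists k => //; split=> //=.
  by exists k => //; split=> //=; rewrite kx.
have i1 := inside_image Fg uA'; rewrite AE in i1.
have CE x : C x <-> exists k, [/\ val b k, A (r k) & s k = x].
  rewrite /C /c /= val_bmul; split=> [[_ [h [k [ah bk hk ->]]] <-]|[k [bk [h ah hk] <-]]].
    by exists k; rewrite src_mul //; split=> //; exists h.
  by exists (mul h k); [exists h, k|rewrite src_mul].
pose N := s @` (val b `\` val g).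
have mN : measurable N by rewrite /N; meas.
have in_g k : val b k -> ~ N (s k) -> val g k.
  by move=> bk nN; apply: contrapT => nf; apply: nN; exists k.
have i2 : ae (fun k y => inside C k y == inside (B `&` A') k y).
  apply: inside_ae_eq => //; first exact: unitsetI.
    apply: null_sub (x0 b); [by meas|by meas|].
    move=> x [/CE[k [bk Ak kx]] nBA]; apply: contrapT => nN; apply: nBA; split.
      by exists k.
    by exists k => //; split=> //; apply: in_g => //; rewrite kx.
  apply: null_sub (x0 b); [by meas|by meas|].
  move=> x [[[k bk kx] [h [gh Ah] hx]] nC]; apply: contrapT => nN; apply: nC; apply/CE.
  exists k; split=> //; suff -> : k = h by [].
  apply: (bis_inj_src bg) => //; last by rewrite kx hx.
  by apply: in_g => //; rewrite kx.
have Ffg := full_bmul Ff Fg.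
have i3 : ae (fun k y => inside C k y ==> (lift (extension c) k y == lift (bmul f g) k y)).
  apply: inside_agree => //.
  pose N1 := s @` (val c `\` val (extension c)).
  (* The points that [b] sends to where [a] leaves its extension [f]; they form a null set by
     invariance. *)
  pose N2 := s @` (val b `&` r @^-1` (s @` (val a `\` val f))).
  have mN1 : measurable N1 by rewrite /N1; meas.
  have mN2 : measurable N2 by rewrite /N2; meas.
  apply: (@null_sub _ _ _ (N1 `|` (N `|` N2))).
  - by meas.
  - by meas.
  - move=> x [[l [xl nl] lx] [l' cl l'x]]; apply: contrapT => nN.
    have ll : l' = l.
      apply: (bis_inj_src (bis_val (extension c))) => //; last by rewrite l'x lx.
      by apply: contrapT => nx; apply: nN; left; exists l'.
    apply: nl; rewrite -ll val_bmul; move: cl; rewrite /c /= val_bmul.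
    move=> [h [k [ah bk hk e]]]; exists h, k; split=> //.
      apply: contrapT => nfh; apply: nN; right; right; exists k.
        by split=> //=; exists h.
      by rewrite -l'x e src_mul.
    apply: in_g => // Nk; apply: nN; right; left.
    by rewrite -l'x e src_mul.
  - apply: nullU; [by meas|by meas|exact: x0|].
    apply: nullU; [by meas|by meas|exact: x0|].
    apply: null_src_image => //; meas.
apply: (ae_imp3 (ae_and i1 i2) (insideI uB uA') (ae_and i3 (lift_mul Ff Fg))) => k y.
move=> /andP[/eqP e1 /eqP e2] /eqP e3 /andP[e4 /eqP e5].
by rewrite permM -[lift f k _]e5 e4 andbT [inside A k _]e1 -/B -/C e2 e3.
Qed.

(** The domain of the inverse is [r(a)], up to a null set the image of [A] under [f];
    [inside_image], read through the inverse permutation, identifies the set attached to it. *)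
Lemma extend_inv a : extend (binv a) = minv (extend a).
Proof.
rewrite upperm_inv; apply: upperm_eq.
pose f := extension a; pose A := s @` val a; pose C := s @` val (binv a).
have uA : unitset A := ud a; have uC : unitset C := ud (binv a).
have [mA AG] := uA; have [mC _] := uC; have Ff : full (val f) := Fx a.
have bf := bis_val f; have ba := bis_val a.
have CE : C = r @` val a.
  apply/seteqP; split=> [_ [_ [k ak <-] <-]|_ [k ak <-]].
    by exists k; rewrite ?src_inv.
  by exists (inv k); [exists k|rewrite src_inv].
pose C' := r @` (val f `&` s @^-1` A).
have uC' : unitset C' by apply: unitset_rng; exact: bis_restr_src.
have N0 : pm (r @` (val a `\` val f)) = 0.
  by rewrite -pm_bis ?x0 //; meas.
have i1 : ae (fun k y => inside C k y == inside C' k y).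
  apply: inside_ae_eq => //; rewrite CE.
    apply: null_sub N0; [by rewrite /C'; meas|by meas|].
    move=> _ [[k ak <-] nC]; exists k => //; split=> // fk; apply: nC.
    by exists k => //; split=> //; exists k.
  have N1 := @null_rng_image _ _ _ _ bf _ (x0 a).
  apply: null_sub (N1 _); [by rewrite /C'; meas|by meas| |by meas].
  move=> x [[k [fk [h ah hk]] kx] nax]; exists k => //; split=> //.
  exists h => //; split=> // fh; apply: nax; exists h => //.
  by rewrite (bis_inj_src bf fh fk).
have i2 := ae_perm (fun k => (lift f k)^-1)%g (inside_image Ff uA).
have Fi := full_binv Ff.
have i3 : ae (fun k y => inside C k y ==> (lift (extension (binv a)) k y == lift (binv f) k y)).
  apply: inside_agree => //.
  pose N1 := s @` (val (binv a) `\` val (extension (binv a))).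
  pose N2 := r @` (val a `\` val f).
  apply: (@null_sub _ _ _ (N1 `|` N2)); [by meas|by rewrite /N1 /N2; meas| |].
    move=> x [[l [xl nl] lx] [l' al l'x]]; apply: contrapT => nN.
    have ll : l' = l.
      apply: (bis_inj_src (bis_val (extension (binv a)))) => //; last by rewrite l'x lx.
      by apply: contrapT => nx; apply: nN; left; exists l'.
    apply: nl; rewrite -ll; apply/binvP; move/binvP: al => al.
    apply: contrapT => nf; apply: nN; right; exists (inv l') => //.
    by rewrite rng_inv.
  apply: nullU => //; [by rewrite /N1; meas|by rewrite /N2; meas|exact: x0].
apply: (ae_imp3 i1 i2 (ae_and i3 (lift_inv Ff))) => k y.
move=> /eqP e1 /eqP e2 /andP[e3 /eqP e4]; rewrite permKV in e2.
by rewrite e4 in e3; rewrite e3 andbT -/C e1 e2.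
Qed.

Definition extension_map (c : full_semigroup G) : square_ultraprod U := extend (mrepr c).

Lemma extension_map_emb : isometric_embedding extension_map.
Proof.
have sqL := @square_prod_lawful R U UU.
apply: (mquot_lift (borel_full_semigroup_lawful G) sqL).
split; [exact: extend_one|exact: extend_mul|exact: extend_inv|exact: extend_dist].
Qed.

Lemma extension_map_mpi a : extension_map (mpi a) = extend a.
Proof.
apply: (mquot_eq (@square_prod_lawful R U UU)); rewrite [LHS]extend_dist.
exact: (mrepr_mpi (borel_full_semigroup_lawful G)).
Qed.

Lemma extension_map_incl x :
  extension_map (full_group_incl x) = sym_ultraprod_incl (theta x).
Proof.
have [f Ff ->] := full_group_surj x.
by rewrite full_group_eltE // extension_map_mpi extend_full // sym_ultraprod_inclE.
Qed.

Let iset A (uA : unitset A) : bis A := bis_units uA.1 uA.2.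

Definition idem A (uA : unitset A) : BS := exist _ A (mem_set (iset uA)).

(** An element is its extension times the idempotent of its source, so it remains to treat
    idempotents. The image of the idempotent of [A] is idempotent, hence the identity on a domain
    [q], and the distance to the unit shows that [q] has density [pm A]. The full bisection [W]
    supported off [A] absorbs into this idempotent, so its lift fixes [q]. Thus [q] is contained in
    [inside A], and equal to it by density. *)
Lemma extension_unique (Theta : full_semigroup G -> square_ultraprod U) :
  isometric_embedding Theta ->
  (forall x, Theta (full_group_incl x) = sym_ultraprod_incl (theta x)) ->
  Theta = extension_map.
Proof.
move=> ThE ThI; have lB := borel_full_semigroup_lawful G.
have ThF f : full (val f) -> Theta (mpi f) = upperm (lift f) (fun=> xpredT).
  by move=> Ff; rewrite -full_group_eltE // ThI sym_ultraprod_inclE.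
have bmulE f A (uA : unitset A) : bmul f (idem uA) = exist _ (val f `&` s @^-1` A)
    (mem_set (bis_restr_src (bis_val f) uA.1)).
  apply: val_inj; rewrite val_bmul /=; apply/seteqP; split=> x.
    move=> [k [u [fk Au ku ->]]]; have uu := uA.2 _ Au.
    rewrite (unit_rng uu) in ku.
    by rewrite mul_src_unit //; split=> //=; rewrite ku.
  by move=> [fx Ax]; exists x, (s x); split; rewrite ?rng_src ?mul_src_unit.
have ThId A (uA : unitset A) : Theta (mpi (idem uA)) = upperm (fun=> 1%g) (inside A).
  have [mA AG] := uA.
  have [t [q Tq]] := upperm_surj (Theta (mpi (idem uA))); rewrite Tq.
  have e1 : ae (fun k y => q k y ==> (t k y == y)).
    have H : mmul (Theta (mpi (idem uA))) (Theta (mpi (idem uA))) = Theta (mpi (idem uA)).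
      rewrite -(emb_mul ThE) mquot_mul //; congr Theta; congr mpi.
      rewrite /= bmulE; apply: val_inj; apply/seteqP; split=> x /=; first by case.
      by move=> Ax; split=> //; rewrite unit_src //; exact: AG.
    rewrite Tq upperm_mul in H.
    have e0 := upperm_inj (UU := UU) H.
    apply: (ae_imp e0) => k y; rewrite permM (inj_eq perm_inj).
    by case: (q k y); case: (q k (t k y)); case: (t k y == y).
  have q1 : dens q = pm A.
    have := emb_dist ThE (mpi (idem uA)) mone; rewrite (emb_one ThE) Tq upperm1 upperm_dist.
    rewrite (mquot_dist lB) => D.
    have : dens (fun k y => ~~ q k y) = 1 - pm A.
      have <- : pm (G0 `\` A) = 1 - pm A.
        by have := pmDI (measurable_units G) mA; rewrite pm_units (setIidr AG); lra.
      have <- : mdist (idem uA) mone = pm (G0 `\` A).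
        rewrite /= /bdist -/(pm _) /=; congr pm; apply/seteqP; split.
          move=> _ [x [[/AG Ax nx]|[ux nA]] <-] //.
          by rewrite unit_src.
        by move=> x [ux nA]; exists x; [right|exact: unit_src].
      rewrite -D; apply: dens_ae_eq; apply: (ae_imp e1) => k y.
      by case: (q k y) => //= /eqP ->; rewrite perm1 eqxx.
    by have := @densC R U UU q; lra.
  pose W := with_support (G0 `\` A); have uC := unitsetC uA.
  have FW : full (val W) := full_with_support uC.
  have e2 : ae (fun k y => q k y ==> inside A k y).
    have H : mmul (Theta (mpi W)) (Theta (mpi (idem uA))) = Theta (mpi (idem uA)).
      rewrite -(emb_mul ThE) mquot_mul //; congr Theta; congr mpi.
      rewrite /= bmulE; apply: val_inj; apply/seteqP; split=> x /=.
        move=> [Wx Ax]; have Wsx : val W (s x).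
          have [_ _] := with_supportP aper uC.1 uC.2; apply.
          by split=> [|[] //]; exact: units_src.
        by rewrite (bis_inj_src (bis_val W) Wx Wsx) // src_src.
      move=> Ax; have ux := AG _ Ax; rewrite unit_src //; split=> //.
      have [_ _] := with_supportP aper uC.1 uC.2; apply.
      by split=> // -[].
    rewrite Tq (ThF _ FW) in H.
    rewrite upperm_mul in H.
    have e3 : ae (fun k y => q k y ==> (lift W k (t k y) == t k y)).
      apply: (ae_imp (upperm_inj (UU := UU) H)) => k y; rewrite andbT permM => /andP[_ //].
    apply: (ae_imp3 e1 e3 (inside_compl uA)) => k y.
    move=> /implyP i1 /implyP i3 /eqP ->; apply/implyP => qy.
    by have := i3 qy; rewrite (eqP (i1 qy)) /inside /moved negbK.
  have e4 : ae (fun k y => q k y == inside A k y).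
    by apply: ae_sub_eq => //; rewrite q1 dens_inside.
  apply: upperm_eq; apply: (ae_imp2 e1 e4) => k y e1' /eqP <-.
  by rewrite eqxx perm1.
apply/funext => c; have [a ->] := mquot_surj c; rewrite extension_map_mpi.
have uA := ud a.
have -> : mpi a = mmul (mpi (extension a) : full_semigroup G) (mpi (idem uA)).
  rewrite mquot_mul //; apply/(mpi_eqP lB); rewrite /= bmulE /bdist -/(pm _) /=.
  apply: null_sub (x0 a); [|by meas|].
    by apply: src_symdiff_meas; [exact: bis_val|exact: (bis_restr_src (bis_val _) uA.1)].
  move=> _ [k [[ak nk]|[[xk [h ah hk]] nak]] <-].
    by exists k => //; split=> // xk; apply: nk; split=> //; exists k.
  exists h => //; split=> // xh; apply: nak.
  by rewrite -(bis_inj_src (bis_val (extension a)) xh xk).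
rewrite (emb_mul ThE) ThId ThF; last exact: Fx.
rewrite upperm_mul; apply: upperm_eq; apply: ae_all => k y.
by rewrite permM perm1 andbT !eqxx implybT.
Qed.

End Extension.

(** * Actions of finite groupoids on finite sets *)

Section FiniteGroupoid.
Context {R : realType} (H : pmpGroupoid R).
Hypothesis finH : finite_set [set: H].
Local Notation mul := (@pmp_mul R H).
Local Notation inv := (@pmp_inv R H).
Local Notation s := (src mul inv).
Local Notation r := (rng mul inv).
Local Notation G0 := (units mul inv).
Local Notation bis := (bisections mul inv).
Local Notation BS := (borel_full_semigroup H).
Implicit Types (a b : BS) (g h x : H) (A D : set H).

Let Ggrp : is_groupoid mul inv := dmg_groupoid (pmp_dmg H).

Lemma finite_measurable A : measurable A.
Proof.
have [B [mB sepB _ _]] := standard_borel_base (dmg_standard (pmp_dmg H)).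
have m1 x : measurable [set x].
  rewrite (_ : [set x] = \bigcap_k (if `[<B k x>] then B k else ~` B k)).
    by apply: bigcapT_measurable => k; case: ifP => _ //; exact: measurableC.
  apply/seteqP; split=> [_ -> k _|y By]; first by case: ifPn => /asboolP.
  apply: sepB => k; have := By k I.
  by case: ifPn => /asboolP Bx; split.
rewrite -[A]image_id -bigcup_imset1; apply: fin_bigcup_measurable => [|x _].
  by apply: sub_finite_set finH.
exact: m1.
Qed.

Definition arrows : seq H := undup (sval (cid ((finite_seqP _).1 finH))).

Lemma mem_arrows g : g \in arrows.
Proof.
rewrite /arrows mem_undup; case: cid => l /= /seteqP[h _].
exact: (h g).
Qed.

Lemma uniq_arrows : uniq arrows. Proof. exact: undup_uniq. Qed.

Definition fibre_size x : nat := count (fun g => r g == x) arrows.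

Lemma fibre_size_gt0 x : G0 x -> (0 < fibre_size x)%N.
Proof.
move=> ux; rewrite -has_count; apply/hasP; exists x; first exact: mem_arrows.
by rewrite unit_rng.
Qed.

Lemma fibre_size_le g : (fibre_size (s g) <= fibre_size (r g))%N.
Proof.
rewrite /fibre_size -!size_filter -(size_map (mul g)); apply: uniq_leq_size.
  rewrite map_inj_in_uniq ?filter_uniq ?uniq_arrows // => x y.
  rewrite !mem_filter => /andP[/eqP rx _] /andP[/eqP ry _] e.
  by rewrite -(mulVK (esym rx)) e mulVK.
move=> _ /mapP[x + ->]; rewrite !mem_filter mem_arrows => /andP[/eqP rx _].
by rewrite rng_mul ?eqxx ?mem_arrows.
Qed.

Lemma fibre_size_eq g : fibre_size (s g) = fibre_size (r g).
Proof.
apply/eqP; rewrite eqn_leq fibre_size_le.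
by have := fibre_size_le (inv g); rewrite src_inv rng_inv.
Qed.

(** Measures how far [a] is from being defined everywhere: the models of full bisections are only
    approximately full. *)
Definition defect a : R := pm (G0 `\` s @` val a).

Lemma pm_point_eq g : pm [set s g] = pm [set r g] :> R.
Proof.
have bg : bis [set g].
  by split=> [|x y /set_mem -> /set_mem ->|x y /set_mem -> /set_mem ->] //;
    exact: finite_measurable.
by have := pm_bis bg; rewrite !image_set1.
Qed.

Lemma pm_seq (l : seq H) (p : pred H) : uniq l ->
  pm [set x | x \in l /\ p x] = \sum_(x <- l | p x) pm [set x] :> R.
Proof.
elim: l => [_|x l IH /= /andP[xl ul]].
  rewrite big_nil -[RHS](pm0 H); congr pm; apply/seteqP; split=> y //=.
  by case; rewrite in_nil.
rewrite big_cons -IH //; case: ifPn => px; last first.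
  congr pm; apply/seteqP; split=> y /= [+ py]; rewrite inE.
    by case/predU1P => [yx|//]; rewrite yx (negbTE px) in py.
  by move=> ->; rewrite orbT.
rewrite -pmU; [|exact: finite_measurable|exact: finite_measurable|].
  congr pm; apply/seteqP; split=> y /=.
    by rewrite inE => -[/predU1P[->|yl] py]; [left|right].
  by move=> [->|[yl py]]; rewrite inE ?eqxx // yl orbT.
by move=> _ -> [yl _]; rewrite yl in xl.
Qed.

(** The mass of a unit is shared equally among the arrows with that range, so the arrows have total
    mass 1. Left multiplication preserves it, since the two ends of an arrow have the same mass and
    the same number of arrows ending there. *)
Definition density g : R := pm [set r g] / (fibre_size (r g))%:R.

Lemma sum_density (p : pred H) : (forall x, p x -> G0 x) ->
  \sum_(g <- arrows | p (r g)) density g = pm [set x | p x].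
Proof.
move=> pG; have -> : [set x | p x] = [set x | x \in arrows /\ p x].
  by apply/seteqP; split=> x /= => [px|[]//]; rewrite mem_arrows.
rewrite pm_seq ?uniq_arrows //.
pose F x : R := pm [set x] / (fibre_size x)%:R.
transitivity (\sum_(g <- arrows) \sum_(x <- arrows | p x && (r g == x)) F x).
  rewrite big_mkcond; apply: eq_bigr => g _; case: ifPn => pg; last first.
    by rewrite big1 // => x /andP[px /eqP e]; rewrite e px in pg.
  rewrite (eq_bigl (fun x => x == r g)); last first.
    by move=> x /=; rewrite [r g == x]eq_sym; case: eqP => [->|]; rewrite ?pg ?andbF.
  by rewrite -big_filter filter_pred1_uniq ?mem_arrows ?uniq_arrows // big_seq1.
rewrite (exchange_big_dep p) => [|g x _ /andP[]//]; apply: eq_bigr => x px /=.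
rewrite (eq_bigl (fun g => r g == x)) => [|g]; last by rewrite px.
rewrite big_const_seq iter_addr_0 -/(fibre_size x) -mulr_natr divfK // pnatr_eq0 -lt0n.
by apply: fibre_size_gt0; exact: pG.
Qed.

Section Action.
Variable m : nat.

(** The number of copies of [g] in a set with [m.+1] points. Rounding down makes the copies fit, and
    invariance of the density makes the number of copies invariant under left multiplication. *)
Definition weight g : nat := Num.truncn (m.+1%:R * density g).

Lemma weight_mul g h : s g = r h -> weight (mul g h) = weight h.
Proof.
by move=> e; rewrite /weight /density rng_mul // -pm_point_eq -fibre_size_eq e.
Qed.

Lemma density_ge0 g : 0 <= density g.
Proof. by rewrite divr_ge0 // pm_ge0. Qed.

Lemma weight_le g : (weight g)%:R <= m.+1%:R * density g.
Proof. by rewrite truncn_le // mulr_ge0 // density_ge0. Qed.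

Lemma weight_gt g : m.+1%:R * density g - 1 <= (weight g)%:R.
Proof. by rewrite lerBlDr natr1 ltW // truncnS_gt. Qed.

(** The copies of the arrows. The entry of index [i] labels the point [i] of ['I_m.+1]; the points
    from [size tower] on carry no arrow. *)
Definition tower : seq (H * nat) :=
  [seq (g, i) | g <- arrows, i <- iota 0 (weight g)].

Lemma mem_tower g i : ((g, i) \in tower) = (i < weight g)%N.
Proof.
apply/allpairsPdep/idP => [[g' [i' [_ + [-> ->]]]]|ig].
  by rewrite mem_iota add0n.
by exists g, i; rewrite mem_arrows mem_iota.
Qed.

Lemma uniq_tower : uniq tower.
Proof.
apply: allpairs_uniq_dep => [|g _|[? ?] [? ?] _ _ [-> ->]//].
  exact: uniq_arrows.
exact: iota_uniq.
Qed.

Lemma count_tower (p : pred H) :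
  count (fun z => p (r z.1)) tower = \sum_(g <- arrows | p (r g)) weight g.
Proof.
rewrite /tower; elim: arrows => [|g l IH]; first by rewrite big_nil.
rewrite /= count_cat big_cons IH; case: ifPn => pg.
  by rewrite count_map (eq_count (a2 := predT)) ?count_predT ?size_iota // => i; rewrite /= pg.
by rewrite count_map (eq_count (a2 := pred0)) ?count_pred0 // => i; rewrite /= (negbTE pg).
Qed.


Lemma size_tower : (size tower <= m.+1)%N.
Proof.
have -> : size tower = \sum_(g <- arrows | true) weight g.
  rewrite -(count_predT tower) -(count_tower xpredT).
  by apply: eq_count.
rewrite -(ler_nat R) natr_sum.
rewrite (eq_bigl (fun g => `[<G0 (r g)>])) => [|g]; last first.
  by apply/esym/asboolP; exact: units_rng.
apply: (@le_trans _ _ (\sum_(g <- arrows | `[<G0 (r g)>]) m.+1%:R * density g)).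
  by apply: ler_sum => g _; exact: weight_le.
rewrite -mulr_sumr (@sum_density (fun x => `[<G0 x>])) => [|x /asboolP//].
by rewrite ler_piMr // pm_le1 //; exact: finite_measurable.
Qed.

Definition base_point (y : 'I_m.+1) : H := r (nth (point, 0%N) tower y).1.

(** Rounding the weights down loses at most one copy per arrow; this is the error term. *)
Lemma freq_base D : D `<=` G0 ->
  let f := freq (fun y : 'I_m.+1 => (y < size tower)%N && `[<D (base_point y)>]) in
  f <= pm D /\ pm D - (size arrows)%:R / m.+1%:R <= f.
Proof.
move=> DG f; have m0 : (0 : R) < m.+1%:R by rewrite ltr0n.
have fE : f = (\sum_(g <- arrows | `[<D (r g)>]) weight g)%:R / m.+1%:R.
  congr (_%:R / _); rewrite -(@count_tower (fun x => `[<D x>])).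
  rewrite -[in RHS](mkseq_nth (point, 0%N) tower) /mkseq count_map.
  have -> : iota 0 (size tower) = [seq val y | y <- enum 'I_m.+1 & (val y < size tower)%N].
    transitivity [seq i <- map val (enum 'I_m.+1) | (i < size tower)%N]; last by rewrite filter_map.
    rewrite val_enum_ord; have := size_tower; set n := size tower => nm.
    rewrite -(subnKC nm) iotaD filter_cat add0n -[LHS]cats0; congr (_ ++ _); apply/esym.
      by apply/all_filterP/allP => i; rewrite mem_iota.
    apply/eqP; rewrite -size_eq0 size_filter -leqn0 leqNgt -has_count -all_predC.
    by apply/allP => i; rewrite mem_iota /= -leqNgt => /andP[].
  rewrite count_map count_filter cardE /enum_mem !size_filter.
  by rewrite [RHS]count_filter; apply: eq_count => y; rewrite /= !inE andbT andbC.
have sumD : \sum_(g <- arrows | `[<D (r g)>]) density g = pm D.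
  by rewrite (@sum_density (fun x => `[<D x>])) => [|x /asboolP/DG//];
    congr pm; apply/seteqP; split=> x /=; [move/asboolP|move=> ?; exact/asboolP].
rewrite fE natr_sum; split.
  rewrite ler_pdivrMr // -sumD mulrC mulr_sumr; apply: ler_sum => g _.
  exact: weight_le.
rewrite ler_pdivlMr // mulrBl divfK ?gt_eqF // -sumD mulrC mulr_sumr.
apply: (@le_trans _ _ (\sum_(g <- arrows | `[<D (r g)>]) (m.+1%:R * density g - 1))).
  rewrite sumrB lerD2l lerN2 big_const_seq iter_addr_0 ler_nat; exact: count_size.
by apply: ler_sum => g _; exact: weight_gt.
Qed.

(** Copy [i] of [g] goes to copy [i] of [kg], where [k] is the arrow of [a] whose source is the
    range of [g]; this copy exists because the two weights are equal. Outside [in_domain a] the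
    value is junk. *)
Definition act_point a (y : 'I_m.+1) : 'I_m.+1 :=
  let z := nth (point, 0%N) tower y in
  inord (index (mul (xget point [set k | val a k /\ s k = r z.1]) z.1, z.2) tower).

Definition in_domain a (y : 'I_m.+1) : bool :=
  (y < size tower)%N && `[<(s @` val a) (base_point y)>].

Lemma nth_tower (y : 'I_m.+1) : (y < size tower)%N -> nth (point, 0%N) tower y \in tower.
Proof. by move=> yt; rewrite mem_nth. Qed.

Lemma act_pointE a (y : 'I_m.+1) k : val a k -> (y < size tower)%N -> s k = base_point y ->
  let z := nth (point, 0%N) tower y in
  (act_point a y < size tower)%N /\
  nth (point, 0%N) tower (act_point a y) = (mul k z.1, z.2).
Proof.
move=> ak yt ky z.
have xE : xget point [set k | val a k /\ s k = r z.1] = k.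
  by case: xgetP => [_ -> /= [ax ex]|/(_ k)[]];
    [apply: (bis_inj_src (bis_val a)); rewrite ?ex ?ky|split].
have zt : z \in tower by exact: nth_tower.
have mt : (mul k z.1, z.2) \in tower.
  rewrite mem_tower weight_mul // -mem_tower; by case: (z) zt.
have it : (index (mul k z.1, z.2) tower < m.+1)%N.
  by apply: leq_trans size_tower; rewrite index_mem.
rewrite /act_point -/z xE inordK //; split; first by rewrite index_mem.
by rewrite nth_index.
Qed.

Lemma tower_inj (y y' : 'I_m.+1) : (y < size tower)%N -> (y' < size tower)%N ->
  nth (point, 0%N) tower y = nth (point, 0%N) tower y' -> y = y'.
Proof. by move=> yt yt' /eqP; rewrite nth_uniq ?uniq_tower // => /eqP /val_inj. Qed.

Lemma act_exists a : exists t : {perm 'I_m.+1},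
  forall y, in_domain a y -> t y = act_point a y.
Proof.
apply: perm_extend => y y' /andP[yt /asboolP[k ak ky]] /andP[yt' /asboolP[k' ak' ky']] e.
have [_ e1] := act_pointE ak yt ky; have [_ e2] := act_pointE ak' yt' ky'.
have := e1; rewrite e e2 => -[m12 i12].
have kk : k' = k.
  apply: (bis_inj_rng (bis_val a)) => //.
  by have := congr1 r m12; rewrite !rng_mul.
apply: tower_inj => //; rewrite [LHS]surjective_pairing [RHS]surjective_pairing i12.
by congr (_, _); rewrite -(mulVK ky) -m12 kk mulVK // -kk.
Qed.

Definition act a : {perm 'I_m.+1} := sval (cid (act_exists a)).

Lemma actE a y : in_domain a y -> act a y = act_point a y.
Proof. by rewrite /act; case: cid => t /= tE; exact: tE. Qed.

(** Left multiplication is free: the product with the arrow labelling the point determines the arrow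
    that acts. This makes the action almost isometric. *)
Lemma act_eq a b (y : 'I_m.+1) k k' : val a k -> val b k' -> (y < size tower)%N ->
  s k = base_point y -> s k' = base_point y -> (act a y == act b y) = (k == k').
Proof.
move=> ak bk' yt ky ky'.
have da : in_domain a y by rewrite /in_domain yt; apply/asboolP; exists k.
have db : in_domain b y by rewrite /in_domain yt; apply/asboolP; exists k'.
have [ta ea] := act_pointE ak yt ky; have [tb eb] := act_pointE bk' yt ky'.
rewrite (actE da) (actE db); apply/eqP/eqP => [e|kk].
  have := ea; rewrite e eb => -[e'].
  set g := (nth _ _ _).1 in e'.
  have := congr1 (fun x => mul x (inv g)) e'.
  have gK h : s h = r g -> mul (mul h g) (inv g) = h.
    by move=> hg; rewrite (gmulA Ggrp) ?rng_inv // -/(rng mul inv g) mul_src_unit.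
  by rewrite !gK.
by apply: tower_inj => //; rewrite ea eb kk.
Qed.

Lemma act_mul a b y : in_domain (bmul a b) y -> act (bmul a b) y = act a (act b y).
Proof.
move=> dy; have /andP[yt /asboolP[l]] := dy; rewrite val_bmul.
move=> [h [k [ah bk hk ->]]]; rewrite src_mul // => ky.
have db : in_domain b y by rewrite /in_domain yt; apply/asboolP; exists k.
have abl : val (bmul a b) (mul h k) by rewrite val_bmul; exists h, k.
have [tb eb] := act_pointE bk yt ky.
have hb : s h = base_point (act_point b y) by rewrite /base_point eb rng_mul.
have da : in_domain a (act_point b y) by rewrite /in_domain tb; apply/asboolP; exists h.
have [ta ea] := act_pointE ah tb hb.
have [tc ec] := act_pointE abl yt (etrans (src_mul hk) ky).
rewrite (actE dy) (actE db) (actE da); apply: tower_inj => //.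
by rewrite ea ec eb /= (gmulA Ggrp).
Qed.

End Action.


Lemma freqU_le m (p q : pred 'I_m.+1) :
  freq (fun y => p y || q y) <= freq p + freq q :> R.
Proof. by rewrite -freqU lerDl; case/andP: (@freq01 R m (fun y => p y && q y)). Qed.

Lemma freqC m (p : pred 'I_m.+1) : freq p + freq (fun y => ~~ p y) = 1 :> R.
Proof.
rewrite -mulrDl -natrD -[X in _ / X](natr1 m) natr1.
rewrite -cardsUI (_ : _ :&: _ = finset.set0)%SET ?cards0 ?addn0; last first.
  by apply/setP => y; rewrite !inE andbN.
rewrite (eq_card (B := predT)) ?card_ord ?divff ?pnatr_eq0 // => y.
by rewrite !inE orbN.
Qed.

(** The action is uncontrolled only over the units missed by the sources, whose measure is the
    defect, and at the points that carry no arrow. The proportion of the latter and the rounding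
    error tend to 0 as [m] grows. *)
Lemma finite_action (eps : R) : 0 < eps -> exists M, forall m, (M <= m)%N ->
  exists phi : BS -> {perm 'I_m.+1},
  (forall a b, `|freq (fun y => phi a y != phi b y) - mdist a b| <=
     defect a + defect b + eps) /\
  (forall a b, freq (fun y => phi (bmul a b) y != phi a (phi b y)) <=
     defect (bmul a b) + eps).
Proof.
(* Beyond this threshold the rounding error, the number of arrows divided by [m.+1], is at most
   [eps]. *)
move=> eps0; exists (Num.truncn ((size arrows)%:R / eps)) => m Mm.
have m0 : (0 : R) < m.+1%:R by rewrite ltr0n.
have e_le : (size arrows)%:R / m.+1%:R <= eps.
  rewrite ler_pdivrMr // mulrC -ler_pdivrMr //.
  by apply/ltW/(lt_le_trans (truncnS_gt _)); rewrite ler_nat ltnS.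
exists (fun a => act m a).
pose p D (y : 'I_m.+1) := (y < size (tower m))%N && `[<D (base_point y)>].
pose W D : R := freq (p D).
have W_le D : D `<=` G0 -> W D <= pm D by move=> DG; case: (freq_base m DG).
have W_ge D : D `<=` G0 -> pm D - eps <= W D.
  by move=> DG; case: (freq_base m DG) => _; apply: le_trans; rewrite lerD2l lerN2.
have junk : freq (fun y : 'I_m.+1 => ~~ (y < size (tower m))%N) <= eps.
  have := freqC (fun y : 'I_m.+1 => (y < size (tower m))%N).
  have := W_ge G0 (fun _ => id); rewrite pm_units.
  have : W G0 <= freq (fun y : 'I_m.+1 => (y < size (tower m))%N).
    by apply: freq_le => y /andP[].
  lra.
have defG a : G0 `\` s @` val a `<=` G0 by move=> x [].
have pin a (y : 'I_m.+1) : (y < size (tower m))%N -> ~~ p (G0 `\` s @` val a) y ->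
    exists2 k, val a k & s k = base_point y.
  move=> yt; rewrite /p yt => /asboolP np; apply: contrapT => nk; apply: np.
  by split=> [|[k ak ky]]; [exact: units_rng|apply: nk; exists k].
split=> a b; last first.
  apply: (@le_trans _ _ (freq (fun y : 'I_m.+1 => p (G0 `\` s @` val (bmul a b)) y ||
      ~~ (y < size (tower m))%N))).
    apply: freq_le => y; apply: contraR; rewrite negb_or negbK => /andP[np yt].
    by rewrite act_mul ?eqxx // /in_domain yt; apply/asboolP; exact: (pin _ _ yt np).
  by apply: (le_trans (freqU_le _ _)); apply: lerD => //; exact: W_le.
pose S := s @` (val a `+` val b).
have SG : S `<=` G0 by move=> _ [k _ <-]; exact: units_src.
have dE : mdist a b = pm S by [].
have SP (y : 'I_m.+1) k k' : val a k -> val b k' -> (y < size (tower m))%N ->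
    s k = base_point y -> s k' = base_point y -> S (base_point y) <-> k <> k'.
  move=> ak bk' yt ky ky'; split.
    move=> [l [[al nl]|[bl nl]] ly] kk.
      by apply: nl; rewrite (bis_inj_src (bis_val a) al ak) ?ky // kk.
    by apply: nl; rewrite (bis_inj_src (bis_val b) bl bk') ?ky' // -kk.
  move=> kk; exists k => //; left; split=> // bk; apply: kk.
  by apply: (bis_inj_src (bis_val b)) => //; rewrite ky.
rewrite dE ler_norml; apply/andP; split.
  have : W S <= freq (fun y => act m a y != act m b y) + (defect a + defect b).
    apply: (@le_trans _ _ (freq (fun y => (act m a y != act m b y) ||
        (p (G0 `\` s @` val a) y || p (G0 `\` s @` val b) y)))).
      apply: freq_le => y /andP[yt /asboolP Sy].
      case: (boolP (p (G0 `\` s @` val a) y)) => [|na]; first by rewrite orbT.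
      case: (boolP (p (G0 `\` s @` val b) y)) => [|nb]; first by rewrite !orbT.
      have [k ak ky] := pin _ _ yt na; have [k' bk' ky'] := pin _ _ yt nb.
      by rewrite (act_eq ak bk') //; apply/orP; left; apply/eqP; apply/(SP y).
    apply: (le_trans (freqU_le _ _)); rewrite lerD2l.
    by apply: (le_trans (freqU_le _ _)); apply: lerD; exact: W_le.
  have := W_ge S SG; lra.
have : freq (fun y => act m a y != act m b y) <= (pm S + eps) + (defect a + defect b).
  apply: (@le_trans _ _ (freq (fun y : 'I_m.+1 => (p S y || ~~ (y < size (tower m))%N) ||
      (p (G0 `\` s @` val a) y || p (G0 `\` s @` val b) y)))).
    apply: freq_le => y ne.
    case: (boolP (p (G0 `\` s @` val a) y)) => [|na]; first by rewrite orbT.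
    case: (boolP (p (G0 `\` s @` val b) y)) => [|nb]; first by rewrite !orbT.
    case: (boolP (y < size (tower m))%N) => [yt|]; last by rewrite orbT.
    have [k ak ky] := pin _ _ yt na; have [k' bk' ky'] := pin _ _ yt nb.
    rewrite (act_eq ak bk') // in ne.
    by rewrite /p yt !orbF; apply/asboolP/(SP y k k') => //; apply/eqP.
  apply: (le_trans (freqU_le _ _)); apply: lerD.
    by apply: (le_trans (freqU_le _ _)); apply: lerD => //; exact: W_le.
  by apply: (le_trans (freqU_le _ _)); apply: lerD; exact: W_le.
by lra.
Qed.

End FiniteGroupoid.

(** * Separability of the full group *)

Section Separability.
Context {R : realType} (G : pmpGroupoid R).
Local Notation mul := (@pmp_mul R G).
Local Notation inv := (@pmp_inv R G).
Local Notation s := (src mul inv).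
Local Notation BS := (borel_full_semigroup G).
Implicit Types (A : set G) (g h : BS).

Lemma pm_bigcup_lt (F : nat -> set G) (eps : R) : (forall n, measurable (F n)) ->
  0 < eps -> exists N, pm (\bigcup_n F n `\` \bigcup_(n in `I_N) F n) < eps.
Proof.
move=> mF eps0; pose E N := \bigcup_(n in `I_N) F n.
have mE N : measurable (E N) by apply: bigcup_measurable => n _.
have ndE : nondecreasing_seq E.
  apply/nondecreasing_seqP => n; apply/subsetPset => x [i /= ni Fx].
  by exists i => //=; rewrite ltnW.
have ET : \bigcup_n E n = \bigcup_n F n.
  apply/seteqP; split=> [x [n _ [i _ Fx]]|x [n _ Fx]]; first by exists i.
  by exists n.+1 => //; exists n => /=.
have mT : measurable (\bigcup_n F n) by apply: bigcup_measurable.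
have mET : measurable (\bigcup_n E n) by rewrite ET.
have cv := nondecreasing_cvg_mu (mu := pmp_mu G) mE mET ndE; rewrite ET in cv.
have cvR : (fun n => pm (E n)) @ \oo --> pm (\bigcup_n F n).
  apply: (@fine_cvg _ _ _ _ (fun n => pmp_mu G (E n))).
  by rewrite -pmE.
have /cvgrPdist_lt /(_ eps eps0) [N _ NP] := cvR.
exists N; have := NP N (leqnn N); rewrite /= -/(E N).
have EN : E N `<=` \bigcup_n F n by move=> x [n _ Fx]; exists n.
have := pmDI mT (mE N); rewrite (setIidr EN) => ->.
by rewrite addrK ger0_norm // pm_ge0.
Qed.

Variable B : nat -> set G.
Hypothesis mB : forall k, measurable (B k).
Hypothesis genB : forall A, measurable A -> <<s range B >> A.

(** Terms for the algebra generated by [B]. Trees over [nat] form a countable type, so there are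
    countably many coded sets; the other tree shapes denote the empty set. *)
Fixpoint eval (t : GenTree.tree nat) : set G :=
  match t with
  | GenTree.Leaf k => B k
  | GenTree.Node _ [:: t1] => ~` eval t1
  | GenTree.Node _ [:: t1; t2] => eval t1 `|` eval t2
  | _ => set0
  end.

Lemma eval_meas t : measurable (eval t).
Proof.
move: t; fix IH 1 => -[k|k [|t1 [|t2 [|t3 l]]]] //=.
- by apply: measurableC; exact: IH.
- by apply: measurableU; exact: IH.
Qed.

Definition approximable A := measurable A /\
  forall eps : R, 0 < eps -> exists t, pm (A `+` eval t) < eps.

Lemma symdiff_meas (A E : set G) : measurable A -> measurable E -> measurable (A `+` E).
Proof. by move=> mA mE; apply: measurableU; exact: measurableD. Qed.

Lemma pm_symdiff_tri (A C E : set G) : measurable A -> measurable C -> measurable E ->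
  pm (A `+` E) <= pm (A `+` C) + pm (C `+` E).
Proof.
move=> mA mC mE; apply: le_trans (pmU_le _ _); try exact: symdiff_meas.
apply: pm_le; [exact: symdiff_meas|apply: measurableU; exact: symdiff_meas|].
move=> x [[Ax nEx]|[Ex nAx]]; case: (pselect (C x)) => Cx.
- by right; left.
- by left; left.
- by left; right.
- by right; right.
Qed.

Lemma approximableU A E : approximable A -> approximable E -> approximable (A `|` E).
Proof.
move=> [mA aA] [mE aE]; split; first exact: measurableU.
move=> eps eps0; have e2 : 0 < eps / 2 by rewrite divr_gt0.
have [t tP] := aA _ e2; have [u uP] := aE _ e2.
exists (GenTree.Node 0 [:: t; u]) => /=.
have mt := eval_meas t; have mu := eval_meas u.
apply: (@le_lt_trans _ _ (pm (A `+` eval t) + pm (E `+` eval u))).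
  apply: le_trans (pmU_le _ _); try exact: symdiff_meas.
  apply: pm_le; [by apply: symdiff_meas; exact: measurableU|
    by apply: measurableU; exact: symdiff_meas|].
  move=> x [[[Ax|Ex] nx]|[[tx|ux] nx]].
  - by left; left; split=> // ?; apply: nx; left.
  - by right; left; split=> // ?; apply: nx; right.
  - by left; right; split=> // ?; apply: nx; left.
  - by right; right; split=> // ?; apply: nx; right.
by lra.
Qed.

(** The approximable sets form a sigma-algebra: a countable union is within [eps / 2] of a finite
    one, which is approximable by [approximableU]. *)
Lemma measurable_approximable A : measurable A -> approximable A.
Proof.
move=> /genB; move: A; apply: smallest_sub; last first.
  move=> _ [k _ <-]; split=> // eps eps0; exists (GenTree.Leaf k).
  by rewrite /= setYK pm0.
have a0 : approximable set0.
  by split=> // eps eps0; exists (GenTree.Node 0 [::]); rewrite /= setYK pm0.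
split=> //.
- move=> A [mA aA]; rewrite setTD; split; first exact: measurableC.
  move=> eps /aA[t tP]; exists (GenTree.Node 0 [:: t]) => /=.
  rewrite (_ : ~` A `+` ~` eval t = A `+` eval t) //.
  apply/seteqP; split=> x [[H1 H2]|[H1 H2]].
  + by right; split=> //; exact: contrapT.
  + by left; split=> //; exact: contrapT.
  + by right; split=> // /(_ H1).
  + by left; split=> // /(_ H1).
- move=> F FP; have mF n : measurable (F n) by case: (FP n).
  split; first by apply: bigcup_measurable.
  move=> eps eps0; have e2 : 0 < eps / 2 by rewrite divr_gt0.
  have [N NP] := pm_bigcup_lt mF e2; set V := \bigcup_(n in `I_N) F n in NP.
  have [mV aV] : approximable V.
    rewrite /V; elim: N {NP V} => [|N IH].
      by rewrite (_ : \bigcup_(n in _) _ = set0) // -subset0 => x [].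
    rewrite (_ : \bigcup_(n in _) _ = \bigcup_(n in `I_N) F n `|` F N).
      exact: approximableU.
    by rewrite IIS bigcup_setU bigcup_set1.
  have [t tP] := aV _ e2; exists t.
  have mFF : measurable (\bigcup_n F n) by apply: bigcup_measurable.
  apply: (le_lt_trans (pm_symdiff_tri mFF mV (eval_meas t))).
  rewrite (_ : \bigcup_n F n `+` V = \bigcup_n F n `\` V); first by lra.
  rewrite /setY (_ : V `\` _ = set0) ?setU0 // -subset0 => x [[n _ Fx] nx].
  by apply: nx; exists n.
Qed.

End Separability.

Section DenseSequence.
Context {R : realType} (G : pmpGroupoid R).
Local Notation mul := (@pmp_mul R G).
Local Notation inv := (@pmp_inv R G).
Local Notation s := (src mul inv).
Local Notation BS := (borel_full_semigroup G).
Implicit Types (g h : BS).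

(* A code (N, M, ts) describes the full bisections g whose sources of the pieces
   in the first N sets of a partition of G into bisections are 1/(M+1)-close to
   the sets coded by ts. *)
Lemma dense_full_sequence : exists D : nat -> BS, (forall n, full (val (D n))) /\
  forall g (eps : R), full (val g) -> 0 < eps -> exists n, mdist g (D n) < eps.
Proof.
have [c [bc cdisj cT]] := bis_cover G.
have [B [mB _ genB _]] := standard_borel_base (dmg_standard (pmp_dmg G)).
pose piece (g : BS) n := s @` (val g `&` c n).
have bI (g : BS) n : bisections mul inv (val g `&` c n).
  apply: (bisS (bis_val g)); first exact: subIsetl.
  by apply: measurableI; apply: bis_meas; [exact: bis_val|exact: bc].
have mp (g : BS) n : measurable (piece g n) by apply: image_src_meas.
pose codes (z : nat * nat * seq (GenTree.tree nat)) g :=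
  full (val g) /\ forall n, (n < z.1.1)%N ->
    pm (piece g n `+` eval B (nth (GenTree.Leaf 0%N) z.2 n)) < z.1.2.+1%:R^-1.
(* One full bisection is kept for each code that describes some; the unit stands in for the other
   codes. *)
have /choice[h hP] z : exists h, full (val h) /\ forall g, codes z g -> codes z h.
  case: (pselect (exists g, codes z g)) => [[g gz]|H].
    by exists g; split=> //; case: gz.
  by exists (bone G); split; [exact: full_bone|move=> g gz; case: H; exists g].
exists (fun n => if unpickle n is Some z then h z else bone G); split.
  by move=> n; case: unpickle => [z|]; [case: (hP z)|exact: full_bone].
move=> g eps Fg eps0.
have e2 : 0 < eps / 2 by rewrite divr_gt0.
have [N NP] := pm_bigcup_lt (mp g) e2.
(* Each of the first [N] pieces contributes at most [2/(M+1)], in total less than [eps / 2]; the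
   tail takes the other half. *)
pose M := Num.truncn (4 * N.+1%:R / eps).
have MP : N%:R * (2 * M.+1%:R^-1) < eps / 2.
  have Mgt : 4 * N.+1%:R / eps < M.+1%:R by exact: truncnS_gt.
  have M0 : (0 : R) < M.+1%:R by rewrite ltr0n.
  rewrite mulrA ltr_pdivrMr //; rewrite ltr_pdivrMr // in Mgt.
  have NN : (N%:R : R) < N.+1%:R by rewrite ltr_nat.
  rewrite mulrAC ltr_pdivlMr //; lra.
have /choice[t tP] n : exists t, pm (piece g n `+` eval B t) < M.+1%:R^-1.
  have [_ H] := measurable_approximable mB genB (mp g n).
  by apply: H; rewrite invr_gt0 ltr0n.
pose z : nat * nat * seq (GenTree.tree nat) := (N, M, mkseq t N).
have gz : codes z g by split=> // n nN; rewrite nth_mkseq.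
exists (pickle z); rewrite pickleK; have [Fh /(_ _ gz)[_ hz]] := hP z.
pose E n := piece g n `\` piece (h z) n.
have mE n : measurable (E n) by exact: measurableD.
have Elt n : (n < N)%N -> pm (E n) <= 2 * M.+1%:R^-1.
  move=> nN; have t1 := tP n.
  have t2 : pm (piece (h z) n `+` eval B (t n)) < M.+1%:R^-1.
    by have := hz n nN; rewrite [X in nth _ X]/= nth_mkseq.
  have me := eval_meas mB (t n).
  apply: (@le_trans _ _ (pm (piece g n `+` piece (h z) n))).
    by apply: pm_le => //; [exact: symdiff_meas|left].
  apply: (le_trans (pm_symdiff_tri (mp g n) me (mp (h z) n))).
  by rewrite (setYC (eval B (t n))) mulr_natl mulr2n ltW // ltrD.
pose T := \bigcup_n piece g n `\` \bigcup_(n in `I_N) piece g n.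
have mT : measurable T by apply: measurableD; apply: bigcup_measurable.
(* If an arrow of [g] in [c i] is not in [h z], its source is not that of an arrow of [h z] in
   [c i], because the source is injective on [c i]. The reverse difference has the same sources,
   both bisections being full. *)
have sub : s @` (val g `+` val (h z)) `<=` T `|` \bigcup_(n in `I_N) E n.
  have sub1 : s @` (val g `\` val (h z)) `<=` T `|` \bigcup_(n in `I_N) E n.
    move=> _ [k [gk nhk] <-]; have [n ckn] := cT k.
    case: (pselect ((\bigcup_(n in `I_N) piece g n) (s k))) => [[i iN [k' [gk' ck'] kk]]|nk].
      have {}kk : k' = k by apply: (bis_inj_src (bis_val g)).
      right; exists i => //; split; first by exists k; rewrite // -kk.
      move=> [l [hl cl] lk]; apply: nhk; rewrite -(bis_inj_src (bc i) cl _ lk) //.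
      by rewrite -kk.
    by left; split=> //; exists n => //; exists k.
  move=> x; rewrite image_symdiff => -[/sub1//|[k [hk ngk] <-]]; apply: sub1.
  have [l gl lk] := src_in Fg (units_src k); exists l => //; split=> // hl; apply: ngk.
  by rewrite -(bis_inj_src (bis_val (h z)) hl hk lk).
have EN : pm (\bigcup_(n in `I_N) E n) <= N%:R * (2 * M.+1%:R^-1).
  elim: (N) (Elt) => [|n IH] El.
    by rewrite mul0r (_ : \bigcup_(n in _) _ = set0) ?pm0 // -subset0 => x [].
  rewrite (_ : \bigcup_(i in _) _ = \bigcup_(i in `I_n) E i `|` E n); last first.
    by rewrite IIS bigcup_setU bigcup_set1.
  apply: (le_trans (pmU_le _ _)) => //; first by apply: bigcup_measurable.
  rewrite -natr1 mulrDl mul1r; apply: lerD; last exact: El.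
  by apply: IH => i ni; apply: El; exact: ltnW.
apply: (@le_lt_trans _ _ (pm T + pm (\bigcup_(n in `I_N) E n))).
  apply: le_trans (pmU_le _ _) => //; last by apply: bigcup_measurable.
  apply: pm_le => //; first by apply: src_symdiff_meas; exact: bis_val.
  by apply: measurableU => //; apply: bigcup_measurable.
by rewrite [ltRHS]splitr ltrD // (le_lt_trans EN).
Qed.

End DenseSequence.

(** * From sofic to metrically sofic *)

Section ApproximateHomomorphism.
Context {R : realType} (U : set_system nat) {UU : UltraFilter U}.
Context (G : pmpGroupoid R).
Local Notation mul := (@pmp_mul R G).
Local Notation inv := (@pmp_inv R G).
Local Notation BS := (borel_full_semigroup G).
Local Notation dens := (@dens R U).
Local Notation ae := (@ae R U).

Let Ggrp : is_groupoid mul inv := dmg_groupoid (pmp_dmg G).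

Lemma bmul_binv (f : BS) : full (val f) -> bmul (binv f) f = bone G.
Proof.
move=> Ff; apply: val_inj; rewrite val_bmul; apply/seteqP; split=> x.
  move=> [h [k [/binvP fh fk hk ->]]].
  have e : inv h = k by apply: (bis_inj_rng (bis_val f)) => //; rewrite rng_inv.
  by rewrite -e -{1}(ginvK Ggrp h) -/(src mul inv (inv h)); exact: units_src.
move=> ux; have [k fk <-] := src_in Ff ux; exists (inv k), k; split=> //.
  by apply/binvP; rewrite (ginvK Ggrp).
by rewrite src_inv.
Qed.

Lemma bmul_bone : bmul (bone G) (bone G) = bone G.
Proof.
apply: val_inj; rewrite val_bmul; apply/seteqP; split=> x.
  move=> [u [v [uu uv e ->]]]; rewrite mul_rng_unit // -e; exact: unit_src.
by move=> ux; exists x, x; rewrite unit_src // unit_rng // mul_src_unit ?unit_src.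
Qed.

(* Units and inverses are preserved automatically, the target being a group. *)
Lemma approximate_hom_sofic (th : full_group G -> forall k, {perm 'I_k.+1}) :
  (forall x y, dens (fun k i => th x k i != th y k i) = mdist x y) ->
  (forall x y, ae (fun k i => th (mmul x y) k i == th x k (th y k i))) ->
  metrically_sofic U (full_group G).
Proof.
move=> thd thm; have sL := @sym_prod_lawful R U UU.
pose pi (t : forall k, {perm 'I_k.+1}) : sym_ultraprod U :=
  @mpi R (prod_monoid U (fun k => sym_group R k.+1)) t.
have pieq (t t' : forall k, {perm 'I_k.+1}) : ae (fun k i => t k i == t' k i) -> pi t = pi t'.
  by move=> H; apply/(mpi_eqP sL).
exists (fun x => pi (th x)); split.
- apply: pieq; have := thm mone mone.
  have -> : mmul mone mone = mone :> full_group G.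
    by rewrite -full_group_elt1 -full_group_elt_mul ?bmul_bone //; exact: full_bone.
  by move=> H; apply: (ae_imp H) => k i; rewrite perm1 (inj_eq perm_inj) eq_sym.
- move=> x y; rewrite (mquot_mul sL); apply: (pieq _ (fun k => th y k * th x k)%g).
  by apply: (ae_imp (thm x y)) => k i /eqP ->; rewrite permM.
- move=> x; rewrite (mquot_inv sL); apply: (pieq _ (fun k => (th x k)^-1)%g).
  have one : ae (fun k i => th mone k i == i).
    have := thm mone mone.
    have -> : mmul mone mone = mone :> full_group G.
      by rewrite -full_group_elt1 -full_group_elt_mul ?bmul_bone //; exact: full_bone.
    by move=> H; apply: (ae_imp H) => k i; rewrite (inj_eq perm_inj) eq_sym.
  have := thm (minv x) x; have [f Ff ->] := full_group_surj x.
  rewrite -full_group_elt_inv // -full_group_elt_mul //; last exact: full_binv.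
  rewrite bmul_binv // full_group_elt1 => H.
  have := ae_perm (fun k => (th (full_group_elt f) k)^-1)%g (ae_and (UU := UU) H one).
  move=> H2; apply: (ae_imp H2) => k i; rewrite permKV => /andP[/eqP e /eqP].
  by rewrite e => ->.
- by move=> x y; rewrite (mquot_dist sL) -thd.
Qed.

End ApproximateHomomorphism.

(** * Diagonal approximation by permutations of prescribed degree *)

Section Diagonal.
Context {R : realType} (U : set_system nat) {UU : UltraFilter U}.
Hypothesis U_free : forall n : nat, ~ U [set n].

Lemma free_ge M : U [set m | (M <= m)%N].
Proof.
elim: M => [|M IH]; first by apply: (@filterE _ U).
have [/U_free//|H] := in_ultra_setVsetC [set M] UU.
apply: (filterS _ (filterI IH H)) => m [/= Mm ne].
by rewrite ltn_neqAle Mm andbT; apply/eqP => e; apply: ne.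
Qed.

Lemma filter_lt (P : nat -> nat -> Prop) n : (forall i, U (P i)) ->
  U [set k | forall i, (i < n)%N -> P i k].
Proof.
move=> UP; elim: n => [|n IH]; first by apply: (@filterE _ U) => k i.
apply: (filterS _ (filterI IH (UP n))) => k [H1 H2] i; rewrite ltnS leq_eqVlt.
by case/predU1P => [->|]; [exact: H2|exact: H1].
Qed.

Lemma ulim_near (u : nat -> R) l e : (forall k, 0 <= u k <= 1) -> ulim U u = l ->
  0 < e -> U [set k | `|u k - l| <= e].
Proof.
move=> u01 <- e0; have /cvgrPdist_le/(_ e e0) := @ulim_cvg R U UU u u01.
by apply: filterS => k /=; rewrite distrC.
Qed.

(** [J m] is the largest [j <= m] whose threshold [M j] is at most [m]. The bound [M 0 <= m] ensures
    that there is one, and [J] tends to infinity since each [L] qualifies for all large [m]. *)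
Lemma diagonal_index (Q : nat -> nat -> Prop) :
  (forall j, exists M, forall m, (M <= m)%N -> Q j m) ->
  exists J : nat -> nat, forall L, exists M, forall m, (M <= m)%N ->
    (L <= J m)%N /\ Q (J m) m.
Proof.
move=> /choice[M MP].
pose J m := (\max_(j < m.+1 | (M j <= m)%N) j)%N.
exists J => L; exists (maxn (M 0%N) (maxn L (M L))) => m.
rewrite !geq_max => /andP[m0 /andP[mL mML]]; split.
  by have /= := @leq_bigmax_cond _ (fun j : 'I_m.+1 => (M j <= m)%N) val (inord L);
    rewrite inordK ?ltnS //; apply.
have [|j Mj e] := @eq_bigmax_cond _ (fun j : 'I_m.+1 => (M j <= m)%N) (fun j => j : nat).
  by apply/card_gt0P; exists ord0.
by rewrite /J e; exact: MP.
Qed.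

Lemma argmin_nat (u : nat -> R) j :
  exists i, (i <= j)%N /\ forall i', (i' <= j)%N -> u i <= u i'.
Proof.
elim: j => [|j [i [ij H]]].
  by exists 0%N; split=> // i'; rewrite leqn0 => /eqP ->.
have [le|lt] := leP (u i) (u j.+1).
  exists i; split; first exact: ltnW.
  by move=> i'; rewrite leq_eqVlt => /predU1P[->//|/H].
exists j.+1; split=> // i'; rewrite leq_eqVlt => /predU1P[->//|/H h].
exact: (ltW (lt_le_trans lt h)).
Qed.

Context (G : pmpGroupoid R) (H : nat -> pmpGroupoid R).
Hypothesis finH : forall k, finite_set [set: H k].
Variable F : full_semigroup G -> ultraprod U (fun k => full_semigroup (H k)).
Hypothesis F_emb : isometric_embedding F.
Local Notation BS := (borel_full_semigroup G).

Implicit Types a b g h : BS.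

Let lB := borel_full_semigroup_lawful G.
Let lH k := borel_full_semigroup_lawful (H k).
Let lP : lawful (prod_monoid U (fun k => full_semigroup (H k))).
Proof. by apply: prod_monoid_lawful => k; exact: full_semigroup_lawful. Qed.

Definition model (a : BS) k : borel_full_semigroup (H k) := mrepr (mrepr (F (mpi a)) k).

Lemma model_dist a b : ulim U (fun k => mdist (model a k) (model b k)) = mdist a b.
Proof.
have := emb_dist F_emb (mpi a) (mpi b); rewrite (mquot_dist lB) => <-.
by [].
Qed.

Lemma model_mul a b :
  ulim U (fun k => mdist (model (mmul a b) k) (mmul (model a k) (model b k))) = 0.
Proof.
have e : F (mpi (mmul a b)) = mmul (F (mpi a)) (F (mpi b)).
  by rewrite -(emb_mul F_emb) (mquot_mul lB).
have := mrepr_mpi lP (fun k => mpi (mmul (model a k) (model b k))).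
move=> <-; congr ulim; apply/funext => k; rewrite /model e.
by apply: (ldist_eq (lH k)); [exact: (ldist0 (lH k))|rewrite (ldistC (lH k)) (mrepr_mpi (lH k))].
Qed.

Lemma model_one : ulim U (fun k => mdist (model mone k) mone) = 0.
Proof.
have e : F (mpi mone) = mone by rewrite -(emb_one F_emb).
have := mrepr_mpi lP (fun k => mpi mone).
move=> <-; congr ulim; apply/funext => k; rewrite /model e.
by apply: (ldist_eq (lH k)); [exact: (ldist0 (lH k))|rewrite (ldistC (lH k)) (mrepr_mpi (lH k))].
Qed.

Lemma defect_lip (K : pmpGroupoid R) (a b : borel_full_semigroup K) :
  defect a <= defect b + mdist a b.
Proof.
rewrite /defect /= /bdist -/(pm _).
have mE := src_symdiff_meas (bis_val a) (bis_val b).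
apply: le_trans (pmU_le _ mE); last by meas.
apply: pm_le; [by meas|by apply: measurableU => //; meas|].
move=> x [ux na].
case: (pselect ((src (@pmp_mul R K) (@pmp_inv R K) @` val b) x)) => [[k bk kx]|nb].
  by right; exists k => //; right; split=> // ak; apply: na; exists k.
by left.
Qed.

Lemma defect_mul (K : pmpGroupoid R) (a b : borel_full_semigroup K) :
  defect b <= defect (mmul a b).
Proof.
rewrite /defect; apply: pm_le; [by meas|by meas|].
move=> x [ux nb]; split=> // -[g]; rewrite /= val_bmul => -[h [k [ah bk hk ->]]].
by rewrite src_mul // => kx; apply: nb; exists k.
Qed.

Let d01 (K : pmpGroupoid R) (x y : borel_full_semigroup K) : 0 <= mdist x y <= 1.
Proof. by have lK := borel_full_semigroup_lawful K; rewrite (ldist_ge0 lK) (ldist_le1 lK). Qed.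

Lemma model_near_mul a b e : 0 < e ->
  U [set k | mdist (model (mmul a b) k) (mmul (model a k) (model b k)) <= e].
Proof.
move=> e0; apply: (filterS _ (ulim_near _ (model_mul a b) e0)) => k /=; last first.
  exact: d01.
by rewrite subr0; apply: le_trans; exact: ler_norm.
Qed.

(** Since the inverse of [a] times [a] is the unit, the product of their models is close to the
    model of the unit, itself close to the unit, so it has small defect. This bounds the defect of
    the model of [a], whose source contains that of the product. *)
Lemma model_near_defect a e : full (val a) -> 0 < e ->
  U [set k | defect (model a k) <= e].
Proof.
move=> Fa e0; have e2 : 0 < e / 2 by rewrite divr_gt0.
have n1 : U [set k | mdist (model mone k) mone <= e / 2].
  apply: (filterS _ (ulim_near _ model_one e2)) => k /=; last exact: d01.
  by rewrite subr0; apply: le_trans; exact: ler_norm.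
apply: (filterS _ (filterI n1 (model_near_mul (minv a) a e2))) => k [h1 h2].
have {}h1 : mdist (model mone k) mone <= e / 2 := h1.
have eq1 : mmul (minv a) a = mone by exact: bmul_binv.
have {}h2 : mdist (model mone k) (mmul (model (minv a) k) (model a k)) <= e / 2 by rewrite -eq1.
have d0 : defect (mone : borel_full_semigroup (H k)) = 0.
  by rewrite /defect /= image_src_units setDv pm0.
have l1 := defect_mul (model (minv a) k) (model a k).
have l2 := defect_lip (mmul (model (minv a) k) (model a k)) (model mone k).
have l3 := defect_lip (model mone k) mone.
rewrite (ldistC (lH k)) in l2.
have sp := splitr e; rewrite /mkset; lra.
Qed.

Lemma model_near_dist a b e : 0 < e ->
  U [set k | `|mdist (model a k) (model b k) - mdist a b| <= e].
Proof.
move=> e0; apply: ulim_near => //; exact: model_dist.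
Qed.

Lemma model_near_defect_mul a b e : full (val a) -> full (val b) -> 0 < e ->
  U [set k | defect (mmul (model a k) (model b k)) <= e].
Proof.
move=> Fa Fb e0; have e2 : 0 < e / 2 by rewrite divr_gt0.
have Fab : full (val (mmul a b)) by exact: full_bmul.
apply: (filterS _ (filterI (model_near_defect Fab e2) (model_near_mul a b e2))).
move=> k [h1 h2].
have {}h1 : defect (model (mmul a b) k) <= e / 2 := h1.
have {}h2 : mdist (model (mmul a b) k) (mmul (model a k) (model b k)) <= e / 2 := h2.
have l := defect_lip (mmul (model a k) (model b k)) (model (mmul a b) k).
rewrite (ldistC (lH k)) in l; have sp := splitr e; rewrite /mkset; lra.
Qed.

Variable D : nat -> BS.
Hypothesis fullD : forall n, full (val (D n)).
Hypothesis denseD : forall g (eps : R), full (val g) -> 0 < eps -> exists n, mdist g (D n) < eps.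

Let near_index : forall g, exists pi : nat -> nat, forall j, (pi j <= j)%N /\
  forall i, (i <= j)%N -> mdist g (D (pi j)) <= mdist g (D i).
Proof. by move=> g; have [pi piP] := choice (argmin_nat (fun i => mdist g (D i))); exists pi. Qed.

(** At stage [j] only [D 0], ..., [D j] are modelled, so that finitely many conditions are imposed.
    Any [g] is replaced by the nearest of them, at the cost [gap g j], which tends to 0 when [g] is
    full. *)
Definition nearest (g : BS) : nat -> nat := sval (cid (near_index g)).

Definition gap (g : BS) j : R := mdist g (D (nearest g j)).

Lemma nearest_le g j : (nearest g j <= j)%N.
Proof. by rewrite /nearest; case: cid => pi /= piP; case: (piP j). Qed.

Lemma gap_le g i j : (i <= j)%N -> gap g j <= mdist g (D i).
Proof. by rewrite /gap /nearest; case: cid => pi /= piP; case: (piP j) => _; apply. Qed.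

Lemma gap_small g e : full (val g) -> 0 < e ->
  exists L, forall j, (L <= j)%N -> gap g j <= e.
Proof.
move=> Fg e0; have [n gn] := denseD Fg e0; exists n => j nj.
exact: (le_trans (gap_le g nj) (ltW gn)).
Qed.

(** With e the inverse of [j.+1]: the 4 e consist of one for the distance between models, two for
    defects and one for the action. The 7 e consist of two for comparing the model of the product
    with the product of the models, three for the defects and the action in that comparison, and two
    for the multiplicativity of the action. *)
Definition approximates j m (tau : BS -> {perm 'I_m.+1}) : Prop :=
  (forall g h, `|freq (fun y => tau g y != tau h y) - mdist g h| <=
     4 * j.+1%:R^-1 + gap g j + gap h j) /\
  (forall g h, freq (fun y => tau (mmul g h) y != tau g (tau h y)) <=
     7 * j.+1%:R^-1 + gap (mmul g h) j + gap g j + gap h j).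

(** Finitely many conditions are required at stage [j], each true for [U]-many [k], so a single
    finite groupoid [H k] satisfies them all. Its action exists on sets of every large size, with
    [k] depending on [j] and not on [m]. *)
Lemma approximates_exists j : exists M, forall m, (M <= m)%N ->
  exists tau : BS -> {perm 'I_m.+1}, approximates j tau.
Proof.
set e : R := j.+1%:R^-1; have e0 : 0 < e by rewrite invr_gt0 ltr0n.
pose P i i' l k :=
  [/\ `|mdist (model (D i) k) (model (D i') k) - mdist (D i) (D i')| <= e,
      mdist (model (mmul (D i) (D i')) k) (mmul (model (D i) k) (model (D i') k)) <= e,
      `|mdist (model (D l) k) (model (mmul (D i) (D i')) k) -
        mdist (D l) (mmul (D i) (D i'))| <= e,
      defect (model (D i) k) <= e &
      defect (mmul (model (D i) k) (model (D i') k)) <= e].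
have UP i i' l : U (P i i' l).
  have h1 := model_near_dist (D i) (D i') e0.
  have h2 := model_near_mul (D i) (D i') e0.
  have h3 := model_near_dist (D l) (mmul (D i) (D i')) e0.
  have h4 := model_near_defect (fullD i) e0.
  have h5 := model_near_defect_mul (fullD i) (fullD i') e0.
  apply: (filterS _ (filterI (filterI h1 h2) (filterI h3 (filterI h4 h5)))).
  by move=> k [[? ?] [? [? ?]]].
have UQ : U [set k | forall i, (i < j.+1)%N -> forall i', (i' < j.+1)%N ->
    forall l, (l < j.+1)%N -> P i i' l k].
  by apply: filter_lt => i; apply: filter_lt => i'; apply: filter_lt => l.
have [k kP] := filter_ex UQ.
have [M MP] := finite_action (finH k) e0.
exists M => m /MP[phi [phid phim]].
exists (fun g => phi (model (D (nearest g j)) k)).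
have leD g : (nearest g j < j.+1)%N by rewrite ltnS nearest_le.
split=> g h.
  have [c1 _ _ c4 _] := kP _ (leD g) _ (leD h) _ (leD h).
  have [_ _ _ c4' _] := kP _ (leD h) _ (leD h) _ (leD h).
  have := phid (model (D (nearest g j)) k) (model (D (nearest h j)) k).
  set f := freq _ => pd.
  have t1 := ldist_tri lB g (D (nearest g j)) h.
  have t2 := ldist_tri lB (D (nearest g j)) (D (nearest h j)) h.
  have t3 := ldist_tri lB (D (nearest g j)) g (D (nearest h j)).
  have t4 := ldist_tri lB g h (D (nearest h j)).
  rewrite (ldistC lB (D (nearest h j)) h) in t2; rewrite (ldistC lB (D (nearest g j)) g) in t3.
  move: c1 pd; rewrite /gap -/e !ler_norml => /andP[c1 c1'] /andP[pd pd'].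
  by apply/andP; split; lra.
have [_ c2 c3 c4 c5] := kP _ (leD g) _ (leD h) _ (leD (mmul g h)).
have [_ _ _ c4' _] := kP _ (leD (mmul g h)) _ (leD h) _ (leD h).
set a := model (D (nearest g j)) k in c2 c4 c5 *.
set b := model (D (nearest h j)) k in c2 c5 *.
set c := model (D (nearest (mmul g h) j)) k in c3 c4' *.
have := phid c (mmul a b); rewrite ler_norml => /andP[_ pd].
have pm := phim a b.
have tr : freq (fun y => phi c y != phi a (phi b y)) <=
    freq (fun y => phi c y != phi (mmul a b) y) +
    freq (fun y => phi (mmul a b) y != phi a (phi b y)) :> R.
  apply: le_trans (freqU_le _ _); apply: freq_le => y.
  by apply: contraR; rewrite negb_or !negbK => /andP[/eqP -> /eqP ->].
have t1 := ldist_tri (lH k) c (model (mmul (D (nearest g j)) (D (nearest h j))) k) (mmul a b).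
have t2 := ldist_tri lB (D (nearest (mmul g h) j)) (mmul g h)
  (mmul (D (nearest g j)) (D (nearest h j))).
have t3 := ldist_mul lB g (D (nearest g j)) h (D (nearest h j)).
rewrite (ldistC lB (D (nearest (mmul g h) j)) (mmul g h)) in t2.
move: c3; rewrite /gap -/e ler_norml => /andP[_ c3'].
rewrite -[bmul a b]/(mmul a b) in pm.
lra.
Qed.

Lemma diagonal_sofic : metrically_sofic U (full_group G).
Proof.
have [J JP] := diagonal_index approximates_exists.
(* For small [m] there may be no approximation at stage [J m]; the identity is then a
   placeholder. *)
have tauE m : exists tau : BS -> {perm 'I_m.+1},
    (exists tau', @approximates (J m) m tau') -> approximates (J m) tau.
  case: (pselect (exists tau' : BS -> {perm 'I_m.+1}, approximates (J m) tau')) => [[t tP]|nt].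
    by exists t.
  by exists (fun=> 1%g).
pose tau m := sval (cid (tauE m)).
have tauP L : exists M, forall m, (M <= m)%N -> (L <= J m)%N /\ approximates (J m) (tau m).
  have [M MP] := JP L; exists M => m /MP[? ?]; split=> //.
  by rewrite /tau; case: cid => t /=; apply.
pose rep (x : full_group G) : BS := sval (cid2 (full_group_surj x)).
have repF x : full (val (rep x)) by rewrite /rep; case: cid2.
have repE x : x = full_group_elt (rep x) by rewrite {1}/rep; case: cid2.
have distE x y : mdist (rep x) (rep y) = mdist x y.
  by rewrite -full_group_elt_dist // -!repE.
pose small (u : nat -> R) := forall eps, 0 < eps -> exists L, forall j, (L <= j)%N -> u j <= eps.
have smallD u v : small u -> small v -> small (fun j => u j + v j).
  move=> su sv eps eps0; have e2 : 0 < eps / 2 by rewrite divr_gt0.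
  have [L LP] := su _ e2; have [L' LP'] := sv _ e2; exists (maxn L L') => j.
  by rewrite geq_max => /andP[/LP h1 /LP' h2]; have sp := splitr eps; lra.
have smallC (c : R) : 0 < c -> small (fun j => c * j.+1%:R^-1).
  move=> c0 eps eps0; exists (Num.truncn (c / eps)) => j jL.
  rewrite ler_pdivrMr ?ltr0n // mulrC -ler_pdivrMr //.
  by apply/ltW/(lt_le_trans (truncnS_gt _)); rewrite ler_nat ltnS.
have smallG x : small (gap (rep x)) by move=> eps; exact: gap_small.
have near_of (u : nat -> R) (P : nat -> Prop) eps : small u -> 0 < eps ->
    (forall m, approximates (J m) (tau m) -> u (J m) <= eps -> P m) -> U P.
  move=> su eps0 uP; have [L LP] := su _ eps0; have [M MP] := tauP L.
  apply: (filterS _ (free_ge M)) => m /= /MP[LJ ap].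
  by apply: uP => //; exact: LP.
apply: (@approximate_hom_sofic R U UU G (fun x k => tau k (rep x))).
  move=> x y; apply: cvg_ulim; apply/cvgrPdist_le => eps eps0.
  apply: (near_of _ _ _ (smallD _ _ (smallD _ _ (smallC 4 _) (smallG x)) (smallG y)) eps0) => //.
  move=> m [ad _] le; cbv beta; rewrite distrC -distE; apply: le_trans le; exact: ad.
move=> x y; apply: cvg_ulim; apply/cvgrPdist_le => eps eps0.
pose z := mmul (rep x) (rep y).
have Fz : full (val z) by exact: full_bmul.
(* The representative of a product need not be the product of the representatives. They are at
   distance 0, so the first clause of [approximates] compares their permutations. *)
have zE : mdist (rep (mmul x y)) z = 0.
  rewrite -full_group_elt_dist // -repE full_group_elt_mul // -!repE.
  have [f Ff ->] := full_group_surj (mmul x y).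
  by rewrite full_group_elt_dist // (ldist0 lB).
have smallz : small (gap z) by move=> e; exact: gap_small.
have p4 : (0 : R) < 4 by [].
have p7 : (0 : R) < 7 by [].
have su := smallD _ _ (smallD _ _ (smallD _ _ (smallC 4 p4) (smallG (mmul x y))) smallz)
  (smallD _ _ (smallD _ _ (smallD _ _ (smallC 7 p7) smallz) (smallG x)) (smallG y)).
apply: (near_of _ _ _ su eps0) => m [ad am] le; cbv beta.
rewrite sub0r normrN ger0_norm; last by rewrite /freq divr_ge0.
apply: le_trans le.
have := ad (rep (mmul x y)) z; rewrite zE subr0 => h1.
have h2 := am (rep x) (rep y).
apply: (@le_trans _ _ (freq (fun y0 => tau m (rep (mmul x y)) y0 != tau m z y0) +
   freq (fun y0 => tau m z y0 != tau m (rep x) (tau m (rep y) y0)))).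
  apply: le_trans (freqU_le _ _); apply: freq_le => i.
  by apply: contraR; rewrite negb_or !negbK => /andP[/eqP -> /eqP ->].
by apply: lerD => //; apply: le_trans h1; exact: ler_norm.
Qed.

End Diagonal.

Theorem theorem4p5 (R : realType) (U : set_system nat)
    (U_ultra : UltraFilter U) (U_free : forall n : nat, ~ U [set n])
    (G : pmpGroupoid R) (G_aperiodic : aperiodic G) :
  (sofic U G <-> metrically_sofic U (full_group G)) /\
  (forall theta : full_group G -> sym_ultraprod U,
     isometric_embedding theta ->
     exists! Theta : full_semigroup G -> square_ultraprod U,
       isometric_embedding Theta /\
       forall g : full_group G,
         Theta (full_group_incl g) = sym_ultraprod_incl (theta g)).
Proof.
split; [split|].
- move=> [H [finH [F F_emb]]].
  have [D [fullD denseD]] := dense_full_sequence G.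
  exact: (diagonal_sofic U_free finH F_emb fullD denseD).
(* The target of the extension is itself an ultraproduct of full semigroups of finite groupoids, so
   the extension witnesses soficity. *)
- move=> [theta theta_emb]; exists (fun k => sq_pmp R k); split.
    by move=> k; exact: sq_finite.
  exists (extension_map theta).
  exact: (extension_map_emb G_aperiodic theta_emb).
- move=> theta theta_emb; exists (extension_map theta); split.
    split; first exact: (extension_map_emb G_aperiodic theta_emb).
    exact: (extension_map_incl G_aperiodic theta_emb).
  move=> Theta [ThE ThI]; apply/esym.
  exact: (extension_unique G_aperiodic theta_emb ThE ThI).
Qed.
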